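(* Let $L_+,L_-$ be self-adjoint operators on a Hilbert space $\mathcal{X}$ satisfying assumptions (P1) and (P2) of the context, let $A$, $K$, $\mathcal{H}$, $\delta$ be as in the context, and assume that all embedded eigenvalues of the generalized eigenvalue problem $Au=\gamma Ku$, $u\in\mathcal{H}$, are simple. Then the eigenvalues of this problem satisfy the pair of equalities $$N_p^-+N_n^0+N_n^++N_{c^+}=\dim(\mathcal{H}_{A+\delta K}^-),$$ $$N_n^-+N_n^0+N_n^++N_{c^+}=\dim(\mathcal{H}_K^-).$$
   Context: Let $\mathcal{X}$ be a Hilbert space with inner product $(\cdot,\cdot)$ and $L_\pm$ self-adjoint operators on it such that: (P1) the essential spectrum of $L_\pm$ consists of an absolutely continuous part $\sigma_c(L_\pm)$, bounded from below by $\omega_+\ge0$ for $L_+$ and by $\omega_->0$ for $L_-$, and finitely many embedded eigenvalues of finite multiplicities; (P2) the discrete spectrum of $L_\pm$ consists of finitely many isolated eigenvalues of finite multiplicities, with $p(L_\pm)$ positive, $z(L_\pm)$ zero and $n(L_\pm)$ negative eigenvalues (counted with multiplicity). Let $\mathcal{H}=\{u\in\mathcal{X}:u\perp\ker L_-\}$, let $\mathcal{P}$ be the orthogonal projection of $\mathcal{X}$ onto $\mathcal{H}$, and let $A=\mathcal{P}L_+\mathcal{P}$, $K=\mathcal{P}L_-^{-1}\mathcal{P}$, considered as self-adjoint operators on $\mathcal{H}$ ($K$ is bounded with trivial kernel). For a self-adjoint operator $S$ on $\mathcal{H}$, $\mathcal{H}_S^-$ denotes the span of the eigenvectors of $S$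 for its negative isolated eigenvalues. One has $\dim\mathcal{H}_K^-=n(L_-)=:\kappa$. The number $\delta$ satisfies $0<\delta<|\sigma_{-1}|$, where $\sigma_{-1}$ is the negative eigenvalue of $K^{-1}A$ smallest in absolute value. It is assumed that $\omega_{A+\delta K}:=\min\sigma_c(A+\delta K)>0$ for $\delta>0$ even if $\omega_+=0$ (so that $A+\delta K$ is continuously invertible). Put $[u,v]=(Ku,v)$. This form turns (the extension of) $\mathcal{H}$ into a Pontryagin space $\Pi_\kappa$. Eigenvalues $\gamma$ of $Au=\gamma Ku$ are those of $K^{-1}A$; isolated/embedded means isolated from/embedded in the essential spectrum. For a real eigenvalue $\gamma_0$ with generalized eigenspace $\mathcal{H}_{\gamma_0}$ (span of all Jordan chains), let $N_p(\gamma_0)$ (resp. $N_n(\gamma_0)$) be the maximal dimension of a subspace of $\mathcal{H}_{\gamma_0}$ on which $[u,u]\ge0$ (resp. $[u,u]\le0$). Explicitly, for an isolated eigenvalue with a single Jordan chain $f_1,\dots,f_n$: $N_p=N_n=k$ if $n=2k$; if $n=2k+1$, then $(N_p,N_n)=(k+1,k)$ when $[f_1,f_n]>0$ and $(k,k+1)$ when $[f_1,f_n]<0$. For a simple embedded eigenvalue with eigenvector $f_1$: $(N_p,N_n)=(1,0)$ if $[f_1,f_1]>0$, $(0,1)$ if $[f_1,f_1]<0$, $(1,1)$ if $[f_1,f_1]=0$. $N_p^-,N_n^-$ are the sums of $N_p(\gamma_0)$, $N_n(\gamma_0)$ over negative eigenvalues $\gamma_0<0$; $N_p^0,N_n^0$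 are these numbers for $\gamma_0=0$; $N_p^+,N_n^+$ are the sums over positive eigenvalues $\gamma_0>0$ (isolated and embedded). $N_{c^+}$ ($N_{c^-}$) is the number of complex eigenvalues with $\operatorname{Im}\gamma>0$ ($\operatorname{Im}\gamma<0$), with algebraic multiplicity. *)

(* Defs.v *)
From HB Require Import structures.
From mathcomp Require Import all_boot all_order all_algebra.
From mathcomp Require Import complex.
From mathcomp Require Import all_classical all_reals all_analysis.

Set Implicit Arguments.
Unset Strict Implicit.
Unset Printing Implicit Defensive.

Import Order.TTheory GRing.Theory Num.Theory.
Import numFieldNormedType.Exports.

Local Open Scope classical_set_scope.
Local Open Scope complex_scope.
Local Open Scope ring_scope.

Section Hilbert.
Variables (R : realType) (X : completeNormedModType R[i]).
Implicit Types (V W S : set X) (z : R[i]).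

(* A Hilbert space is a complete normed space whose norm comes from an inner
   product, linear in the first variable.  Note that [`|u| : R[i]], and that
   [0 <= w] for [w : R[i]] means that [w] is real and nonnegative. *)
Definition inner_product (ip : X -> X -> R[i]) : Prop :=
  [/\ forall a u v w, ip (a *: u + v) w = a * ip u w + ip v w,
      forall u v, ip v u = (ip u v)^*%C
    & forall u, ip u u = `|u| ^+ 2].

Definition subspace V : Prop :=
  V 0 /\ forall a u v, V u -> V v -> V (a *: u + v).

Definition lspan S : set X :=
  [set u | forall W, subspace W -> S `<=` W -> W u].

Definition lin_indep n (v : 'I_n -> X) : Prop :=
  forall c : 'I_n -> R[i], \sum_(i < n) c i *: v i = 0 -> forall i, c i = 0.

Definition ldim V : \bar R :=
  ereal_sup [set n%:R%:E | n in [set n | exists v : 'I_n -> X,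
    (forall i, V (v i)) /\ lin_indep v]].

(* A partially defined operator; the values outside [dom] are irrelevant. *)
Record operator := Operator { dom : set X; app :> X -> X }.
Implicit Types (A K L T : operator).

Definition op_id V := Operator V id.

Definition op_add A K := Operator (dom A `&` dom K) (fun u => A u + K u).

Definition op_scale z K := Operator (dom K) (fun u => z *: K u).

Definition op_restrict L V := Operator (dom L `&` V) L.

Definition op_ker L : set X := [set u | dom L u /\ L u = 0].

(* K^{-1} A, for K injective *)
Definition op_ldiv K A := Operator
  [set u | dom A u /\ exists2 w, dom K w & K w = A u]
  (fun u => xget 0 [set w | dom K w /\ K w = A u]).

(* [T - z] is a bijection from [dom T] onto [V] with a bounded inverse; here
   [T] is an operator in the subspace [V]. *)
Definition resolvent_set V T : set R[i] := [set z |
  (forall f, V f -> exists2 u, dom T u & T u - z *: u = f) /\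
  exists c : R, forall u, dom T u -> `|u| <= c%:C * `|T u - z *: u|].

Definition spectrum V T : set R[i] := ~` resolvent_set V T.

(* [f 0, ..., f n] is a Jordan chain of [A u = z K u]. *)
Definition jordan_chain A K z n (f : nat -> X) : Prop :=
  [/\ forall j, (j <= n)%N -> dom A (f j) /\ dom K (f j),
      f 0%N != 0, A (f 0%N) = z *: K (f 0%N)
    & forall j, (j < n)%N -> A (f j.+1) = z *: K (f j.+1) + K (f j)].

Definition gen_eigenspace A K z : set X :=
  lspan [set u | exists n f, jordan_chain A K z n f /\
    exists2 j, (j <= n)%N & u = f j].

Definition eigenvector A K z u : Prop :=
  [/\ dom A u, dom K u, u != 0 & A u = z *: K u].

Definition is_eigenvalue A K : set R[i] :=
  [set z | exists u, eigenvector A K z u].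

Definition alg_mult A K z : \bar R := ldim (gen_eigenspace A K z).

(* Isolated points of the spectrum that are eigenvalues of finite algebraic
   multiplicity (for a self-adjoint operator all Jordan chains have length one,
   so the algebraic multiplicity is the dimension of the eigenspace). *)
Definition discrete_spectrum V T : set R[i] := [set z |
  [/\ spectrum V T z,
      exists2 e : R, 0 < e &
        forall w, spectrum V T w -> `|w - z| < e%:C -> w = z,
      is_eigenvalue T (op_id V) z
    & (alg_mult T (op_id V) z < +oo)%E]].

Definition essential_spectrum V T : set R[i] :=
  spectrum V T `\` discrete_spectrum V T.

Section InnerProduct.
Variable ip : X -> X -> R[i].

Definition orthocomplement V : set X :=
  [set u | forall v, V v -> ip u v = 0].

Definition proj V (u : X) : X :=
  xget 0 [set v | V v /\ orthocomplement V (u - v)].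

(* [T] is a densely defined operator in the closed subspace [V] that equals its
   adjoint. *)
Definition self_adjoint V T : Prop :=
  [/\ subspace (dom T), dom T `<=` V, V `<=` closure (dom T),
      forall u, dom T u -> V (T u)
    & (forall a u v, dom T u -> dom T v -> T (a *: u + v) = a *: T u + T v)
      /\ forall v w, V v -> V w ->
           (forall u, dom T u -> ip (T u) v = ip u w) <-> dom T v /\ T v = w].

(* [mu] is the spectral measure of the self-adjoint operator [T] at the vector
   [u]; it is determined by its Borel transform
   ((T - z)^{-1} u, u) = \int (t - z)^{-1} d mu(t) for z nonreal. *)
Definition spectral_measure T (u : X)
    (mu : {finite_measure set (measurableTypeR R) -> \bar R}) : Prop :=
  forall z v, complex.Im z != 0 -> dom T v -> T v - z *: v = u ->
    ip v u = Complex
      (Rintegral mu setT (fun t : R => complex.Re (t%:C - z)^-1))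
      (Rintegral mu setT (fun t : R => complex.Im (t%:C - z)^-1)).

Definition ac_subspace V T : set X :=
  [set u | V u /\ exists mu : {finite_measure set (measurableTypeR R) -> \bar R},
    spectral_measure T u mu /\ mu `<< @lebesgue_measure R].

Definition ac_spectrum V T : set R[i] :=
  spectrum (ac_subspace V T) (op_restrict T (ac_subspace V T)).

Definition embedded_eigenvalues V T : set R[i] :=
  is_eigenvalue T (op_id V) `&` essential_spectrum V T.

(* The essential spectrum consists of an absolutely continuous part, bounded
   from below by [omega], and of finitely many embedded eigenvalues of finite
   multiplicity.  The last clause says that there is no singular continuous
   part: all vectors orthogonal to the eigenvectors are in the absolutely
   continuous subspace. *)
Definition essential_spectrum_assumption L (omega : R) : Prop :=
  [/\ essential_spectrum setT L =
        ac_spectrum setT L `|` embedded_eigenvalues setT L,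
      forall z, ac_spectrum setT L z -> omega%:C <= z,
      finite_set (embedded_eigenvalues setT L),
      forall z, embedded_eigenvalues setT L z ->
        (alg_mult L (op_id setT) z < +oo)%E
    & orthocomplement [set u | exists z, eigenvector L (op_id setT) z u]
        `<=` ac_subspace setT L].

(* The finiteness of the multiplicities is part of [discrete_spectrum]. *)
Definition discrete_spectrum_assumption L : Prop :=
  finite_set (discrete_spectrum setT L).

Section Pencil.
Variables Lp Lm : operator.

Definition spaceH : set X := orthocomplement (op_ker Lm).

Definition projH : X -> X := proj spaceH.

(* P L_+ P as an operator in H *)
Definition opA := Operator
  [set u | spaceH u /\ dom Lp (projH u)] (fun u => projH (Lp (projH u))).

(* P L_-^{-1} P as an operator in H: the two preimages of a vector under L_-
   differ by an element of ker L_-, which is annihilated by the outer P. *)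
Definition opK := Operator
  [set u | spaceH u /\ exists2 v, dom Lm v & Lm v = projH u]
  (fun u => projH (xget 0 [set v | dom Lm v /\ Lm v = projH u])).

Definition opAK (delta : R) := op_add opA (op_scale delta%:C opK).

(* the dimension of H_T^-, for T self-adjoint in H *)
Definition neg_dim T : \bar R :=
  ldim (lspan [set u | exists z,
    [/\ z < 0, discrete_spectrum spaceH T z & eigenvector T (op_id spaceH) z u]]).

Definition krein (u v : X) : R[i] := ip (opK u) v.

Definition Np z : \bar R := ereal_sup [set ldim W | W in [set W |
  [/\ subspace W, W `<=` gen_eigenspace opA opK z
    & forall u, W u -> 0 <= krein u u]]].

Definition Nn z : \bar R := ereal_sup [set ldim W | W in [set W |
  [/\ subspace W, W `<=` gen_eigenspace opA opK z
    & forall u, W u -> krein u u <= 0]]].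

(* The sums over eigenvalues are unconditional sums in [0, +oo].  The order on
   R[i] being partial, [z < 0] and [0 < z] imply that [z] is real. *)
Definition Np_neg : \bar R := esum [set z | is_eigenvalue opA opK z /\ z < 0] Np.
Definition Nn_neg : \bar R := esum [set z | is_eigenvalue opA opK z /\ z < 0] Nn.
Definition Nn_zero : \bar R := Nn 0.
Definition Nn_pos : \bar R := esum [set z | is_eigenvalue opA opK z /\ 0 < z] Nn.
Definition Nc_plus : \bar R :=
  esum [set z | is_eigenvalue opA opK z /\ 0 < complex.Im z] (alg_mult opA opK).

(* embedded in the essential spectrum of K^{-1} A in H *)
Definition pencil_embedded_eigenvalues : set R[i] :=
  is_eigenvalue opA opK `&` essential_spectrum spaceH (op_ldiv opK opA).

End Pencil.
End InnerProduct.
End Hilbert.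

(* Main.v *)
Require Import Defs.
From HB Require Import structures.
From mathcomp Require Import all_boot all_order all_algebra.
From mathcomp Require Import complex.
From mathcomp Require Import all_classical all_reals all_analysis.
From mathcomp Require Import ring lra.
Import Order.TTheory GRing.Theory Num.Theory.
Import numFieldNormedType.Exports.

(** Let [H] be the complement of the kernel of [Lm], on which [K] is the inverse of
    [Lm], and let [G] be the inverse of [A + delta K] on [H]. With
    [mu = z + delta] the equation [A u = z K u] becomes [u = mu S u], where
    [S = G K]. Extended by zero, [K] and [G] are bounded symmetric operators that
    are injective on [H], and their forms have finitely many negative squares, so
    that [S] is a symmetric operator in a Pontryagin space in two ways: for the
    form [[u, v] = (K u, v)], and after the interchange of the two operators, which
    replaces [S] by [K G], for the form [(G u, v)]. The Jordan chains of the pencil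
    are those of [S] ([gen_eigenspaceE]).

    Let [kappa] be the number of negative squares of [(K u, u)]. Pontryagin's theorem
    ([pontryagin]) provides an invariant nonpositive subspace of dimension [kappa]
    with [mu] in the closed upper half plane, and this subspace is the direct sum of
    its root subspaces. Conversely, root spaces for different numbers of the
    closed upper half plane are orthogonal and those for nonreal numbers are
    neutral, so that nonpositive root subspaces add up to a nonpositive subspace, whose
    dimension is at most [kappa]. Therefore the dimensions of maximal nonpositive
    subspaces of the root spaces, over the closed upper half plane, have the sum
    [kappa] ([dimension_sum]). This is the second equality.

    The first one is the same statement for the interchanged operators. On the root
    space for a real [mu] a polynomial in [S] that is a square root of the inverse of
    [mu S] carries [(G h, h)] to [mu [u, u]] ([swap_family]). Hence nonpositive
    subspaces for [G] correspond to nonpositive subspaces for [K] if [mu > 0], and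
    to nonnegative ones if [mu < 0]. As [delta] is smaller than the modulus of every
    negative eigenvalue [z], the number [mu] is negative for these and positive for
    [z >= 0].

    It remains to see that the numbers of negative squares are finite and equal to the
    dimensions of the negative eigenspaces. Below zero the spectra of [Lp] and [Lm]
    consist of finitely many eigenvalues of finite multiplicity ([spectrum_below]), and
    off their eigenvectors the forms are nonnegative ([nonneg_off_eigenvectors]).
    No spectral theorem enters here: a bound for the resolvent in a gap
    ([gap_lower_bound]) and the removal of isolated points of the spectrum
    ([isolated_point_removed]) suffice. The second point is Pontryagin's theorem once
    more, with the identity in the place of one of the operators
    ([negative_eigenspace_dim]).

    For Pontryagin's theorem itself, the operator is compressed to finite-dimensional
    subspaces and perturbed so that it becomes strictly dissipative. Then there are no
    real eigenvalues, and the eigenvectors for one half plane span a negative subspace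
    of the right dimension ([dissipative_negative_subspace]). These subspaces converge
    along an ultrafilter, because they are graphs over a fixed negative subspace. *)

Set Implicit Arguments.
Unset Strict Implicit.
Unset Printing Implicit Defensive.
Local Open Scope classical_set_scope.
Local Open Scope complex_scope.
Local Open Scope ring_scope.

Local Notation Re := (@complex.Re _).
Local Notation Im := (@complex.Im _).
Local Notation subspace := Defs.subspace.

(** * Complex scalars and hermitian forms *)

Section Scalars.
Variable R : realType.
Implicit Types (z w : R[i]) (x y : R).

(** The squared modulus, as a real number: with it all estimates take place in
    [R], where [lra] and [nra] apply. *)
Definition sqm z : R := Re z ^+ 2 + Im z ^+ 2.

Lemma cReD z w : Re (z + w) = Re z + Re w. Proof. by case: z w => ? ? []. Qed.
Lemma cImD z w : Im (z + w) = Im z + Im w. Proof. by case: z w => ? ? []. Qed.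
Lemma cReN z : Re (- z) = - Re z. Proof. by case: z. Qed.
Lemma cImN z : Im (- z) = - Im z. Proof. by case: z. Qed.
Lemma cReB z w : Re (z - w) = Re z - Re w. Proof. by rewrite cReD cReN. Qed.
Lemma cReM z w : Re (z * w) = Re z * Re w - Im z * Im w.
Proof. by case: z w => ? ? []. Qed.
Lemma cImM z w : Im (z * w) = Re z * Im w + Im z * Re w.
Proof. by case: z w => ? ? []. Qed.
Lemma cRe_conj z : Re z^*%C = Re z. Proof. by case: z. Qed.
Lemma cIm_conj z : Im z^*%C = - Im z. Proof. by case: z. Qed.
Lemma cReR x : Re x%:C = x. Proof. by []. Qed.
Lemma cImR x : Im x%:C = 0. Proof. by []. Qed.
Lemma complexP z w : Re z = Re w -> Im z = Im w -> z = w.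
Proof. by case: z w => a b [c d] /= -> ->. Qed.
Lemma conjc_Im0 z : Im z = 0 -> z^*%C = z.
Proof. by move=> h; apply: complexP; rewrite ?cRe_conj ?cIm_conj ?h ?oppr0. Qed.
Lemma sqm_ge0 z : 0 <= sqm z.
Proof. by rewrite /sqm addr_ge0 ?sqr_ge0. Qed.
Lemma sqmM z w : sqm (z * w) = sqm z * sqm w.
Proof. rewrite /sqm cReM cImM; ring. Qed.
Lemma sqmR x : sqm x%:C = x ^+ 2. Proof. by rewrite /sqm /= expr0n addr0. Qed.
Lemma sqm_conj z : sqm z^*%C = sqm z. Proof. by case: z => a b; rewrite /sqm /= sqrrN. Qed.
Lemma sqm_eq0 z : sqm z = 0 -> z = 0.
Proof.
move=> h; have := sqr_ge0 (Re z); have := sqr_ge0 (Im z) => h1 h2.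
apply: complexP; apply/eqP; rewrite -sqrf_eq0; apply/eqP=> /=.
- by rewrite /sqm in h; lra.
- by rewrite /sqm in h; lra.
Qed.
Lemma sqm_gt0 z : z != 0 -> 0 < sqm z.
Proof.
move=> z0; rewrite lt_def sqm_ge0 andbT; apply/eqP => /sqm_eq0 h.
by rewrite h eqxx in z0.
Qed.
Lemma conjc_sqm z : z * z^*%C = (sqm z)%:C.
Proof. by apply: complexP; rewrite ?cReM ?cImM cRe_conj cIm_conj /sqm /=; ring. Qed.
Lemma normc_sqm z : `|z| ^+ 2 = (sqm z)%:C.
Proof. by rewrite -add_Re2_Im2. Qed.
Lemma sqmN z : sqm (- z) = sqm z. Proof. by rewrite /sqm cReN cImN !sqrrN. Qed.
Lemma sqmD_le z w : sqm (z + w) <= 2 * sqm z + 2 * sqm w.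
Proof.
rewrite /sqm cReD cImD.
have := sqr_ge0 (Re z - Re w); have := sqr_ge0 (Im z - Im w).
by nra.
Qed.
Lemma le_eps x y : (forall e : R, 0 < e -> x <= y + e) -> x <= y.
Proof. by move=> h; apply/ler_addgt0Pr => e; exact: h. Qed.
End Scalars.

Definition hermitian_form (R : realType) (E : lmodType R[i])
    (b : E -> E -> R[i]) : Prop :=
  (forall a u v w, b (a *: u + v) w = a * b u w + b v w) /\
  (forall u v, b v u = (b u v)^*%C).

(** For a hermitian form the imaginary part on the diagonal vanishes, and the
    quadratic form takes its values in [R]. *)
Definition qf (R : realType) (E : lmodType R[i]) (b : E -> E -> R[i]) u : R :=
  Re (b u u).

Section Herm.
Variables (R : realType) (E : lmodType R[i]) (b : E -> E -> R[i]).
Hypothesis hb : hermitian_form b.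
Local Notation q := (qf b).

Lemma herm_conj u v : b v u = (b u v)^*%C. Proof. exact: hb.2. Qed.
Lemma hermDl u v w : b (u + v) w = b u w + b v w.
Proof. by have := hb.1 1 u v w; rewrite scale1r mul1r. Qed.
Lemma herm0l w : b 0 w = 0.
Proof. by have := hermDl 0 0 w; rewrite addr0 => /eqP; rewrite -subr_eq subrr eq_sym => /eqP. Qed.
Lemma hermZl a u w : b (a *: u) w = a * b u w.
Proof. by have := hb.1 a u 0 w; rewrite addr0 herm0l addr0. Qed.
Lemma hermNl u w : b (- u) w = - b u w.
Proof. by rewrite -scaleN1r hermZl mulN1r. Qed.
Lemma hermBl u v w : b (u - v) w = b u w - b v w.
Proof. by rewrite hermDl hermNl. Qed.
Lemma hermDr u v w : b w (u + v) = b w u + b w v.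
Proof. by rewrite herm_conj hermDl rmorphD /= -!herm_conj. Qed.
Lemma herm0r w : b w 0 = 0.
Proof. by rewrite herm_conj herm0l conjc0. Qed.
Lemma hermZr a u w : b w (a *: u) = a^*%C * b w u.
Proof. by rewrite herm_conj hermZl rmorphM /= -herm_conj. Qed.
Lemma hermNr u w : b w (- u) = - b w u.
Proof. by rewrite herm_conj hermNl rmorphN /= -herm_conj. Qed.
Lemma hermBr u v w : b w (u - v) = b w u - b w v.
Proof. by rewrite hermDr hermNr. Qed.
Lemma herm_sumr I (r : seq I) (P : pred I) (F : I -> E) w :
  b w (\sum_(i <- r | P i) F i) = \sum_(i <- r | P i) b w (F i).
Proof.
by apply: (big_morph (fun u => b w u)); [move=> u v; exact: hermDr | exact: herm0r].
Qed.

Lemma Im_herm u : Im (b u u) = 0.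
Proof. have := congr1 Im (herm_conj u u); rewrite cIm_conj => h; lra. Qed.
Lemma hermE u : b u u = (q u)%:C.
Proof. by apply: complexP => //=; rewrite Im_herm. Qed.
Lemma qf0 : q 0 = 0. Proof. by rewrite /qf herm0l. Qed.
Lemma qfZ a u : q (a *: u) = sqm a * q u.
Proof.
by rewrite /qf hermZl hermZr mulrA conjc_sqm hermE cReM /= mul0r subr0.
Qed.
Lemma qfN u : q (- u) = q u.
Proof. by rewrite -scaleN1r qfZ /sqm /= oppr0 expr0n addr0 sqrrN expr1n mul1r. Qed.
Lemma qfD u v : q (u + v) = q u + q v + 2 * Re (b u v).
Proof.
rewrite /qf hermDl !hermDr !cReD [b v u]herm_conj cRe_conj; ring.
Qed.
Lemma qfB u v : q (u - v) = q u + q v - 2 * Re (b u v).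
Proof. by rewrite qfD qfN hermNr cReN mulrN. Qed.
Lemma qfBC u v : q (u - v) = q (v - u).
Proof. by rewrite -opprB qfN. Qed.
Lemma qf_parallelogram u v : q (u + v) + q (u - v) = 2 * q u + 2 * q v.
Proof. rewrite qfB qfD; ring. Qed.

Section CauchySchwarz.
Variable V : set E.
Hypothesis sV : forall a u v, V u -> V v -> V (a *: u + v).
Hypothesis pV : forall w, V w -> 0 <= q w.

(** Semidefiniteness is assumed on [V] only: the form of interest is
    indefinite on the whole space. *)
Lemma herm_CS u v : V u -> V v -> sqm (b u v) <= q u * q v.
Proof.
move=> Vu Vv.
have key (t : R) : 0 <= q v * (t ^+ 2 * sqm (b u v)) + q u - 2 * t * sqm (b u v).
  have := pV (sV (- (t%:C * b u v)) Vv Vu).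
  rewrite qfD qfZ sqmN sqmM sqmR hermZl [b v u]herm_conj.
  rewrite cReM cReN cImN cRe_conj cIm_conj !cReM !cImM cReR cImR /sqm; nra.
have v0 := pV Vv; have u0 := pV Vu; have s0 := sqm_ge0 (b u v).
have [vz|vn0] := eqVneq (q v) 0.
  rewrite vz mulr0 leNgt; apply/negP => sp.
  have := key ((q u + 1) / sqm (b u v)).
  by rewrite vz mul0r add0r -mulrA divfK ?gt_eqF //; lra.
have vp : 0 < q v by rewrite lt_def vn0 v0.
have := key (q v)^-1.
have -> : q v * ((q v)^-1 ^+ 2 * sqm (b u v)) = (q v)^-1 * sqm (b u v).
  by rewrite expr2 -[_ * _ * sqm _]mulrA mulrA mulfV ?mul1r.
have : 0 <= (q v)^-1 by rewrite invr_ge0.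
move=> iv0 h.
have {}h : 0 <= q u - (q v)^-1 * sqm (b u v) by lra.
by rewrite -ler_pdivrMr // mulrC; lra.
Qed.

Lemma herm_CS_Re u v : V u -> V v -> Re (b u v) ^+ 2 <= q u * q v.
Proof.
move=> Vu Vv; apply: le_trans (herm_CS Vu Vv).
by rewrite /sqm lerDl sqr_ge0.
Qed.

Lemma qfD_le u v : V u -> V v -> q (u + v) <= 2 * q u + 2 * q v.
Proof.
move=> Vu Vv; rewrite -qf_parallelogram lerDl; apply: pV.
by rewrite -scaleN1r addrC; apply: sV.
Qed.
End CauchySchwarz.
End Herm.

(** * Closed subspaces, functionals and inverses in the Hilbert space *)

Section Hilbert.
Variables (R : realType) (X : completeNormedModType R[i]).
Variable (ip : X -> X -> R[i]).
Hypothesis hip : inner_product ip.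
Implicit Types (u v w : X) (V : set X).

Lemma ip_herm : hermitian_form ip.
Proof. by case: hip. Qed.
Local Notation hI := ip_herm.
Local Notation n2 := (qf ip).

Lemma normE u : `|u| = (Num.sqrt (n2 u))%:C.
Proof.
have [_ _ h] := hip; rewrite /qf h.
have : 0 <= `|u| by [].
case: (`|u|) => a b; rewrite lecE => /andP[/= /eqP -> a0].
by rewrite /= mul0r subr0 -expr2 sqrtr_sqr ger0_norm.
Qed.
Lemma n2_ge0 u : 0 <= n2 u.
Proof.
have [_ _ h] := hip; rewrite /qf h.
have : 0 <= `|u| by [].
case: (`|u|) => a b; rewrite lecE => /andP[/= /eqP -> a0].
by rewrite /= mul0r subr0 mulr_ge0.
Qed.
Lemma n2_eq0 u : n2 u = 0 -> u = 0.
Proof. by move=> h; apply/normr0_eq0; rewrite normE h sqrtr0. Qed.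
Lemma n2_gt0 u : u != 0 -> 0 < n2 u.
Proof.
move=> u0; rewrite lt_def n2_ge0 andbT; apply/eqP => /n2_eq0 h.
by rewrite h eqxx in u0.
Qed.
Lemma norm_le_n2 c u v : 0 <= c -> n2 u <= c ^+ 2 * n2 v -> `|u| <= c%:C * `|v|.
Proof.
move=> c0 h; rewrite !normE -rmorphM lecR.
have -> : c * Num.sqrt (n2 v) = Num.sqrt (c ^+ 2 * n2 v).
  by rewrite sqrtrM ?sqr_ge0 // sqrtr_sqr ger0_norm.
by rewrite ler_wsqrtr.
Qed.
Lemma n2_le_norm c u v : `|u| <= c%:C * `|v| -> n2 u <= c ^+ 2 * n2 v.
Proof.
rewrite !normE -rmorphM lecR => h.
rewrite -(sqr_sqrtr (n2_ge0 u)) -[n2 v](sqr_sqrtr (n2_ge0 v)) -exprMn.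
by rewrite ler_sqr ?nnegrE ?sqrtr_ge0 // (le_trans _ h) ?sqrtr_ge0.
Qed.
Lemma norm_lt_n2 (e : R) u : 0 < e -> n2 u < e ^+ 2 -> `|u| < e%:C.
Proof.
move=> e0 h; rewrite normE ltcR -[e]ger0_norm ?ltW // -sqrtr_sqr.
by rewrite ltr_sqrt // exprn_gt0.
Qed.
Lemma n2_lt_norm (e : R) u : `|u| < e%:C -> n2 u < e ^+ 2.
Proof.
rewrite normE ltcR => h; rewrite -(sqr_sqrtr (n2_ge0 u)).
by rewrite ltrXn2r // ?sqrtr_ge0 // ltW // (le_lt_trans _ h) ?sqrtr_ge0.
Qed.

Lemma n2D_le u v : n2 (u + v) <= 2 * n2 u + 2 * n2 v.
Proof. by apply: (@qfD_le _ _ _ hI setT) => // w _; exact: n2_ge0. Qed.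
Lemma CS u v : sqm (ip u v) <= n2 u * n2 v.
Proof.
by apply: (@herm_CS _ _ _ hI setT) => // w _; exact: n2_ge0.
Qed.
Lemma CS_Re u v : Re (ip u v) ^+ 2 <= n2 u * n2 v.
Proof. by apply: (@herm_CS_Re _ _ _ hI setT) => // w _; exact: n2_ge0. Qed.

(** Completeness of the space in the form in which minimizing sequences use
    it, with an explicit rate. *)
Lemma complete_seq (c : R) (x : nat -> X) : 0 < c ->
  (forall n m, (n <= m)%N -> n2 (x n - x m) <= c / n.+1%:R) ->
  exists l, forall n, n2 (x n - l) <= 2 * c / n.+1%:R.
Proof.
move=> c0 h.
have rate (e : R) : 0 < e -> exists N, c / N.+1%:R < e.
  move=> e0; exists (Num.truncn (c / e)).
  by rewrite ltr_pdivrMr ?ltr0Sn // mulrC -ltr_pdivrMr // truncnS_gt.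
have : cauchy (x @ \oo).
  apply/cauchy_exP => e e0.
  have [r re] : exists r : R, e = r%:C.
    by exists (Re e); rewrite RRe_real // gtr0_real.
  have r0 : 0 < r by rewrite re ltcR in e0.
  have [N hN] := rate (r ^+ 2) ltac:(by rewrite exprn_gt0).
  exists (x N); exists N => // m /= Nm.
  rewrite -ball_normE /= re; apply: norm_lt_n2 => //.
  by apply: le_lt_trans hN; exact: h.
move/cauchy_cvgP/cvg_ex => -[l xl]; exists l => n.
apply: le_eps => e e0.
move/cvgrPdist_lt : xl => /(_ (Num.sqrt (e / 2))%:C).
have e2 : 0 < Num.sqrt (e / 2) by rewrite sqrtr_gt0 divr_gt0.
rewrite ltcR => /(_ e2) [N _ hN].
have /n2_lt_norm := hN (maxn n N) (leq_maxr _ _).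
rewrite sqr_sqrtr; last by rewrite divr_ge0 // ltW.
move=> h1.
have h2 := h n (maxn n N) (leq_maxl _ _).
have -> : x n - l = (x n - x (maxn n N)) + (x (maxn n N) - l) by rewrite addrA subrK.
apply: le_trans (n2D_le _ _) _.
rewrite (qfBC hI (x (maxn n N))) -[2 * c / _]mulrA.
by move: (n2 _) (n2 _) (c / _) h1 h2 => a b d; lra.
Qed.

(** Closedness in terms of the squared norm, the form in which estimates give
    it. *)
Definition nclosed V := forall u,
  (forall e : R, 0 < e -> exists2 s, V s & n2 (u - s) < e) -> V u.

Lemma orthocomplement_subspace V : subspace (orthocomplement ip V).
Proof.
split=> [v _|a u v hu hv w Vw]; first by rewrite (herm0l hI).
by rewrite (hermDl hI) (hermZl hI) hu // hv // mulr0 addr0.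
Qed.

Lemma orthocomplement_closed V : nclosed (orthocomplement ip V).
Proof.
move=> u h v Vv; apply: sqm_eq0; apply/eqP.
rewrite eq_le sqm_ge0 andbT; apply: le_eps => e e0; rewrite add0r.
have n0 := n2_ge0 v.
have [s Vs hs] := h (e / (n2 v + 1)) ltac:(by rewrite divr_gt0 //; lra).
have -> : ip u v = ip (u - s) v by rewrite (hermBl hI) Vs // subr0.
apply: le_trans (CS _ _) _.
have s0 := n2_ge0 (u - s).
apply: (@le_trans _ _ (n2 (u - s) * (n2 v + 1))); first by nra.
by rewrite -ler_pdivlMr ?ltW //; lra.
Qed.

Section Riesz.
Variables (V : set X) (b : X -> X -> R[i]) (c M : R) (phi : X -> R[i]) (Mp : R).
Hypothesis sV : subspace V.
Hypothesis cV : nclosed V.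
Hypothesis hb : hermitian_form b.
Hypothesis c0 : 0 < c.
Hypothesis M0 : 0 <= M.
Hypothesis Mp0 : 0 <= Mp.
Hypothesis bc : forall u, V u -> c * n2 u <= qf b u.
Hypothesis bM : forall u, V u -> qf b u <= M * n2 u.
Hypothesis phil : forall a u v, V u -> V v -> phi (a *: u + v) = a * phi u + phi v.
Hypothesis phiM : forall u, V u -> sqm (phi u) <= Mp * n2 u.

Let q := qf b.
Let J u := q u - 2 * Re (phi u).
Let sub a u v : V u -> V v -> V (a *: u + v). Proof. exact: sV.2. Qed.
Let q0 u : V u -> 0 <= q u.
Proof. by move=> /bc; apply: le_trans; apply: mulr_ge0 (ltW c0) (n2_ge0 u). Qed.

Let J_lb u : V u -> - (Mp / c) <= J u.
Proof.
move=> Vu; rewrite /J.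
have h1 := bc Vu; have h2 := phiM Vu; have n0 := n2_ge0 u.
have h3 : Re (phi u) ^+ 2 <= Mp * n2 u.
  by apply: le_trans h2; rewrite /sqm lerDl sqr_ge0.
rewrite -/(q u) in h1.
have ic : 0 < c^-1 by rewrite invr_gt0.
have h4 : 0 <= (q u) * c^-1 - n2 u.
  by rewrite subr_ge0 ler_pdivlMr // mulrC.
have h5 : Re (phi u) ^+ 2 <= (Mp / c) * q u.
  apply: le_trans h3 _; rewrite -mulrA ler_wpM2l //.
  by rewrite mulrC; lra.
have qq := q0 Vu.
have kk : 0 <= Mp / c by rewrite divr_ge0 // ltW.
rewrite leNgt; apply/negP => h.
set k := Mp / c in h5 kk h *; set r := Re _ in h5 h *.
have h6 : 0 < 2 * r - (q u + k) by lra.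
have h7 : 0 < 2 * r + (q u + k) by lra.
have := mulr_gt0 h6 h7; have := sqr_ge0 (q u - k); nra.
Qed.

Let S := [set J u | u in V].
Let m := inf S.
Let infS : has_inf S.
Proof.
split; first by exists (J 0), 0; [exact: sV.1|].
by exists (- (Mp / c)) => _ [u Vu <-]; exact: J_lb.
Qed.
Let mJ u : V u -> m <= J u.
Proof. by move=> Vu; apply: (inf_lbound infS.2); exists u. Qed.

Let ReZ (t : R) (z : R[i]) : Re (t%:C * z) = t * Re z.
Proof. by rewrite cReM /= mul0r subr0. Qed.

(** Minimizing sequences of [b u u - 2 Re (phi u)] are Cauchy by the parallelogram
    law, and at their limit the first variation vanishes. *)
Lemma riesz : exists2 y, V y & forall v, V v -> b v y = phi v.
Proof.
have hx n : exists2 u, V u & J u < m + 1 / n.+1%:R.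
  have [|_ [u Vu <-] hu] := @inf_adherent _ S (1 / n.+1%:R) _ infS.
    by rewrite divr_gt0 // ltr0Sn.
  by exists u.
pose x n := projT1 (cid2 (hx n)).
have Vx n : V (x n) by rewrite /x; case: cid2.
have Jx n : J (x n) < m + 1 / n.+1%:R by rewrite /x; case: cid2.
have Jpar u v : V u -> V v -> q (u - v) <= 2 * (J u - m) + 2 * (J v - m).
  move=> Vu Vv.
  have := mJ (sub 2^-1%:C Vu (sub 2^-1%:C Vv sV.1)).
  rewrite {1}/J !phil //; last 2 first.
  - exact: sV.1.
  - by apply: sub => //; exact: sV.1.
  have -> : phi 0 = 0.
    have := phil 1 sV.1 sV.1; rewrite scale1r mul1r addr0 => /eqP.
    by rewrite -subr_eq subrr eq_sym => /eqP.
  rewrite !addr0 /J /q !(qfD hb) (qfN hb) (hermNr hb) !(qfZ hb) (hermZl hb) (hermZr hb) sqmR.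
  rewrite conjc_real cReD !ReZ cReN; lra.
have xx n k : (n <= k)%N -> n2 (x n - x k) <= (4 / c) / n.+1%:R.
  move=> nk.
  have Vd : V (x n - x k) by rewrite addrC -scaleN1r; exact: sub.
  have h := bc Vd; have := Jpar _ _ (Vx n) (Vx k); rewrite /q.
  have h1 := Jx n; have h2 := Jx k.
  have h3 : 1 / k.+1%:R <= 1 / n.+1%:R :> R.
    by rewrite !div1r lef_pV2 ?posrE ?ltr0Sn // ler_nat ltnS.
  move=> h4.
  have h5 : c * n2 (x n - x k) <= 4 * (1 / n.+1%:R).
    apply: le_trans h _; move: h1 h2 h3 h4.
    by move: (qf b _) (J _) (J _) (1 / _) (1 / _) => a1 a2 a3 a4 a5; lra.
  rewrite mulrA mulr1 in h5.
  by rewrite mulrAC ler_pdivlMr // [_ * c]mulrC.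
have [|y xy] := complete_seq _ xx; first by rewrite divr_gt0.
have small (K e : R) : 0 < e -> exists n, K / n.+1%:R < e.
  move=> e0; have [K0|K0] := lerP K 0.
    exists 0%N; apply: le_lt_trans e0.
    by rewrite mulr_le0_ge0 // invr_ge0 ler0n.
  exists (Num.truncn (K / e)).
  by rewrite ltr_pdivrMr ?ltr0Sn // mulrC -ltr_pdivrMr // truncnS_gt.
have Vy : V y.
  apply: cV => e e0; have [n hn] := small (2 * (4 / c)) e e0.
  by exists (x n) => //; rewrite (qfBC hI); apply: le_lt_trans hn; exact: xy.
exists y => // v Vv.
(* the first variation of J at the n-th term of the minimizing sequence *)
have var n : sqm (b v (x n) - phi v) <= (1 / n.+1%:R) * q v.
  set z : R[i] := b v (x n) - phi v.
  have key (t : R) : 0 <= 1 / n.+1%:R + t ^+ 2 * sqm z * q v - 2 * t * sqm z.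
    have := mJ (sub (- (t%:C * z^*%C)) Vv (Vx n)).
    have := Jx n; rewrite /J phil // /q (qfD hb) (qfZ hb) sqmN sqmM sqmR sqm_conj.
    rewrite (hermZl hb) -/q cReD.
    have -> : Re (- (t%:C * z^*%C) * b v (x n)) =
      Re (- (t%:C * z^*%C) * phi v) - t * sqm z.
      have -> : b v (x n) = z + phi v by rewrite /z subrK.
      by rewrite mulrDr cReD mulNr cReN -mulrA [z^*%C * z]mulrC conjc_sqm -rmorphM /= addrC.
    by move: (1 / _) (Re _) (Re _) (sqm z) => a1 a2 a3 a4; lra.
  have z0 := sqm_ge0 z; have v0 := q0 Vv.
  have [vz|vn0] := eqVneq (q v) 0.
    rewrite vz mulr0 leNgt; apply/negP => zp.
    have e0 : 0 <= 1 / n.+1%:R :> R by rewrite divr_ge0.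
    have := key ((1 / n.+1%:R + 1) / sqm z).
    rewrite vz mulr0 addr0 -mulrA divfK ?gt_eqF //.
    by move: (1 / _) e0 => a; lra.
  have vp : 0 < q v by rewrite lt_def vn0 v0.
  have := key (q v)^-1.
  have -> : (q v)^-1 ^+ 2 * sqm z * q v = (q v)^-1 * sqm z by field; rewrite gt_eqF.
  rewrite -ler_pdivrMr // [sqm z / _]mulrC -[2 / q v * _]mulrA.
  by move: (1 / _) (_ * sqm z) => a1 a2; lra.
have lim n : sqm (b v y - phi v) <= (2 * q v * (M * (2 * (4 / c))) + 2 * q v) / n.+1%:R.
  have -> : b v y - phi v = b v (y - x n) + (b v (x n) - phi v).
    by rewrite (hermBr hb) addrA subrK.
  apply: le_trans (sqmD_le _ _) _.
  have Vd : V (y - x n) by rewrite addrC -scaleN1r; exact: sub.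
  have h1 := herm_CS hb sub q0 Vv Vd; rewrite -/q in h1.
  have h2 := var n; have h3 := xy n; rewrite (qfBC hI) in h3.
  have h4 := bM Vd; rewrite -/q in h4.
  have h5 := q0 Vv; have h6 := q0 Vd; have h7 := n2_ge0 (y - x n).
  have h9 : q (y - x n) <= M * (2 * (4 / c) / n.+1%:R).
    by apply: le_trans h4 _; rewrite ler_wpM2l.
  have h10 : q v * q (y - x n) <= q v * (M * (2 * (4 / c) / n.+1%:R)).
    by rewrite ler_wpM2l.
  have -> : (2 * q v * (M * (2 * (4 / c))) + 2 * q v) / n.+1%:R =
    2 * (q v * (M * (2 * (4 / c) / n.+1%:R))) + 2 * (1 / n.+1%:R * q v).
    by rewrite div1r; ring.
  by apply: lerD; rewrite ler_pM2l //; exact: le_trans h1 h10.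
apply/eqP; rewrite -subr_eq0; apply/eqP; apply: sqm_eq0.
apply/eqP; rewrite eq_le sqm_ge0 andbT; apply: le_eps => e e0; rewrite add0r.
have [n hn] := small (2 * q v * (M * (2 * (4 / c))) + 2 * q v) e e0.
by apply: le_trans (lim n) _; exact: ltW hn.
Qed.
End Riesz.

(** Operators obtained from existence statements become linear maps in the sense
    of the algebraic hierarchy, to which the lemmas on linear maps apply. *)
Lemma linear_pack (E : lmodType R[i]) (f : E -> E) :
  (forall a (u v : E), f (a *: u + v) = a *: f u + f v) ->
  exists g : {linear E -> E}, forall u : E, g u = f u.
Proof.
move=> hf.
pose m := GRing.isLinear.Build R[i] E E *:%R f hf.
by exists (HB.pack_for {linear E -> E} f m).
Qed.

Definition symmetric_op (B : X -> X) := forall f g, ip (B f) g = ip f (B g).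
Definition bounded_op (B : X -> X) :=
  exists2 c : R, 0 <= c & forall f, n2 (B f) <= c * n2 f.

Lemma subspaceB V : subspace V -> forall u v, V u -> V v -> V (u - v).
Proof. by move=> sV u v Vu Vv; rewrite addrC -scaleN1r; apply: sV.2. Qed.

Lemma subspaceZ V : subspace V -> forall a u, V u -> V (a *: u).
Proof. by move=> sV a u Vu; rewrite -[a *: u]addr0; apply: sV.2 => //; exact: sV.1. Qed.

Lemma subspaceD V : subspace V -> forall u v, V u -> V v -> V (u + v).
Proof. by move=> sV u v Vu Vv; rewrite -[u]scale1r; apply: sV.2. Qed.

Lemma subspace_sum V I (r : seq I) (P : pred I) (F : I -> X) : subspace V ->
  (forall i, P i -> V (F i)) -> V (\sum_(i <- r | P i) F i).
Proof.
by move=> sV hF; apply: big_ind => //; [exact: sV.1 | exact: subspaceD].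
Qed.

Lemma ip_self_eq0 V u : V u -> (forall v, V v -> ip u v = 0) -> u = 0.
Proof. by move=> Vu h; apply: n2_eq0; rewrite /qf h. Qed.

Lemma orthogonal_projection V : subspace V -> nclosed V ->
  exists P : {linear X -> X}, [/\ forall u, V (P u), forall u, V u -> P u = u
    & forall u v, V v -> ip (P u) v = ip u v].
Proof.
move=> sV cV.
have ex u : exists2 y, V y & forall v, V v -> ip v y = ip v u.
  apply: (@riesz V ip 1 1 (fun v => ip v u) (n2 u)) => //.
  - exact: ip_herm.
  - exact: n2_ge0.
  - by move=> v _; rewrite mul1r.
  - by move=> v _; rewrite mul1r.
  - by move=> a v w _ _; rewrite (hermDl hI) (hermZl hI).
  - by move=> v _; rewrite mulrC CS.
pose P0 u := projT1 (cid2 (ex u)).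
have VP u : V (P0 u) by rewrite /P0; case: cid2.
have PE u v : V v -> ip (P0 u) v = ip u v.
  move=> Vv; rewrite !(herm_conj hI v); congr (_^*%C).
  by rewrite /P0; case: cid2 => y Vy /= ->.
have uniq u y : V y -> (forall v, V v -> ip y v = ip u v) -> P0 u = y.
  move=> Vy hy; apply/eqP; rewrite -subr_eq0; apply/eqP.
  apply: (ip_self_eq0 (V := V)); first exact: subspaceB.
  by move=> v Vv; rewrite (hermBl hI) PE // hy // subrr.
have [|P hP] := @linear_pack _ P0.
  move=> a u v; apply: uniq; first by apply: sV.2.
  by move=> w Vw; rewrite !(hermDl hI) !(hermZl hI) !PE.
exists P; split=> [u|u Vu|u v Vv]; rewrite hP //.
- by apply: uniq.
- exact: PE.
Qed.

(** The inverse is precomposed with the projection onto [V]: extended by zero to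
    the orthogonal complement, it is a symmetric linear map of the whole of [X],
    and no subtype for [V] is required. *)
Lemma inverse_operator V (D : set X) (T : X -> X) :
  subspace V -> nclosed V -> D `<=` V ->
  (forall a u v, D u -> D v ->
     D (a *: u + v) /\ T (a *: u + v) = a *: T u + T v) ->
  (forall u, D u -> V (T u)) ->
  (forall u v, D u -> D v -> ip (T u) v = ip u (T v)) ->
  (forall f, V f -> exists2 u, D u & T u = f) ->
  (exists2 c : R, 0 <= c & forall u, D u -> n2 u <= c * n2 (T u)) ->
  exists B : {linear X -> X},
    [/\ forall f, D (B f), forall f, V f -> T (B f) = f,
        forall u, D u -> B (T u) = u,
        symmetric_op B /\ bounded_op B
      & forall f, (forall v, V v -> ip f v = 0) -> B f = 0].
Proof.
move=> sV cV DV Dl DT symT surT [c c0 lbT].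
have [P [VP PV PE]] := orthogonal_projection sV cV.
have ex f : exists2 u, D u & T u = P f by apply: surT.
pose B0 f := projT1 (cid2 (ex f)).
have DB f : D (B0 f) by rewrite /B0; case: cid2.
have TB f : T (B0 f) = P f by rewrite /B0; case: cid2.
have TBB u v : D u -> D v -> D (u - v) /\ T (u - v) = T u - T v.
  by move=> Du Dv; have := Dl (-1) _ _ Dv Du; rewrite !scaleN1r ![- _ + _]addrC.
have inj u v : D u -> D v -> T u = T v -> u = v.
  move=> Du Dv huv; have [Duv Tuv] := TBB _ _ Du Dv.
  apply/eqP; rewrite -subr_eq0; apply/eqP; apply: n2_eq0; apply/eqP.
  rewrite eq_le n2_ge0 andbT; apply: le_trans (lbT _ Duv) _.
  by rewrite Tuv huv subrr (qf0 hI) mulr0.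
have [|B hB] := @linear_pack _ B0.
  move=> a u v; have [Duv Tuv] := Dl a _ _ (DB u) (DB v).
  by apply: inj => //; rewrite Tuv !TB linearP.
have PP f : n2 (P f) <= n2 f.
  have h : n2 (P f) = Re (ip f (P f)) by rewrite /qf PE.
  have h1 := CS_Re f (P f); rewrite -h in h1.
  have h2 := n2_ge0 (P f); have h3 := n2_ge0 f.
  rewrite leNgt; apply/negP => h4; nra.
exists B; split.
- by move=> f; rewrite hB.
- by move=> f Vf; rewrite hB TB PV.
- by move=> u Du; rewrite hB; apply: inj => //; rewrite TB PV //; exact: DT.
- split.
    move=> f g; rewrite !hB.
    have -> : ip (B0 f) g = ip (B0 f) (P g).
      by rewrite !(herm_conj hI _ (B0 f)) PE //; exact: DV.
    by rewrite -[RHS]PE; [rewrite -[P f]TB -[P g]TB symT | exact: DV].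
  exists c => // f; rewrite hB; apply: le_trans (lbT _ (DB f)) _.
  by rewrite TB ler_wpM2l.
- move=> f hf; rewrite hB; apply: inj => //.
    by have [] := TBB _ _ (DB f) (DB f); rewrite subrr.
  have [_] := TBB _ _ (DB f) (DB f); rewrite !subrr => ->.
  rewrite TB; apply: n2_eq0; rewrite /qf PE //.
  by rewrite hf.
Qed.
End Hilbert.

(** * Gaps and isolated points of the spectrum *)

Section Arithmetic.
Variable R : realType.
Implicit Types a b r q n y N : R.

Lemma min_arith y N : y < 0 -> 0 <= N ->
  0 < Num.min (- y / 4) (y ^+ 2 / (16 * (N + 1))).
Proof.
move=> y0 N0; rewrite lt_min !divr_gt0 //; [|lra|lra].
by rewrite exprn_even_gt0 //= lt_eqF.
Qed.

Lemma closure_arith r q n y N : y < 0 -> 0 <= N -> 0 <= n ->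
  0 <= y + q - 2 * r -> q <= 2 * n -> r ^+ 2 <= N * n ->
  n < - y / 4 -> n * (16 * (N + 1)) < y ^+ 2 -> False.
Proof.
move=> y0 N0 n0 p1 p2 p3 h1 h2.
have p4 : 2 * r <= y / 2 by lra.
have p5 : (y / 2) ^+ 2 <= (2 * r) ^+ 2.
  by rewrite -[leRHS]sqrrN -[leLHS]sqrrN ler_sqr ?nnegrE; lra.
nra.
Qed.

Lemma lower_bound_arith r a b : 0 <= a -> 0 <= b -> 2 / 3 * a <= r ->
  r ^+ 2 <= b * a -> a <= 9 / 4 * b.
Proof.
move=> a0 b0 h2 h3.
have : (2 / 3 * a) ^+ 2 <= b * a.
  apply: le_trans h3; rewrite ler_sqr ?nnegrE //; [lra|].
  by apply: le_trans h2; lra.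
have [->|an] := eqVneq a 0; first by move=> _; lra.
have ap : 0 < a by rewrite lt_def an.
have -> : (2 / 3 * a) ^+ 2 = (4 / 9 * a) * a by field.
by rewrite ler_pM2r //; lra.
Qed.
End Arithmetic.

Section SpectralGap.
Variables (R : realType) (X : completeNormedModType R[i]).
Variable (ip : X -> X -> R[i]).
Hypothesis hip : inner_product ip.
Local Notation hI := (ip_herm hip).
Local Notation n2 := (qf ip).
Implicit Types (u v : X) (V : set X).

Lemma Re_scaler (x : R) (z : R[i]) : Re (x%:C * z) = x * Re z.
Proof. by rewrite cReM /= mul0r subr0. Qed.

(** Reid's inequality. The moments [(F C^k w, C^k w)] form a bounded convex
    sequence, which cannot increase; its first two terms give the claim, since
    [2 (1 - C) = (1 - C)^2 + (1 - C^2)]. *)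
Lemma positive_mul_contraction V (C F : {linear X -> X}) (M : R) :
  symmetric_op ip C -> symmetric_op ip F ->
  (forall u, V u -> V (C u)) -> subspace V ->
  (forall u, V u -> n2 (C u) <= n2 u) -> 0 <= M ->
  (forall u, V u -> F (C u) = C (F u)) ->
  (forall u, V u -> 0 <= Re (ip (F u) u) <= M * n2 u) ->
  forall u, V u -> 0 <= Re (ip (F (u - C u)) u).
Proof.
move=> sC sF VC sV cC M0 FC Fpos w Vw.
pose bF u v := ip (F u) v.
have hF : hermitian_form bF.
  split=> [a u v x|u v]; first by rewrite /bF linearP (hermDl hI) (hermZl hI).
  by rewrite /bF sF (herm_conj hI).
pose x k := iter k C w.
have Vx k : V (x k) by elim: k => //= k IH; exact: VC.
pose a k := qf bF (x k).
have cross u : V u -> bF u (C (C u)) = (qf bF (C u))%:C.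
  by move=> Vu; rewrite /bF -sC -FC // -(hermE hF).
have convex k : 2 * a k.+1 <= a k + a k.+2.
  have := (Fpos (x k - x k.+2) (subspaceB sV (Vx _) (Vx _))).
  move=> /andP[+ _]; rewrite -[Re _]/(qf bF _) (qfB hF).
  by rewrite [bF _ _]cross //= -/(a k) -/(a k.+2) -/(a k.+1); lra.
have incr k : a 1%N - a 0%N <= a k.+1 - a k.
  by elim: k => // k IH; have := convex k; lra.
have grow k : a 0%N + k%:R * (a 1%N - a 0%N) <= a k.
  elim: k => [|k IH]; first by rewrite mul0r addr0.
  by have := incr k; rewrite -[k.+1]addn1 natrD; lra.
have bnd k : a k <= M * n2 w.
  have /andP[_ h] := Fpos _ (Vx k).
  apply: le_trans h _; rewrite ler_wpM2l //.
  by elim: k => //= k IH; apply: le_trans (cC _ (Vx k)) IH.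
have dec : a 1%N <= a 0%N.
  rewrite leNgt; apply/negP => lt01.
  have d0 : 0 < a 1%N - a 0%N by lra.
  have := truncnS_gt ((M * n2 w - a 0%N) / (a 1%N - a 0%N)).
  rewrite ltr_pdivrMr //; set N := (_.+1).
  by have := grow N; have := bnd N; lra.
have h1 : 0 <= qf bF (w - C w).
  by have /andP[] := Fpos _ (subspaceB sV Vw (VC _ Vw)).
rewrite linearB (hermBl hI) cReB.
have := h1; rewrite (qfB hF) -[qf bF w]/(a 0%N) -[qf bF (C w)]/(a 1%N).
have -> : Re (bF w (C w)) = Re (ip (F (C w)) w).
  by rewrite (herm_conj hF) cRe_conj.
by have -> : Re (ip (F w) w) = a 0%N by []; lra.
Qed.

Variables (D : set X) (T : X -> X).
Hypothesis Dl : forall a u v, D u -> D v ->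
  D (a *: u + v) /\ T (a *: u + v) = a *: T u + T v.
Hypothesis symT : forall u v, D u -> D v -> ip (T u) v = ip u (T v).

(** The real number [l] is in the resolvent set of the part of [T] in [V]. *)
Definition regular V (l : R) : Prop :=
  (forall f, V f -> exists2 u, V u /\ D u & T u - l%:C *: u = f) /\
  (exists2 c : R, 0 <= c &
    forall u, V u -> D u -> n2 u <= c * n2 (T u - l%:C *: u)).

Definition part_invariant V := forall u, V u -> D u -> V (T u).

Let Ts (l : R) u := T u - l%:C *: u.
Let DZ a u : D u -> D (a *: u) /\ T (a *: u) = a *: T u.
Proof.
move=> Du; have [D0 T0] := Dl (-1) Du Du.
rewrite scaleN1r addNr in D0 T0; rewrite scaleN1r addNr in T0.
by have := Dl a Du D0; rewrite T0 !addr0.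
Qed.
Let DD u v : D u -> D v -> D (u + v) /\ T (u + v) = T u + T v.
Proof. by move=> Du Dv; have := Dl 1 Du Dv; rewrite !scale1r. Qed.
Let TsP l a u v : D u -> D v -> Ts l (a *: u + v) = a *: Ts l u + Ts l v.
Proof.
move=> Du Dv; rewrite /Ts (Dl a Du Dv).2 !scalerDr scalerN !scalerA.
by rewrite [a * _]mulrC opprD addrACA.
Qed.
Let symTs l u v : D u -> D v -> ip (Ts l u) v = ip u (Ts l v).
Proof.
move=> Du Dv; rewrite /Ts (hermBl hI) (hermBr hI) (hermZl hI) (hermZr hI).
by rewrite symT // conjc_real.
Qed.
Let VTs V l u : subspace V -> part_invariant V -> V u -> D u -> V (Ts l u).
Proof. by move=> sV iV Vu Du; apply: subspaceB => //; [exact: iV|exact: subspaceZ]. Qed.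
Let TsD l d u : Ts (l + d) u = Ts l u - d%:C *: u.
Proof. by rewrite /Ts rmorphD /= scalerDl opprD addrA. Qed.

(** This replaces the spectral theorem. Let [m] be the midpoint and [r] half the
    length of the gap, and let [i] be the best constant in
    [n2 u <= i * n2 ((T - m) u)]. If [i] were larger than [r ^- 2], the points
    [m + s] and [m - s] with [s ^+ 2 = 1 / i] would be regular, and
    [(T - m)^2 - s^2] would be bounded from below. For [f = (T - m) u] this makes
    [n2 f - s^2 * n2 u] at least a fixed positive multiple of [n2 f], so that [i]
    could be lowered. *)
Lemma gap_lower_bound V (a b : R) : subspace V -> part_invariant V -> a < b ->
  (forall l, a < l < b -> regular V l) ->
  forall u, V u -> D u ->
    ((b - a) / 2) ^+ 2 * n2 u <= n2 (T u - ((a + b) / 2)%:C *: u).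
Proof.
move=> sV iV ab reg; set m := (a + b) / 2; set r := (b - a) / 2.
have r0 : 0 < r by rewrite divr_gt0 // subr_gt0.
have [surm [cm cm0 hcm]] := reg m ltac:(rewrite /m; lra).
pose S := [set c : R | 0 <= c /\ forall u, V u -> D u -> n2 u <= c * n2 (Ts m u)].
have infS : has_inf S by split; [exists cm | exists 0 => c []].
pose i := inf S.
have i0 : 0 <= i by apply: lb_le_inf infS.1 _ => c [].
have iS u : V u -> D u -> n2 u <= i * n2 (Ts m u).
  move=> Vu Du; have f0 := n2_ge0 hip (Ts m u).
  have [fz|fn] := eqVneq (n2 (Ts m u)) 0.
    by have := hcm u Vu Du; rewrite -/(Ts m u) fz !mulr0.
  have fp : 0 < n2 (Ts m u) by rewrite lt_def fn f0.
  rewrite -ler_pdivrMr //; apply: lb_le_inf infS.1 _ => c [_ hc].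
  by rewrite ler_pdivrMr //; exact: hc.
suff ir : i * r ^+ 2 <= 1.
  move=> u Vu Du; have h := iS u Vu Du; rewrite -/(Ts m u).
  have f0 := n2_ge0 hip (Ts m u).
  apply: (@le_trans _ _ (r ^+ 2 * (i * n2 (Ts m u)))).
    by rewrite ler_wpM2l ?sqr_ge0.
  by rewrite mulrA [r ^+ 2 * i]mulrC; apply: ler_piMl.
rewrite leNgt; apply/negP => ir.
have ip0 : 0 < i.
  rewrite lt_def i0 andbT; apply/eqP => iz.
  by rewrite iz mul0r ltNge ler01 in ir.
pose s : R := (Num.sqrt i)^-1.
have s0 : 0 < s by rewrite invr_gt0 sqrtr_gt0.
have s2 : i * s ^+ 2 = 1.
  by rewrite /s exprVn sqr_sqrtr // mulfV ?gt_eqF.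
have sr : s < r.
  rewrite -(ltr_pXn2r (n := 2)) ?nnegrE ?ltW //.
  by rewrite -(ltr_pM2l ip0) s2.
have [_ [cp cp0 hcp]] := reg (m + s) ltac:(rewrite /m; rewrite /r in sr; lra).
have [_ [cn cn0 hcn]] := reg (m + - s) ltac:(rewrite /m; rewrite /r in sr; lra).
pose k : R := 2 + 2 * (s ^+ 2) ^+ 2 * (cn * cp).
have k2 : 2 <= k.
  by rewrite lerDl mulr_ge0 // ?mulr_ge0 // ?exprn_ge0 // ?sqr_ge0 // ltW.
have kp : 0 < k by lra.
have : i <= i * (1 - k^-1).
  apply: (inf_lbound infS.2); split.
    rewrite mulr_ge0 // subr_ge0 invf_le1 //; lra.
  move=> u Vu Du.
  have [x [Vx Dx] hx] := surm u Vu; rewrite -/(Ts m x) in hx.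
  set f := Ts m u.
  have [Dsx _] := DZ s%:C Dx.
  have [Dy _] := DD Du Dsx.
  have h1 : n2 x <= cn * n2 (u + s%:C *: x).
    have := hcn x Vx Dx; rewrite -/(Ts _ _) TsD hx rmorphN /= scaleNr opprK.
    by [].
  have h2 : n2 (u + s%:C *: x) <= cp * n2 (f - (s ^+ 2)%:C *: x).
    have := hcp (u + s%:C *: x) (subspaceD sV Vu (subspaceZ sV _ Vx)) Dy.
    suff -> : T (u + s%:C *: x) - (m + s)%:C *: (u + s%:C *: x) =
      f - (s ^+ 2)%:C *: x by [].
    rewrite -/(Ts _ _) TsD [u + s%:C *: x]addrC TsP // hx -/f.
    rewrite scalerDr scalerA -rmorphM -expr2.
    by rewrite [s%:C *: u + f]addrC opprD [- _ - _]addrC addrA addrK.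
  have fx : Re (ip f ((s ^+ 2)%:C *: x)) = s ^+ 2 * n2 u.
    by rewrite (hermZr hI) conjc_real Re_scaler symTs // hx.
  have h3 : n2 (f - (s ^+ 2)%:C *: x) <= n2 f - s ^+ 2 * n2 u.
    rewrite (qfB hI) fx (qfZ hI) sqmR.
    have h := iS x Vx Dx; rewrite hx in h.
    have : (s ^+ 2) ^+ 2 * n2 x <= s ^+ 2 * n2 u.
      have -> : s ^+ 2 * n2 u = (s ^+ 2) ^+ 2 * (i * n2 u).
        by rewrite -[RHS]mulrA; rewrite -{1}[s ^+ 2]mulr1 -s2; ring.
      by rewrite ler_wpM2l ?sqr_ge0.
    by move: (n2 f) (n2 x) (n2 u) => a1 a2 a3; lra.
  have h4 : n2 f <= 2 * n2 (f - (s ^+ 2)%:C *: x) + 2 * ((s ^+ 2) ^+ 2 * n2 x).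
    have := n2D_le hip (f - (s ^+ 2)%:C *: x) ((s ^+ 2)%:C *: x).
    by rewrite subrK [n2 (_ *: x)](qfZ hI) sqmR.
  have h5 : n2 x <= (cn * cp) * n2 (f - (s ^+ 2)%:C *: x).
    by apply: le_trans h1 _; rewrite -mulrA ler_wpM2l.
  have h6 : n2 f <= k * n2 (f - (s ^+ 2)%:C *: x).
    have : (s ^+ 2) ^+ 2 * n2 x <=
        (s ^+ 2) ^+ 2 * (cn * cp * n2 (f - (s ^+ 2)%:C *: x)).
      by rewrite ler_wpM2l ?sqr_ge0.
    move: h4; rewrite /k; move: (n2 f) (n2 x) (n2 _) ((s ^+ 2) ^+ 2) (cn * cp).
    by move=> a1 a2 a3 a4 a5; lra.
  have h7 : n2 f <= k * (n2 f - s ^+ 2 * n2 u).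
    by apply: le_trans h6 _; rewrite ler_pM2l.
  have h8 : s ^+ 2 * n2 u <= (1 - k^-1) * n2 f.
    rewrite mulrBl mul1r lerBrDr addrC -lerBrDr ler_pdivrMl //.
  have -> : n2 u = i * (s ^+ 2 * n2 u) by rewrite mulrA s2 mul1r.
  by rewrite -[leRHS]mulrA ler_pM2l.
rewrite ler_pMr // => h.
have : 0 < k^-1 by rewrite invr_gt0.
by lra.
Qed.

Lemma regular_restrict V V' l : subspace V ->
  (forall u, V' u -> V u) ->
  (forall u, V u -> D u -> V' (T u - l%:C *: u) -> V' u) ->
  regular V l -> regular V' l.
Proof.
move=> sV V'V hV' [sur [c c0 hc]]; split.
  move=> f V'f; have [u [Vu Du] hu] := sur f (V'V _ V'f).
  by exists u => //; split=> //; apply: hV' => //; rewrite hu.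
by exists c => // u V'u Du; apply: hc => //; exact: V'V.
Qed.

(** The part of [T] in this subspace no longer has [l] in its spectrum, provided
    that [l] is isolated; see [isolated_point_removed]. *)
Definition remove_eigenvectors V (l : R) : set X :=
  [set u | V u /\ forall k, V k -> D k -> T k = l%:C *: k -> ip u k = 0].

Lemma remove_subspace V l : subspace V -> subspace (remove_eigenvectors V l).
Proof.
move=> sV; split=> [|a u v [Vu hu] [Vv hv]].
  by split=> [|k _ _ _]; [exact: sV.1 | rewrite (herm0l hI)].
split=> [|k Vk Dk Tk]; first exact: sV.2.
by rewrite (hermDl hI) (hermZl hI) hu // hv // mulr0 addr0.
Qed.

Lemma remove_closed V l : nclosed ip V -> nclosed ip (remove_eigenvectors V l).
Proof.
move=> cV u h; split.
  by apply: cV => e e0; have [s [Vs _] hs] := h e e0; exists s.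
move=> k Vk Dk Tk.
apply: (@orthocomplement_closed _ _ _ hip [set k]) => [e e0|//].
have [s [Vs hs1] hs2] := h e e0; exists s => // _ ->.
exact: hs1.
Qed.

Lemma remove_invariant V l :
  part_invariant V -> part_invariant (remove_eigenvectors V l).
Proof.
move=> iV u [Vu hu] Du; split=> [|k Vk Dk Tk]; first exact: iV.
by rewrite symT // Tk (hermZr hI) hu // mulr0.
Qed.

(** With the resolvent [B] at the midpoint [l + e / 2] one forms the bounded
    operator [D0 = (T - l) B], a function of [T] that vanishes at [l] only. The
    gap on the right makes [1 - D0] a contraction, the one on the left gives
    [3 D0^2 >= 2 D0]. Multiplied by [D0], which is possible by
    [positive_mul_contraction], this says that [D0 >= 2/3] on the range of [D0];
    the closure [M] of the range contains all vectors orthogonal to the kernel,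
    and there [T - l] is inverted by way of [D0]. *)
Lemma isolated_point_removed V (l e : R) :
  subspace V -> nclosed ip V -> part_invariant V -> 0 < e ->
  (forall w : R, l - e < w < l + e -> w != l -> regular V w) ->
  regular (remove_eigenvectors V l) l.
Proof.
move=> sV cV iV e0 reg.
set V' := remove_eigenvectors V l.
have sV' : subspace V' by exact: remove_subspace.
have cV' : nclosed ip V' by exact: remove_closed.
pose h := e / 2; have h0 : 0 < h by rewrite divr_gt0.
have hm : l + h != l by rewrite -subr_eq0 addrC addKr gt_eqF.
have [surm [cm cm0 hcm]] : regular V (l + h).
  by apply: reg => //; rewrite /h; lra.
have sDV a u v : V u /\ D u -> V v /\ D v -> V (a *: u + v) /\ D (a *: u + v).
  by move=> [Vu Du] [Vv Dv]; split; [exact: sV.2 | exact: (Dl a Du Dv).1].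
have := @inverse_operator _ _ _ hip V [set u | V u /\ D u] (Ts (l + h)) sV cV.
case.
- by move=> u [].
- by move=> a u v Du Dv; split; [exact: sDV | exact: TsP Du.2 Dv.2].
- by move=> u [Vu Du]; exact: VTs.
- by move=> u v [_ Du] [_ Dv]; exact: symTs.
- exact: surm.
- by exists cm => // u [Vu Du]; exact: hcm.
move=> B [DB TB BT [symB _] _].
have reg1 w : l < w < l + e -> regular V w.
  by move=> hw; apply: reg; [lra | rewrite gt_eqF //; lra].
have reg2 w : l - e < w < l -> regular V w.
  by move=> hw; apply: reg; [lra | rewrite lt_eqF //; lra].
have gap1 u : V u -> D u -> h ^+ 2 * n2 u <= n2 (Ts (l + h) u).
  move=> Vu Du; have := gap_lower_bound sV iV _ reg1 Vu Du.
  have -> : (l + e - l) / 2 = h by rewrite /h; field.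
  have -> : (l + (l + e)) / 2 = l + h by rewrite /h; field.
  by apply; lra.
have gap2 u : V u -> D u -> h ^+ 2 * n2 u <= n2 (Ts (l - h) u).
  move=> Vu Du; have := gap_lower_bound sV iV _ reg2 Vu Du.
  have -> : (l - (l - e)) / 2 = h by rewrite /h; field.
  have -> : (l - e + l) / 2 = l - h by rewrite /h; field.
  by apply; lra.
have VB f : V (B f) by case: (DB f).
have DBf f : D (B f) by case: (DB f).
have [|C hC] := @linear_pack _ X (fun u => - (h%:C *: B u)).
  move=> a u v; rewrite linearP scalerDr opprD scalerN !scalerA.
  by rewrite [a * _]mulrC.
have VC u : V (C u) by rewrite hC -scaleNr; exact: subspaceZ.
have symC : symmetric_op ip C.
  move=> u v; rewrite !hC (hermNl hI) (hermNr hI) (hermZl hI) (hermZr hI).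
  by rewrite symB conjc_real.
have contrC u : V u -> n2 (C u) <= n2 u.
  move=> Vu; rewrite hC (qfN hI) (qfZ hI) sqmR.
  by apply: le_trans (gap1 _ (VB u) (DBf u)) _; rewrite TB.
(* [D0 = 1 - C] is defined everywhere; on [V] it is [(T - l) B] *)
have [|D0 D0E] := @linear_pack _ X (fun u => u - C u).
  by move=> a u v; rewrite linearP opprD addrACA -scalerBr.
have D0P a u v : D0 (a *: u + v) = a *: D0 u + D0 v by rewrite linearP.
have D0T u : V u -> D0 u = Ts l (B u).
  move=> Vu; have := TB _ Vu; rewrite TsD => hu.
  by rewrite D0E hC opprK -{1}hu subrK.
have VD0 u : V u -> V (D0 u) by move=> Vu; rewrite D0E; apply: subspaceB.
have symD0 u v : ip (D0 u) v = ip u (D0 v).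
  by rewrite !D0E (hermBl hI) (hermBr hI) symC.
have [|F hF] := @linear_pack _ X (fun u => D0 u - 3 *: C (D0 u)).
  move=> a u v; cbv beta; rewrite D0P linearP !scalerDr opprD addrACA.
  by rewrite [a *: - (3 *: _)]scalerN !scalerA [3 * a]mulrC.
have FE u : F u = 3 *: D0 (D0 u) - 2 *: D0 u.
  rewrite hF [D0 (D0 u)]D0E; move: (D0 u) => y; rewrite scalerBr addrAC -scalerBl.
  by have -> : 3 - 2 = 1 :> R[i]; [ring | rewrite scale1r].
have C2 u : V u -> n2 (D0 u) <= 4 * n2 u.
  move=> Vu; have := n2D_le hip u (- C u); rewrite (qfN hI) -D0E => h1.
  have h2 := contrC _ Vu; apply: le_trans h1 _.
  by move: (n2 _) (n2 _) h2 => a b; lra.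
have CSD0 u : V u -> Re (ip (D0 u) u) <= 2 * n2 u.
  move=> Vu; have := CS_Re hip (D0 u) u; have := C2 u Vu; have := n2_ge0 hip u.
  move: (Re _) (n2 _) (n2 _) => a b c b0 h1 h2.
  by rewrite leNgt; apply/negP => h3; nra.
have Fpos u : V u -> 0 <= Re (ip (F u) u) <= 16 * n2 u.
  move=> Vu.
  have -> : Re (ip (F u) u) = 3 * n2 (D0 u) - 2 * Re (ip (D0 u) u).
    rewrite FE (hermBl hI) !(hermZl hI) [ip (D0 (D0 u)) u]symD0 cReB.
    by rewrite -!(rmorph_nat (real_complex R)) !Re_scaler.
  have g1 := gap2 _ (VB u) (DBf u).
  have E : Ts (l - h) (B u) = D0 u + h%:C *: B u.
    by rewrite TsD rmorphN /= scaleNr opprK -D0T.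
  rewrite E (qfD hI) (qfZ hI) sqmR in g1.
  have E2 : h%:C *: B u = D0 u - u.
    by rewrite D0E hC opprK addrC addKr.
  have E3 : Re (ip (D0 u) (h%:C *: B u)) = n2 (D0 u) - Re (ip (D0 u) u).
    by rewrite E2 (hermBr hI) cReB.
  rewrite E3 in g1.
  have g2 := C2 u Vu.
  have g3 : - (2 * n2 u) <= Re (ip (D0 u) u).
    have := CS_Re hip (D0 u) u; have := n2_ge0 hip u; move: g2.
    move: (Re _) (n2 _) (n2 _) => a b c h1 b0 h2.
    by rewrite leNgt; apply/negP => h3; nra.
  apply/andP; split.
    move: g1; move: (n2 _) (n2 _) (Re _) => a b c; lra.
  by move: g2 g3; move: (n2 _) (n2 _) (Re _) => a b c; lra.
have DC u : D0 (C u) = C (D0 u) by rewrite !D0E linearB.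
have FC u : F (C u) = C (F u) by rewrite !hF !DC linearB [C (3 *: _)]linearZ.
have symF : symmetric_op ip F.
  move=> u v; rewrite !FE (hermBl hI) (hermBr hI) !(hermZl hI) !(hermZr hI).
  by rewrite !symD0 !conjc_nat.
have coercive_range w : V w ->
    2 / 3 * n2 (D0 w) <= Re (ip (D0 (D0 w)) (D0 w)).
  move=> Vw.
  have := @positive_mul_contraction V C F 16 symC symF (fun u _ => VC u) sV
    contrC ltac:(by []) (fun u _ => FC u) Fpos w Vw.
  rewrite -D0E FE (hermBl hI) !(hermZl hI) symD0 [ip (D0 (D0 w)) w]symD0.
  rewrite cReB -!(rmorph_nat (real_complex R)) !Re_scaler /qf.
  by move: (Re _) (Re _) => a b; lra.
pose M : set X :=
  [set u | V u /\ forall d : R, 0 < d -> exists2 w, V w & n2 (u - D0 w) < d].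
have sM : subspace M.
  split=> [|a u v [Vu hu] [Vv hv]].
    split=> [|d d0]; first exact: sV.1.
    exists 0; first exact: sV.1.
    by rewrite linear0 subr0 (qf0 hI).
  split=> [|d d0]; first exact: sV.2.
  have a0 := sqm_ge0 a.
  have [x Vx hx] := hu (d / (4 * (sqm a + 1))) ltac:(by rewrite divr_gt0 //; lra).
  have [y Vy hy] := hv (d / 4) ltac:(by rewrite divr_gt0).
  exists (a *: x + y); first exact: sV.2.
  rewrite D0P opprD addrACA -scalerBr.
  apply: le_lt_trans (n2D_le hip _ _) _; rewrite (qfZ hI).
  have x0 := n2_ge0 hip (u - D0 x).
  have : sqm a * n2 (u - D0 x) <= d / 4.
    rewrite ltr_pdivlMr in hx; last by lra.
    move: (n2 _) (sqm a) hx a0 x0 => p q h1 h2 h3; lra.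
  move: (n2 _) (n2 _) hy => p q h1 h2; lra.
have cM : nclosed ip M.
  move=> u hu; split.
    by apply: cV => d d0; have [s [Vs _] hs] := hu d d0; exists s.
  move=> d d0; have [s [_ Ms] hs] := hu (d / 4) ltac:(by rewrite divr_gt0).
  have [w Vw hw] := Ms (d / 4) ltac:(by rewrite divr_gt0).
  exists w => //; have -> : u - D0 w = (u - s) + (s - D0 w) by rewrite addrA subrK.
  apply: le_lt_trans (n2D_le hip _ _) _.
  by move: (n2 _) (n2 _) hs hw => p q h1 h2; lra.
have coerciveM u : M u -> 2 / 3 * n2 u <= Re (ip (D0 u) u).
  move=> [Vu hu].
  pose bG x y := ip (D0 x - (2 / 3)%:C *: x) y.
  have hG : hermitian_form bG.
    split=> [a x y z|x y].
      rewrite /bG D0P scalerDr scalerA [_ * a]mulrC -scalerA opprD addrACA.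
      by rewrite -scalerBr (hermDl hI) (hermZl hI).
    rewrite /bG -(herm_conj hI) (hermBl hI) (hermZl hI) symD0.
    by rewrite (hermBr hI) (hermZr hI) conjc_real.
  have GE x : qf bG x = Re (ip (D0 x) x) - 2 / 3 * n2 x.
    by rewrite /qf /bG (hermBl hI) (hermZl hI) cReB Re_scaler.
  rewrite -subr_ge0 -GE leNgt; apply/negP => neg.
  set y := qf bG u in neg; set N := n2 (D0 u - (2 / 3)%:C *: u).
  have N0 : 0 <= N by exact: n2_ge0.
  have y2 : 0 < y ^+ 2 by rewrite exprn_even_gt0 //= lt_eqF.
  have [w1 Vw1 hw1] := hu (Num.min (- y / 4) (y ^+ 2 / (16 * (N + 1))))
    (min_arith neg N0).
  move: hw1; rewrite lt_min => /andP[hw1 hw2].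
  set d := u - D0 w1 in hw1 hw2.
  have Vd : V d by apply: subspaceB => //; exact: VD0.
  have p1 : 0 <= qf bG (u - d).
    rewrite /d opprB addrC subrK GE; have := coercive_range _ Vw1; lra.
  rewrite (qfB hG) -/y in p1.
  have p2 : qf bG d <= 2 * n2 d.
    by rewrite GE; have := CSD0 _ Vd; have := n2_ge0 hip d; lra.
  have p3 := CS_Re hip (D0 u - (2 / 3)%:C *: u) d; rewrite -/(bG u d) -/N in p3.
  have d0 := n2_ge0 hip d.
  rewrite ltr_pdivlMr in hw2; last by lra.
  exact: closure_arith neg N0 d0 p1 p2 p3 hw1 hw2.
have eigD0 k : V k -> D k -> T k = l%:C *: k -> D0 k = 0 /\ B k = - (h^-1)%:C *: k.
  move=> Vk Dk Tk.
  have T0 : Ts (l + h) k = - h%:C *: k.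
    by rewrite TsD /Ts Tk subrr sub0r scaleNr.
  have : k = B (- h%:C *: k) by rewrite -T0 BT.
  rewrite linearZ /= => hk; split.
    by rewrite D0E hC {1}hk scaleNr subrr.
  rewrite {2}hk scalerA mulrNN -rmorphM mulVf ?gt_eqF //.
  by rewrite scale1r.
have V'M u : V' u -> M u.
  move=> [Vu hu].
  have [P [MP _ PE]] := orthogonal_projection hip sM cM.
  set k := u - P u.
  have Vk : V k by apply: subspaceB => //; case: (MP u).
  have kM x : M x -> ip k x = 0 by move=> Mx; rewrite /k (hermBl hI) PE // subrr.
  have D0k : D0 k = 0.
    apply: (ip_self_eq0 hip (V := V)) => [|x Vx]; first exact: VD0.
    rewrite symD0; apply: kM; split; first exact: VD0.
    by move=> d d0; exists x; rewrite // subrr (qf0 hI).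
  have kB : k = - (h%:C *: B k) by apply/eqP; rewrite -hC -subr_eq0 -D0E; apply/eqP.
  have Dk : D k by rewrite kB -scaleNr; case: (DZ (- h%:C) (DBf k)).
  have Tk : T k = l%:C *: k.
    apply/eqP; rewrite -subr_eq0 -/(Ts l k) kB -scaleNr.
    have [D00 T00] := DZ 0 (DBf k); rewrite !scale0r in D00 T00.
    have -> : - h%:C *: B k = - h%:C *: B k + 0 by rewrite addr0.
    by rewrite TsP // -D0T // D0k /Ts T00 !scaler0 subrr addr0.
  have k0 : k = 0.
    apply: (n2_eq0 hip); rewrite /qf {1}/k (hermBl hI) hu //.
    by rewrite (herm_conj hI) kM ?MP // conjc0 subrr.
  by have -> : u = P u by apply/eqP; rewrite -subr_eq0 -/k k0.
have D0V' u : V' u -> V' (D0 u).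
  move=> [Vu hu]; split=> [|k Vk Dk Tk]; first exact: VD0.
  by rewrite symD0 (eigD0 _ Vk Dk Tk).1 (herm0r hI).
have BV' u : V' u -> V' (B u).
  move=> [Vu hu]; split=> // k Vk Dk Tk.
  by rewrite symB (eigD0 _ Vk Dk Tk).2 (hermZr hI) hu // mulr0.
have hD0 : hermitian_form (fun u v => ip (D0 u) v).
  split=> [a u v w|u v]; first by rewrite D0P (hermDl hI) (hermZl hI).
  by rewrite symD0 (herm_conj hI).
split.
  move=> f V'f.
  have [g V'g hg] : exists2 g, V' g & forall v, V' v -> ip (D0 v) g = ip v f.
    apply: (@riesz _ _ _ hip V' (fun u v => ip (D0 u) v) (2 / 3) 2
      (fun v => ip v f) (n2 f)) => //.
    - exact: n2_ge0.
    - by move=> u V'u; apply: coerciveM; exact: V'M.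
    - by move=> u [Vu _]; exact: CSD0.
    - by move=> a u v _ _; rewrite (hermDl hI) (hermZl hI).
    - by move=> u _; rewrite mulrC; exact: CS.
  have Dgf : D0 g = f.
    apply/eqP; rewrite -subr_eq0; apply/eqP.
    apply: (ip_self_eq0 hip (V := V')) => [|v V'v].
      by apply: subspaceB => //; exact: D0V'.
    by rewrite (herm_conj hI) (hermBr hI) -hg // symD0 subrr conjc0.
  exists (B g); first by split; [exact: BV' | exact: DBf].
  by rewrite -/(Ts l (B g)) -D0T //; case: V'g.
exists (h ^- 2 * (9 / 4)); first by rewrite mulr_ge0 // invr_ge0 sqr_ge0.
move=> u V'u Du; rewrite -/(Ts l u).
have [Vu _] := V'u.
set g := Ts (l + h) u.
have Vg : V g by exact: VTs.
have uB : u = B g by rewrite /g BT.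
have V'g : V' g.
  split=> // k Vk Dk Tk; rewrite /g symTs // TsD /Ts Tk subrr sub0r.
  by rewrite (hermNr hI) (hermZr hI); case: V'u => _ ->; rewrite // mulr0 oppr0.
have -> : Ts l u = D0 g by rewrite uB D0T // -uB.
have h1 := gap1 _ Vu Du; rewrite -/g in h1.
have h2 := coerciveM _ (V'M _ V'g).
have h3 := CS_Re hip (D0 g) g.
have h4 := lower_bound_arith (n2_ge0 hip g) (n2_ge0 hip (D0 g)) h2 h3.
by rewrite -mulrA ler_pdivlMl ?exprn_gt0 //; apply: le_trans h1 h4.
Qed.
End SpectralGap.

(** * Families of vectors *)

Section Families.
Variables (R : realType) (X : completeNormedModType R[i]).
Implicit Types (u v k : X) (V W S : set X).

Lemma lspan_subspace S : subspace (lspan S).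
Proof.
split=> [W [W0 _] _ //|a u v hu hv W sW SW].
by apply: sW.2; [exact: hu | exact: hv].
Qed.

Lemma sub_lspan S : S `<=` lspan S.
Proof. by move=> u Su W _; apply. Qed.

Lemma lspan_sub S W : subspace W -> S `<=` W -> lspan S `<=` W.
Proof. by move=> sW SW u; apply. Qed.

Definition fcons n k (v : 'I_n -> X) : 'I_n.+1 -> X :=
  fun i => oapp v k (unlift ord0 i).
Definition fcat m n (v : 'I_m -> X) (w : 'I_n -> X) : 'I_(m + n) -> X :=
  fun i => match fintype.split i with inl j => v j | inr j => w j end.

Lemma sum_fcons n k (v : 'I_n -> X) (c : 'I_n.+1 -> R[i]) :
  \sum_i c i *: fcons k v i =
  c ord0 *: k + \sum_i c (lift ord0 i) *: v i.
Proof.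
rewrite big_ord_recl /fcons unlift_none /=; congr (_ + _).
by apply: eq_bigr => i _; rewrite liftK.
Qed.

Lemma sum_fcat m n (v : 'I_m -> X) (w : 'I_n -> X) (c : 'I_(m + n) -> R[i]) :
  \sum_i c i *: fcat v w i =
  \sum_i c (lshift n i) *: v i + \sum_i c (rshift m i) *: w i.
Proof.
rewrite big_split_ord /fcat; congr (_ + _); apply: eq_bigr => i _.
- by have := unsplitK (inl i : 'I_m + 'I_n); rewrite /= => ->.
- by have := unsplitK (inr i : 'I_m + 'I_n); rewrite /= => ->.
Qed.

Lemma fcons_in V n k (v : 'I_n -> X) :
  V k -> (forall i, V (v i)) -> forall i, V (fcons k v i).
Proof. by move=> Vk Vv i; rewrite /fcons; case: unliftP => [j|] _ /=. Qed.

Lemma fcat_in V m n (v : 'I_m -> X) (w : 'I_n -> X) :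
  (forall i, V (v i)) -> (forall i, V (w i)) -> forall i, V (fcat v w i).
Proof. by move=> Vv Vw i; rewrite /fcat; case: fintype.split. Qed.

Lemma lin_indep_fcons n k (v : 'I_n -> X) : lin_indep v ->
  (forall c : 'I_n -> R[i], k <> \sum_i c i *: v i) -> lin_indep (fcons k v).
Proof.
move=> iv hk c; rewrite sum_fcons => hc.
have [c0|c0] := eqVneq (c ord0) 0; last first.
  exfalso; apply: (hk (fun i => - ((c ord0)^-1 * c (lift ord0 i)))).
  have : (c ord0)^-1 *: (c ord0 *: k + \sum_i c (lift ord0 i) *: v i) = 0.
    by rewrite hc scaler0.
  rewrite scalerDr scalerA mulVf // scale1r => /eqP; rewrite addr_eq0 => /eqP ->.
  rewrite scaler_sumr -sumrN; apply: eq_bigr => i _.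
  by rewrite scalerA scaleNr.
rewrite c0 scale0r add0r in hc; have h := iv _ hc.
by move=> i; case: (unliftP ord0 i) => [j|] ->.
Qed.

Lemma ldim_ge V n (v : 'I_n -> X) :
  (forall i, V (v i)) -> lin_indep v -> (n%:R%:E <= ldim V)%E.
Proof. by move=> Vv iv; apply: ereal_sup_ubound; exists n => //; exists v. Qed.

Lemma ldim_le V (x : \bar R) :
  (forall n (v : 'I_n -> X), (forall i, V (v i)) -> lin_indep v ->
    (n%:R%:E <= x)%E) -> (ldim V <= x)%E.
Proof. by move=> h; apply: ge_ereal_sup => _ [n [v [Vv iv]] <-]; exact: h. Qed.

Lemma lin_indep0 (v : 'I_0 -> X) : lin_indep v.
Proof. by move=> c _ []. Qed.

Lemma lin_indep_neq0 n (v : 'I_n -> X) i : lin_indep v -> v i != 0.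
Proof.
move=> iv; apply/eqP => v0; have /(_ _ i) := iv (fun j => (j == i)%:R).
rewrite (bigD1 i) //= eqxx scale1r big1 ?addr0 => [/(_ v0)/eqP|j /negPf ->].
  by rewrite oner_eq0.
by rewrite scale0r.
Qed.

(** A vector outside the span of an independent family enlarges it; if this were
    always possible, the supremum defining [ldim V] would be infinite. *)
Lemma ldim_fin_basis V : (ldim V < +oo)%E ->
  exists n (v : 'I_n -> X), [/\ forall i, V (v i), lin_indep v
    & forall k, V k -> exists c : 'I_n -> R[i], k = \sum_i c i *: v i].
Proof.
move=> fin; apply: contrapT => no.
have all_n n : exists v : 'I_n -> X, (forall i, V (v i)) /\ lin_indep v.
  elim: n => [|n [v [Vv iv]]].
    by exists (fun _ => 0); split; [case | exact: lin_indep0].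
  have [k [Vk hk]] : exists k, V k /\ forall c : 'I_n -> R[i], k <> \sum_i c i *: v i.
    apply: contrapT => no2; apply: no; exists n, v; split=> // k Vk.
    apply: contrapT => no3; apply: no2; exists k; split=> // c hc.
    by apply: no3; exists c.
  exists (fcons k v); split; first exact: fcons_in.
  exact: lin_indep_fcons.
case hd: (ldim V) fin => [r| |] // _.
- have [v [Vv iv]] := all_n (Num.truncn r).+1.
  have := ldim_ge Vv iv; rewrite hd lee_fin leNgt.
  by rewrite truncnS_gt.
- have [v [Vv iv]] := all_n 0%N.
  by have := ldim_ge Vv iv; rewrite hd.
Qed.

Lemma nontrivial_solution (F : fieldType) (n m : nat) (M : 'I_n -> 'I_m -> F) :
  (m < n)%N -> exists2 c : 'I_n -> F, exists i, c i != 0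
    & forall j, \sum_i c i * M i j = 0.
Proof.
move=> mn; pose A := \matrix_(i, j) M i j.
have : kermx A != 0.
  by rewrite -mxrank_eq0 mxrank_ker subn_eq0 -ltnNge (leq_ltn_trans (rank_leq_col A)).
move=> /rowV0Pn[c /sub_kermxP cA c0]; exists (c 0).
  by have /rV0Pn[i ci] := c0; exists i.
move=> j; have := congr1 (fun B : 'rV_m => B 0 j) cA; rewrite !mxE => cA'.
by rewrite -[RHS]cA'; apply: eq_bigr => i _; rewrite !mxE.
Qed.
End Families.

(** * Finitely many negative points in the spectrum *)

Section NegativeSpectrum.
Variables (R : realType) (X : completeNormedModType R[i]).
Variable (ip : X -> X -> R[i]).
Hypothesis hip : inner_product ip.
Local Notation hI := (ip_herm hip).
Local Notation n2 := (qf ip).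
Implicit Types (u v : X) (V : set X).

Section SymmetricOperator.
Variables (D : set X) (T : X -> X).
Hypothesis Dl : forall a u v, D u -> D v ->
  D (a *: u + v) /\ T (a *: u + v) = a *: T u + T v.
Hypothesis symT : forall u v, D u -> D v -> ip (T u) v = ip u (T v).

Lemma isolated_in_list (s : seq R) (x : R) : x < 0 ->
  exists2 e : R, 0 < e & forall w, x - e < w < x + e -> w != x ->
    w < 0 /\ w \notin s.
Proof.
move=> x0; elim: s => [|y s [e e0 he]].
  by exists (- x); [lra | move=> w hw _; split=> //; lra].
have [->|yx] := eqVneq y x.
  exists e => // w hw wx; have [w0 ws] := he w hw wx.
  by rewrite in_cons (negPf wx).
have d0 : 0 < `|y - x| by rewrite normr_gt0 subr_eq0.
exists (Num.min e `|y - x|); first by rewrite lt_min e0.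
move=> w /andP[]; rewrite ltrBlDr -ltrBlDl lt_min => /andP[h1 h2].
rewrite -ltrBlDl lt_min => /andP[h3 h4] wx.
have [|w0 ws] := he w _ wx; first by lra.
split=> //; rewrite in_cons (negPf ws) orbF; apply/eqP => wy; subst y.
have : `|w - x| < `|w - x| by rewrite {1}real_ltr_norml ?num_real //; lra.
by rewrite ltxx.
Qed.

(** Removing the points of [s] one by one leaves an operator whose resolvent set
    contains all negative numbers. By [gap_lower_bound] on [(- 2 t, 0)] this
    operator satisfies [t^2 * n2 u <= n2 (T u + t u)] for all [t > 0], and the terms of
    first order in [t] give the sign of the form. *)
Lemma nonneg_off_eigenvectors (s : seq R) V :
  subspace V -> nclosed ip V -> part_invariant D T V ->
  (forall w : R, w < 0 -> w \notin s -> regular ip D T V w) ->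
  forall u, V u -> D u ->
    (forall l k, l \in s -> D k -> T k = l%:C *: k -> ip u k = 0) ->
    0 <= Re (ip (T u) u).
Proof.
elim: s V => [|l s IH] V sV cV iV reg u Vu Du hu.
  have key (t : R) : 0 < t -> 0 <= n2 (T u) + 2 * t * Re (ip (T u) u).
    move=> t0; have := @gap_lower_bound _ _ _ hip _ _ Dl symT V (- (2 * t)) 0 sV iV.
    have -> : (0 - - (2 * t)) / 2 = t by field.
    have -> : (- (2 * t) + 0) / 2 = - t by field.
    move=> /(_ ltac:(lra)) h.
    have {h} := h (fun w hw => reg w (proj2 (andP hw)) isT) u Vu Du.
    rewrite rmorphN /= scaleNr opprK (qfD hI) (qfZ hI) sqmR (hermZr hI).
    by rewrite conjc_real Re_scaler; lra.
  set r := Re _ in key *; set N := n2 (T u) in key.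
  have N0 : 0 <= N by exact: n2_ge0.
  rewrite leNgt; apply/negP => r0.
  have := key ((N + 1) / - r) ltac:(by rewrite divr_gt0 //; lra).
  have -> : 2 * ((N + 1) / - r) * r = - (2 * (N + 1)) by field; rewrite lt_eqF.
  by lra.
have [l0|l0] := lerP 0 l.
  apply: (IH V) => // [w w0 ws|x k xs]; last by apply: hu; rewrite in_cons xs orbT.
  by apply: reg => //; rewrite in_cons (negPf ws) orbF lt_eqF //; lra.
have [e e0 he] := isolated_in_list s l0.
have regl : regular ip D T (remove_eigenvectors ip D T V l) l.
  apply: (@isolated_point_removed _ _ _ hip _ _ Dl symT V l e) => // w hw wl.
  have [w0 ws] := he w hw wl.
  by apply: reg => //; rewrite in_cons (negPf wl).
apply: (IH (remove_eigenvectors ip D T V l)) => //.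
- exact: remove_subspace.
- exact: remove_closed.
- exact: remove_invariant.
- move=> w w0 ws; have [->//|wl] := eqVneq w l.
  apply: (regular_restrict (V := V)) => //.
  + by move=> x [].
  + move=> x Vx Dx [_ hx]; split=> // k Vk Dk Tk.
    have := hx k Vk Dk Tk; rewrite (hermBl hI) symT // Tk (hermZr hI) (hermZl hI).
    rewrite conjc_real -mulrBl => /eqP; rewrite mulf_eq0 -rmorphB => /orP[|/eqP//].
    by rewrite fmorph_eq0 subr_eq0 eq_sym (negPf wl).
  + by apply: reg => //; rewrite in_cons (negPf wl).
- by split=> // k Vk Dk Tk; apply: (hu l) => //; rewrite in_cons eqxx.
- by move=> x k xs; apply: hu; rewrite in_cons xs orbT.
Qed.
End SymmetricOperator.

Section SelfAdjoint.
Variables (L : operator X) (omega : R).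
Hypothesis L_sa : self_adjoint ip setT L.
Hypothesis P1 : essential_spectrum_assumption ip L omega.
Hypothesis P2 : discrete_spectrum_assumption L.

Lemma sa_linear a u v : dom L u -> dom L v ->
  dom L (a *: u + v) /\ L (a *: u + v) = a *: L u + L v.
Proof.
move=> Du Dv; have [[_ sD] _ _ _ [lin _]] := L_sa.
by split; [exact: sD | exact: lin].
Qed.

Lemma sa_symmetric u v : dom L u -> dom L v -> ip (L u) v = ip u (L v).
Proof.
move=> Du Dv; have [_ _ _ _ [_ adj]] := L_sa.
by have [_ h] := adj v (L v) I I; apply: (h (conj Dv erefl)).
Qed.

(** Below [omega] there is no absolutely continuous spectrum, so that a point of the
    spectrum is one of the finitely many discrete or embedded eigenvalues. *)
Lemma spectrum_below : exists s : seq R,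
  (forall w, w < omega -> w \notin s -> regular ip (dom L) L setT w) /\
  (forall w, w \in s -> (alg_mult L (op_id setT) w%:C < +oo)%E).
Proof.
have [ess ac finE multE _] := P1.
have [sE hE] := (finite_seqP _).1 finE.
have [sD hD] := (finite_seqP _).1 P2.
exists [seq Re z | z <- sE ++ sD & Im z == 0]; split; last first.
  move=> w /mapP[z]; rewrite mem_filter mem_cat => /andP[/eqP Iz hz] ->.
  have -> : (Re z)%:C = z by apply: complexP.
  case/orP: hz => hz.
    by apply: multE; rewrite hE.
  by have [] : discrete_spectrum setT L z by rewrite [discrete_spectrum _ _]hD.
move=> w wo ws.
have : resolvent_set setT L w%:C.
  apply: contrapT => hspec.
  have wn : w%:C \notin sE ++ sD.
    apply: contra ws => hw; apply/mapP; exists w%:C => //.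
    by rewrite mem_filter hw eqxx.
  have nd : ~ discrete_spectrum setT L w%:C.
    rewrite [discrete_spectrum _ _]hD /= => h.
    by rewrite mem_cat (h : _ \in sD) orbT in wn.
  have : essential_spectrum setT L w%:C by split.
  rewrite ess => -[/ac|]; first by rewrite lecR leNgt wo.
  rewrite hE /= => h.
  by rewrite mem_cat (h : _ \in sE) in wn.
move=> [sur [c hc]]; split.
  by move=> f _; have [u Du hu] := sur f I; exists u.
exists (`|c| ^+ 2); first exact: sqr_ge0.
move=> u _ Du; apply: n2_le_norm => //.
apply: le_trans (hc u Du) _; rewrite ler_wpM2r //.
by rewrite lecR ler_norm.
Qed.
End SelfAdjoint.
End NegativeSpectrum.

(** * Strictly dissipative matrix pencils *)

Section DissipativePencil.
Variable R : realType.
Local Notation C := R[i].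

Definition adjmx m n (A : 'M[C]_(m, n)) : 'M[C]_(n, m) :=
  (map_mx (@conjc R) A)^T.

Lemma adjmxM m n p (A : 'M[C]_(m, n)) (B : 'M[C]_(n, p)) :
  adjmx (A *m B) = adjmx B *m adjmx A.
Proof. by rewrite /adjmx map_mxM trmx_mul. Qed.
Lemma adjmxK m n (A : 'M[C]_(m, n)) : adjmx (adjmx A) = A.
Proof. by apply/matrixP => i j; rewrite !mxE conjcK. Qed.
Lemma adjmxD m n (A B : 'M[C]_(m, n)) : adjmx (A + B) = adjmx A + adjmx B.
Proof. by apply/matrixP => i j; rewrite !mxE rmorphD. Qed.
Lemma adjmx0 m n : adjmx (0 : 'M[C]_(m, n)) = 0.
Proof. by apply/matrixP => i j; rewrite !mxE conjc0. Qed.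
Lemma adjmxZ m n a (A : 'M[C]_(m, n)) : adjmx (a *: A) = a^*%C *: adjmx A.
Proof. by apply/matrixP => i j; rewrite !mxE rmorphM. Qed.
Lemma rank_adjmx m n (A : 'M[C]_(m, n)) : \rank (adjmx A) = \rank A.
Proof. by rewrite mxrank_tr mxrank_map. Qed.
Lemma adjmx_col m1 m2 n (A : 'M[C]_(m1, n)) (B : 'M[C]_(m2, n)) :
  adjmx (col_mx A B) = row_mx (adjmx A) (adjmx B).
Proof. by rewrite /adjmx map_col_mx tr_col_mx. Qed.

Definition mxform n (H : 'M[C]_n) (v : 'rV[C]_n) : C :=
  (v *m H *m adjmx v) 0 0.

Lemma mxform_real n (H : 'M[C]_n) v : adjmx H = H ->
  mxform H v = (Re (mxform H v))%:C.
Proof.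
move=> HH; apply: complexP => //=.
have E : adjmx (v *m H *m adjmx v) = v *m H *m adjmx v.
  by rewrite !adjmxM adjmxK HH mulmxA.
have : Im (mxform H v) = - Im (mxform H v).
  by rewrite /mxform -{1}E /adjmx !mxE cIm_conj.
by lra.
Qed.

Lemma mxform_mul m n (H : 'M[C]_n) (B : 'M[C]_(m, n)) (c : 'rV[C]_m) :
  mxform (B *m H *m adjmx B) c = mxform H (c *m B).
Proof. by rewrite /mxform adjmxM !mulmxA. Qed.

Lemma eq11 (A B : 'M[C]_1) : A 0 0 = B 0 0 -> A = B.
Proof. by move=> h; apply/matrixP => i j; rewrite !ord1. Qed.

Lemma mx11B a (A B : 'M[C]_1) : (A - a *: B) 0 0 = A 0 0 - a * B 0 0.
Proof. by rewrite !mxE. Qed.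

Lemma eigenvalue_det0 n (M : 'M[C]_n) l : eigenvalue M l -> \det (l%:M - M) = 0.
Proof.
move=> /eigenvalueP[v vM v0].
apply/eqP; rewrite -[_ == 0]negbK -unitfE -unitmxE -row_free_unit.
rewrite -kermx_eq0; apply/negP => /eqP h.
have : (v <= kermx (l%:M - M))%MS.
  by apply/sub_kermxP; rewrite mulmxBr vM mul_mx_scalar subrr.
by rewrite h submx0 (negPf v0).
Qed.

Section Compression.
Variables (N : nat) (H A : 'M[C]_N) (x : 'rV[C]_N) (l : C).
Hypothesis HH : adjmx H = H.
Hypothesis xA : x *m A = l *: (x *m H).
Let rho : R := Re (mxform H x).
Hypothesis rho0 : rho != 0.

Let hx : H *m adjmx x != 0.
Proof.
apply: contraNneq rho0 => h; rewrite /rho /mxform -mulmxA h mulmx0 mxE.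
by [].
Qed.

(** A basis of the complement of [x] that is orthogonal for the form [H]; locked,
    since unification would otherwise unfold the elimination behind it. *)
Definition perp_basis := locked (row_base (kermx (H *m adjmx x))).
Local Notation B := perp_basis.

Lemma perp_rank : (\rank (kermx (H *m adjmx x)) < N)%N.
Proof.
rewrite mxrank_ker; have := rank_leq_row (H *m adjmx x).
have : (0 < \rank (H *m adjmx x))%N by rewrite lt0n mxrank_eq0.
by case: (\rank _) => // r _ h; rewrite ltn_subrL (leq_trans _ h).
Qed.

Lemma perp_orthogonal : B *m H *m adjmx x = 0.
Proof.
by rewrite /perp_basis -lock -mulmxA; apply/sub_kermxP; rewrite eq_row_base.
Qed.

Lemma perp_orthogonal' : x *m H *m adjmx B = 0.
Proof.
have h : adjmx (x *m H *m adjmx B) = B *m H *m adjmx x.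
  by rewrite !adjmxM adjmxK HH mulmxA.
by rewrite -[LHS]adjmxK h perp_orthogonal adjmx0.
Qed.

Lemma perp_orthogonal_mul m (c : 'M[C]_(m, _)) : c *m B *m H *m adjmx x = 0.
Proof. by rewrite -(mulmxA c) -(mulmxA c) perp_orthogonal mulmx0. Qed.

Lemma perp_inj m (c : 'M[C]_(m, _)) : c *m B = 0 -> c = 0.
Proof.
rewrite /perp_basis -lock => h.
by apply: (row_free_inj (row_base_free _)); rewrite h mul0mx.
Qed.

Lemma perp_mem (v : 'rV[C]_N) : v *m H *m adjmx x = 0 -> exists c, v = c *m B.
Proof.
move=> h; have : (v <= B)%MS.
  by rewrite /perp_basis -lock eq_row_base; apply/sub_kermxP; rewrite mulmxA.
by move=> /submxP[c ->]; exists c.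
Qed.

Lemma perp_annihilator m (y : 'M[C]_(m, N)) :
  y *m adjmx B = 0 -> exists r : 'cV[C]_m, y = r *m (x *m H).
Proof.
move=> h; have xH0 : x *m H != 0.
  apply: contraNneq rho0 => h'; rewrite /rho /mxform h' mul0mx mxE.
  by [].
have yk : (y <= kermx (adjmx B))%MS by apply/sub_kermxP.
have xk : (x *m H <= kermx (adjmx B))%MS by apply/sub_kermxP; exact: perp_orthogonal'.
have rk : \rank (kermx (adjmx B)) = 1%N.
  rewrite mxrank_ker rank_adjmx /perp_basis -lock (eqP (row_base_free _)) mxrank_ker.
  have := rank_leq_col (H *m adjmx x).
  have : (0 < \rank (H *m adjmx x))%N by rewrite lt0n mxrank_eq0.
  have := rank_leq_row (H *m adjmx x).
  by move: (\rank _) => [|[|?]] // h1 _ _; rewrite subKn.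
have : (kermx (adjmx B) <= x *m H)%MS.
  by rewrite -(geq_leqif (mxrank_leqif_sup xk)) rk lt0n mxrank_eq0.
move=> /(submx_trans yk) /submxP[r ->]; by exists r.
Qed.

Lemma perp_decomposition (v : 'rV[C]_N) :
  exists a c, v = a *: x + c *m B.
Proof.
pose a := (v *m H *m adjmx x) 0 0 / rho%:C.
have [c hc] : exists c, v - a *: x = c *m B.
  apply: perp_mem; rewrite mulmxBl mulmxBl -scalemxAl -scalemxAl.
  apply: eq11; rewrite mx11B -/(mxform H x) mxform_real // [RHS]mxE.
  by rewrite -/rho /a divfK ?subrr // fmorph_eq0.
by exists a, c; rewrite -hc addrC subrK.
Qed.

Lemma perp_form a c :
  Re (mxform H (a *: x + c *m B)) = sqm a * rho + Re (mxform H (c *m B)).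
Proof.
rewrite /mxform adjmxD adjmxZ !mulmxDl !mulmxDr -!scalemxAl -!scalemxAr.
have -> : x *m H *m adjmx (c *m B) = 0.
  by rewrite adjmxM mulmxA perp_orthogonal' mul0mx.
rewrite perp_orthogonal_mul !scaler0 addr0 add0r.
have gen b (M M' : 'M[C]_1) : (b *: M + M') 0 0 = b * M 0 0 + M' 0 0.
  by rewrite !mxE.
rewrite scalerA gen -/(mxform H x) mxform_real // -/rho conjc_sqm -rmorphM.
by rewrite cReD.
Qed.

Lemma perp_unit : H \in unitmx -> B *m H *m adjmx B \in unitmx.
Proof.
move=> uH; rewrite -row_free_unit -kermx_eq0.
apply/rowV0P => c /sub_kermxP; rewrite !mulmxA => hc.
have [r hr] := perp_annihilator hc.
have := perp_orthogonal_mul c; rewrite hr => /(congr1 (fun M : 'M[C]_1 => M 0 0)).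
rewrite -(mulmxA r) [r]mx11_scalar mul_scalar_mx.
have gen (b : C) (M : 'M[C]_1) : (b *: M) 0 0 = b * M 0 0 by rewrite mxE.
rewrite gen -/(mxform H x) mxform_real // -/rho [RHS]mxE.
move=> /eqP; rewrite mulf_eq0 fmorph_eq0 (negPf rho0) orbF => /eqP r0.
have {}r0 : r = 0 by apply: eq11; rewrite r0 mxE.
rewrite r0 mul0mx in hr; apply: perp_inj.
by rewrite -[LHS](mulmxK uH) hr mul0mx.
Qed.
End Compression.

(** For an eigenvector, [x A = z x H] and [Im (x A x^star) > 0] give
    [Im z * (x H x^star) > 0]: there are no real eigenvalues, eigenvectors for
    [Im z < 0] are negative and those for [Im z > 0] are positive. Hence one can
    split off one eigenvector after the other and continue with the compression
    to its orthogonal complement, taking those of the lower half plane first.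
    The rows of [W] span the invariant negative subspace obtained; it is maximal
    because the form is nonnegative on its orthogonal complement. *)
Theorem dissipative_negative_subspace N (H A : 'M[C]_N) :
  adjmx H = H -> H \in unitmx ->
  (forall u : 'rV_N, u != 0 -> 0 < Im (mxform A u)) ->
  exists k (W : 'M[C]_(k, N)) (M : 'M[C]_k),
    [/\ W *m A = M *m W *m H,
        forall c : 'rV_k, c != 0 -> Re (mxform H (c *m W)) < 0,
        forall v, v *m H *m adjmx W = 0 -> 0 <= Re (mxform H v)
      & exists s : seq C, [/\ size s = k, all (fun z => Im z < 0) s
          & forall z, \det (z%:M - M) = \prod_(y <- s) (z - y)]].
Proof.
have [b Nb] := ubnP N; elim: b N Nb H A => // b IH [|N] Nb H A HH uH Apos.
  exists 0%N, 0, 0; split.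
  - by apply/matrixP => -[].
  - by move=> c; rewrite [c]thinmx0 eqxx.
  - by move=> v _; rewrite [v]thinmx0 /mxform mul0mx mul0mx mxE.
  - by exists [::]; split=> // z; rewrite det_mx00 big_nil.
have pencil_eigen l (y : 'rV_N.+1) : y *m (A *m invmx H) = l *: y ->
    y *m A = l *: (y *m H).
  by move=> h; rewrite scalemxAl -h !mulmxA mulmxKV.
have eigen_form l (y : 'rV_N.+1) : y *m A = l *: (y *m H) ->
    Im (mxform A y) = Im l * Re (mxform H y).
  move=> h; rewrite /mxform h -scalemxAl mxE -/(mxform H y) mxform_real // cImM /=.
  by rewrite mulr0 add0r.
have [[l [x [xl x0 il]]]|no] := pselect (exists l (x : 'rV_N.+1),
    [/\ x *m A = l *: (x *m H), x != 0 & Im l < 0]).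
- have := Apos x x0; rewrite (eigen_form l) // => pos.
  have rneg : Re (mxform H x) < 0 by nra.
  have rn0 : Re (mxform H x) != 0 by rewrite lt_eqF.
  set B := perp_basis H x.
  have [||||k [W [M [WA Wneg Wpos [s [sk sneg sdet]]]]]] :=
    IH _ _ (B *m H *m adjmx B) (B *m A *m adjmx B).
  + by apply: leq_trans (perp_rank rn0) _; rewrite -ltnS.
  + by rewrite !adjmxM adjmxK HH mulmxA.
  + exact: perp_unit.
  + move=> c c0; rewrite mxform_mul; apply: Apos.
    by apply: contra_neq c0; exact: perp_inj.
  have [r hr] : exists r : 'cV_k, W *m B *m A - M *m (W *m B) *m H = r *m (x *m H).
    apply: (perp_annihilator HH rn0); rewrite -/B mulmxBl.
    by rewrite !mulmxA in WA *; rewrite WA subrr.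
  have hWA : W *m B *m A = (r *m x + M *m (W *m B)) *m H.
    by rewrite mulmxDl -[r *m x *m H]mulmxA -hr subrK.
  exists (1 + k)%N, (col_mx x (W *m B)), (block_mx l%:M 0 r M); split.
  + rewrite mul_col_mx mul_block_col mul_col_mx hWA xl mul0mx addr0.
    by rewrite mul_scalar_mx scalemxAl.
  + move=> c; rewrite -[c]hsubmxK mul_row_col; set a := lsubmx c; set d := rsubmx c.
    move=> c0; have -> : a *m x = a 0 0 *: x.
      by rewrite {1}[a]mx11_scalar mul_scalar_mx.
    rewrite mulmxA perp_form //.
    have [d0|d0] := eqVneq d 0.
      rewrite d0 !mul0mx /mxform !mul0mx [X in _ + Re X]mxE /= addr0.
      rewrite pmulr_rlt0 //; apply: sqm_gt0; apply: contra_neq c0 => a0.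
      have -> : a = 0 by apply: eq11; rewrite a0 mxE.
      by rewrite d0 row_mx0.
    have := Wneg d d0; rewrite mxform_mul => h1.
    have := sqm_ge0 (a 0 0); nra.
  + move=> v; rewrite adjmx_col mul_mx_row => h.
    have [h1 h2] : v *m H *m adjmx x = 0 /\ v *m H *m adjmx (W *m B) = 0.
      by apply: eq_row_mx; rewrite row_mx0 h.
    have [c hc] := perp_mem h1; rewrite hc -mxform_mul; apply: Wpos.
    by rewrite !mulmxA -hc -mulmxA -adjmxM.
  + exists (l :: s); split=> /=; [by rewrite sk|by rewrite il sneg|].
    move=> z; rewrite big_cons -sdet scalar_mx_block opp_block_mx add_block_mx.
    rewrite oppr0 !add0r det_lblock; congr (_ * _).
    by rewrite -raddfB /= det_scalar1.
- have [l /eigenvalueP[x xl x0]] := eigenvalue_closed (A *m invmx H) (ltn0Sn N).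
  have xA := pencil_eigen l x xl.
  have il : 0 <= Im l.
    by rewrite leNgt; apply/negP => il; apply: no; exists l, x.
  have := Apos x x0; rewrite (eigen_form l) // => pos.
  have rpos : 0 < Re (mxform H x) by nra.
  have rn0 : Re (mxform H x) != 0 by rewrite gt_eqF.
  set B := perp_basis H x.
  have [||||k [W [M [WA Wneg Wpos [s [sk sneg sdet]]]]]] :=
    IH _ _ (B *m H *m adjmx B) (B *m A *m adjmx B).
  + by apply: leq_trans (perp_rank rn0) _; rewrite -ltnS.
  + by rewrite !adjmxM adjmxK HH mulmxA.
  + exact: perp_unit.
  + move=> c c0; rewrite mxform_mul; apply: Apos.
    by apply: contra_neq c0; exact: perp_inj.
  have k0 : k = 0%N.
    apply/eqP; rewrite -leqn0 leqNgt; apply/negP => kpos; apply: no.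
    have [l' el'] := eigenvalue_closed M kpos.
    have /eigenvalueP[d dl d0] := el'.
    have l's : l' \in s.
      have := eigenvalue_det0 el'; rewrite sdet => /eqP; rewrite prodf_seq_eq0 => /hasP[y ys /=].
      by rewrite subr_eq0 => /eqP ->.
    have il' : Im l' < 0 by move/allP: sneg => /(_ _ l's).
    have [r hr] : exists r : 'cV_1,
        d *m W *m B *m A - l' *: (d *m W *m B *m H) = r *m (x *m H).
      apply: (perp_annihilator HH rn0); rewrite -/B mulmxBl -scalemxAl.
      have := congr1 (mulmx d) WA; rewrite !mulmxA dl -!scalemxAl => ->.
      by rewrite subrr.
    pose t := - (r 0 0) / (l - l').
    have ll' : l - l' != 0.
      rewrite subr_eq0; apply: contraTneq il => ->.
      by rewrite -ltNge.
    exists l', (d *m W *m B + t *: x); split=> //.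
      rewrite mulmxDl -scalemxAl xA mulmxDl scalerDr -scalemxAl.
      move/eqP: hr; rewrite subr_eq => /eqP ->.
      have key : r 0 0 + t * l = l' * t by rewrite /t; field.
      rewrite [r]mx11_scalar mul_scalar_mx !scalerA -key addrAC -scalerDl.
      by rewrite addrC.
    have := Wneg d d0; rewrite mxform_mul -/B => hn.
    apply: contraTneq hn => h.
    have : (d *m W *m B + t *: x) *m H *m adjmx x = 0 by rewrite h !mul0mx.
    rewrite mulmxDl mulmxDl perp_orthogonal_mul add0r -!scalemxAl.
    move=> /(congr1 (fun M : 'M[C]_1 => M 0 0)); rewrite [LHS]mxE [RHS]mxE.
    rewrite -/(mxform H x) mxform_real // => /eqP.
    rewrite mulf_eq0 fmorph_eq0 (negPf rn0) orbF => /eqP t0.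
    by rewrite t0 scale0r addr0 in h; rewrite h /mxform !mul0mx mxE ltxx.
  move: W M WA Wneg Wpos sk sdet; rewrite k0 => W M WA Wneg Wpos sk sdet.
  exists 0%N, 0, 0; split.
  + by apply/matrixP => -[].
  + by move=> c; rewrite [c]thinmx0 eqxx.
  + move=> v _; have [a [c ->]] := perp_decomposition HH rn0 v.
    rewrite perp_form //; apply: addr_ge0.
      by rewrite mulr_ge0 ?sqm_ge0 // ltW.
    by rewrite -mxform_mul; apply: Wpos; apply/matrixP => i [].
  + by exists [::]; split=> // z; rewrite det_mx00 big_nil.
Qed.
End DissipativePencil.

(** * Limits along ultrafilters *)

Section UltraLimits.
Variables (R : realType) (I : Type) (U : set_system I).
Hypothesis UU : UltraFilter U.
Local Notation C := R[i].
Implicit Types (f g : I -> C) (a b : C).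

Let PU : ProperFilter U. Proof. exact: ultra_proper. Qed.

Lemma ultra_fmap T (f : I -> T) : UltraFilter (f @ U).
Proof.
split; first exact: fmap_proper_filter.
move=> G PG sG; apply/seteqP; split=> // A GA.
have [//|nA] := in_ultra_setVsetC (f @^-1` A) UU.
exfalso; apply: (@filter_not_empty _ G).
by rewrite -(setICr A); apply: filterI => //; apply: sG.
Qed.

(** Stated in components, so that the limit theorems for real functions apply. *)
Definition ucvg f a : Prop :=
  (fun i => Re (f i)) @ U --> Re a /\ (fun i => Im (f i)) @ U --> Im a.

Lemma ucvg_bounded f (M : R) : (forall i, sqm (f i) <= M) -> exists a, ucvg f a.
Proof.
move=> h.
have lim (g : I -> R) : (forall i, g i ^+ 2 <= M) -> exists l : R, g @ U --> l.
  move=> hg; have := @segment_compact R (- (M + 1)) (M + 1).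
  rewrite compact_ultra => /(_ (g @ U) (ultra_fmap g)).
  case; last by move=> l [_ hl]; exists l.
  apply: (@filterE _ U) => i; rewrite /= in_itv /=.
  by have := hg i; have := sqr_ge0 (g i); move: (g i) => x x1 x2; nra.
have [i|x hx] := lim (fun i => Re (f i)).
  by apply: le_trans (h i); rewrite lerDl sqr_ge0.
have [i|y hy] := lim (fun i => Im (f i)).
  by apply: le_trans (h i); rewrite lerDr sqr_ge0.
by exists (Complex x y).
Qed.

Lemma ucvg_unique f a b : ucvg f a -> ucvg f b -> a = b.
Proof.
move=> [h1 h2] [h3 h4]; apply: complexP.
- exact: (cvg_unique _ h1 h3).
- exact: (cvg_unique _ h2 h4).
Qed.

Lemma ucvg_near f g a : U [set i | f i = g i] -> ucvg f a -> ucvg g a.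
Proof.
move=> fg [h1 h2]; split.
- by apply: cvg_trans h1; apply: near_eq_cvg; apply: filterS fg => i ->.
- by apply: cvg_trans h2; apply: near_eq_cvg; apply: filterS fg => i ->.
Qed.

Lemma ucvg_eq f g a : (forall i, f i = g i) -> ucvg f a -> ucvg g a.
Proof. by move=> fg; apply: ucvg_near; apply: filterE => i; exact: fg. Qed.

Lemma ucvg_cst a : ucvg (fun=> a) a.
Proof. by split; exact: cvg_cst. Qed.

Lemma ucvgD f g a b : ucvg f a -> ucvg g b -> ucvg (fun i => f i + g i) (a + b).
Proof.
move=> [h1 h2] [h3 h4]; split; rewrite ?cReD ?cImD.
- under eq_cvg do rewrite cReD; exact: cvgD.
- under eq_cvg do rewrite cImD; exact: cvgD.
Qed.

Lemma ucvgM f g a b : ucvg f a -> ucvg g b -> ucvg (fun i => f i * g i) (a * b).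
Proof.
move=> [h1 h2] [h3 h4]; split; rewrite ?cReM ?cImM.
- under eq_cvg do rewrite cReM; apply: cvgB; exact: cvgM.
- under eq_cvg do rewrite cImM; apply: cvgD; exact: cvgM.
Qed.

Lemma ucvg_conj f a : ucvg f a -> ucvg (fun i => (f i)^*%C) a^*%C.
Proof.
move=> [h1 h2]; split; rewrite ?cRe_conj ?cIm_conj.
- by under eq_cvg do rewrite cRe_conj.
- by under eq_cvg do rewrite cIm_conj; exact: cvgN.
Qed.

Lemma ucvg_sum J (r : seq J) (P : pred J) (F : J -> I -> C) (G : J -> C) :
  (forall j, P j -> ucvg (F j) (G j)) ->
  ucvg (fun i => \sum_(j <- r | P j) F j i) (\sum_(j <- r | P j) G j).
Proof.
move=> h; elim: r => [|j r IH].
  rewrite big_nil; apply: ucvg_eq (ucvg_cst 0) => i; by rewrite big_nil.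
rewrite big_cons; case: ifPn => Pj.
  apply: ucvg_eq (ucvgD (h j Pj) IH) => i; by rewrite big_cons Pj.
by apply: ucvg_eq IH => i; rewrite big_cons (negPf Pj).
Qed.

Lemma ucvg_prod J (r : seq J) (P : pred J) (F : J -> I -> C) (G : J -> C) :
  (forall j, P j -> ucvg (F j) (G j)) ->
  ucvg (fun i => \prod_(j <- r | P j) F j i) (\prod_(j <- r | P j) G j).
Proof.
move=> h; elim: r => [|j r IH].
  rewrite big_nil; apply: ucvg_eq (ucvg_cst 1) => i; by rewrite big_nil.
rewrite big_cons; case: ifPn => Pj.
  apply: ucvg_eq (ucvgM (h j Pj) IH) => i; by rewrite big_cons Pj.
by apply: ucvg_eq IH => i; rewrite big_cons (negPf Pj).
Qed.

Lemma ucvg_det n (F : I -> 'M[C]_n) (G : 'M[C]_n) :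
  (forall j k, ucvg (fun i => F i j k) (G j k)) ->
  ucvg (fun i => \det (F i)) (\det G).
Proof.
move=> h; apply: ucvg_sum => s _; apply: ucvgM; first exact: ucvg_cst.
by apply: ucvg_prod => j _.
Qed.

Lemma ucvg_Re_ge f a (x : R) : (forall i, x <= Re (f i)) -> ucvg f a -> x <= Re a.
Proof.
move=> h [h1 _]; apply: (@closed_cvg _ _ _ _ _ [set y | x <= y] _ _ _ h1).
  exact: closed_ge.
by apply: filterE => i; exact: h.
Qed.

Lemma ucvg_sqm f a : ucvg f a -> ucvg (fun i => (sqm (f i))%:C) (sqm a)%:C.
Proof.
move=> h; rewrite -conjc_sqm.
by apply: ucvg_eq (ucvgM h (ucvg_conj h)) => i; rewrite conjc_sqm.
Qed.
End UltraLimits.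

(** Along this ultrafilter the finite list exhausts [X], as does the sequence of
    finite-dimensional subspaces of a separable space, and the natural number tends
    to infinity; it governs the size of a perturbation. *)
Lemma list_ultrafilter (X : eqType) : exists U : set_system (seq X * nat)%type,
  [/\ UltraFilter U, forall x : X, U [set i : seq X * nat | x \in i.1]
    & forall n, U [set i : seq X * nat | (n <= i.2)%N]].
Proof.
pose B (p : seq X * nat) := [set i : seq X * nat |
  {subset p.1 <= i.1} /\ (p.2 <= i.2)%N].
have FB : ProperFilter (filter_from setT B).
  apply: filter_from_proper; last by move=> p _; exists p; split.
  apply: filter_from_filter; first by exists ([::], 0%N).
  move=> p p' _ _; exists (p.1 ++ p'.1, maxn p.2 p'.2) => // i [/= h1 h2].
  move: h2; rewrite geq_max => /andP[h2 h3].
  split; split=> // x xp; apply: h1; by rewrite mem_cat xp ?orbT.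
have [U [UU sU]] := ultraFilterLemma FB; exists U; split=> //.
- move=> x; apply: sU; exists ([:: x], 0%N) => // i [/= h _].
  by apply: h; rewrite inE.
- by move=> n; apply: sU; exists ([::], n) => // i [].
Qed.

(** * Invariant nonpositive subspaces *)

Section Gram.
Variables (R : realType) (X : completeNormedModType R[i]).
Local Notation C := R[i].
Implicit Types (u v : X).

(** Matrices act on families as on columns, which turns computations with linear
    combinations into matrix algebra. *)
Definition fmul m n (A : 'M[C]_(m, n)) (v : 'I_n -> X) : 'I_m -> X :=
  fun r => \sum_i A r i *: v i.

Lemma fmulM m n p (A : 'M[C]_(m, n)) (B : 'M[C]_(n, p)) (v : 'I_p -> X) r :
  fmul A (fmul B v) r = fmul (A *m B) v r.
Proof.
rewrite /fmul; under eq_bigr do rewrite scaler_sumr.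
rewrite exchange_big; apply: eq_bigr => i _; rewrite mxE scaler_suml.
by apply: eq_bigr => j _; rewrite scalerA.
Qed.

Lemma fmul_in (V : set X) m n (A : 'M[C]_(m, n)) (v : 'I_n -> X) : subspace V ->
  (forall i, V (v i)) -> forall r, V (fmul A v r).
Proof. by move=> sV Vv r; apply: subspace_sum => // i _; exact: subspaceZ. Qed.

Lemma fmul_eq0 n (c : 'rV[C]_n) (v : 'I_n -> X) :
  lin_indep v -> fmul c v 0 = 0 -> c = 0.
Proof. by move=> iv h; apply/rowP => i; rewrite mxE; exact: iv h i. Qed.

Lemma fmul_row n (c : 'I_n -> C) (v : 'I_n -> X) :
  \sum_i c i *: v i = fmul (\row_i c i) v 0.
Proof. by apply: eq_bigr => i _; rewrite mxE. Qed.

Lemma fmul_delta n (v : 'I_n -> X) i : fmul (delta_mx 0 i) v (0 : 'I_1) = v i.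
Proof.
rewrite /fmul (bigD1 i) //= mxE !eqxx scale1r big1 ?addr0 // => j /negPf ji.
by rewrite mxE eqxx ji scale0r.
Qed.

Lemma fmul1 n (v : 'I_n -> X) i : fmul 1%:M v i = v i.
Proof.
rewrite /fmul (bigD1 i) //= mxE eqxx scale1r big1 ?addr0 // => j /negPf ji.
by rewrite mxE eq_sym ji scale0r.
Qed.

Lemma fmul0 m n (v : 'I_n -> X) (i : 'I_m) : fmul (0 : 'M[C]_(m, n)) v i = 0.
Proof. by rewrite /fmul big1 // => j _; rewrite mxE scale0r. Qed.

Lemma linear_fmul (B : {linear X -> X}) m n (A : 'M[C]_(m, n)) (v : 'I_n -> X) r :
  B (fmul A v r) = fmul A (fun i => B (v i)) r.
Proof. by rewrite /fmul linear_sum; apply: eq_bigr => i _; rewrite linearZ. Qed.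

Lemma lin_indep_fmul m n (A : 'M[C]_(m, n)) (v : 'I_n -> X) :
  lin_indep v -> row_free A -> lin_indep (fmul A v).
Proof.
move=> iv fA c; rewrite fmul_row fmulM => /(fmul_eq0 iv) h i.
have /rowP/(_ i) : \row_i c i = 0 :> 'rV_m.
  by apply: (row_free_inj fA); rewrite h mul0mx.
by rewrite !mxE.
Qed.

Definition sesquilinear_form (b : X -> X -> C) : Prop :=
  (forall a u v w, b (a *: u + v) w = a * b u w + b v w) /\
  (forall a u v w, b w (a *: u + v) = a^*%C * b w u + b w v).

Lemma hermitian_sesquilinear b : hermitian_form b -> sesquilinear_form b.
Proof.
move=> hb; split=> [a u v w|a u v w]; first by case: hb.
by rewrite (hermDr hb) (hermZr hb).
Qed.

Definition gram (b : X -> X -> C) m n (u : 'I_m -> X) (v : 'I_n -> X) : 'M[C]_(m, n) :=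
  \matrix_(i, j) b (u i) (v j).

Section Sesq.
Variable b : X -> X -> C.
Hypothesis hb : sesquilinear_form b.

Lemma sesq0l w : b 0 w = 0.
Proof.
have := hb.1 1 0 0 w; rewrite scale1r addr0 mul1r => /eqP.
by rewrite -subr_eq subrr eq_sym => /eqP.
Qed.
Lemma sesq0r w : b w 0 = 0.
Proof.
have := hb.2 1 0 0 w; rewrite scale1r addr0 conjc1 mul1r => /eqP.
by rewrite -subr_eq subrr eq_sym => /eqP.
Qed.
Lemma sesqDl u v w : b (u + v) w = b u w + b v w.
Proof. by have := hb.1 1 u v w; rewrite scale1r mul1r. Qed.
Lemma sesqDr u v w : b w (u + v) = b w u + b w v.
Proof. by have := hb.2 1 u v w; rewrite scale1r conjc1 mul1r. Qed.
Lemma sesqZl a u w : b (a *: u) w = a * b u w.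
Proof. by have := hb.1 a u 0 w; rewrite addr0 sesq0l addr0. Qed.
Lemma sesqZr a u w : b w (a *: u) = a^*%C * b w u.
Proof. by have := hb.2 a u 0 w; rewrite addr0 sesq0r addr0. Qed.

Lemma sesq_fmull m n (A : 'M[C]_(m, n)) (u : 'I_n -> X) v r :
  b (fmul A u r) v = \sum_i A r i * b (u i) v.
Proof.
rewrite (big_morph (b^~ v) (fun x y => sesqDl x y v) (sesq0l v)).
by apply: eq_bigr => i _; rewrite sesqZl.
Qed.
Lemma sesq_fmulr m n (A : 'M[C]_(m, n)) (u : 'I_n -> X) v r :
  b v (fmul A u r) = \sum_i b v (u i) * (A r i)^*%C.
Proof.
rewrite (big_morph (b v) (fun x y => sesqDr x y v) (sesq0r v)).
by apply: eq_bigr => i _; rewrite sesqZr mulrC.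
Qed.

Lemma gramMl m n p (A : 'M[C]_(m, n)) (u : 'I_n -> X) (v : 'I_p -> X) :
  gram b (fmul A u) v = A *m gram b u v.
Proof.
apply/matrixP => i j; rewrite !mxE sesq_fmull.
by apply: eq_bigr => k _; rewrite mxE.
Qed.
Lemma gramMr m n p (A : 'M[C]_(m, n)) (u : 'I_p -> X) (v : 'I_n -> X) :
  gram b u (fmul A v) = gram b u v *m adjmx A.
Proof.
apply/matrixP => i j; rewrite !mxE sesq_fmulr.
by apply: eq_bigr => k _; rewrite !mxE.
Qed.
Lemma mxform_gram n (c : 'rV[C]_n) (v : 'I_n -> X) :
  mxform (gram b v v) c = b (fmul c v 0) (fmul c v 0).
Proof.
by rewrite /mxform -gramMl -gramMr mxE.
Qed.
End Sesq.

Lemma basis_of_list (V : set X) (s : seq X) : (forall x, x \in s -> V x) ->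
  exists n (b : 'I_n -> X), [/\ forall i, V (b i), lin_indep b
    & forall x, x \in s -> exists c : 'rV[C]_n, x = fmul c b 0].
Proof.
elim: s => [|x s IH] hs.
  by exists 0%N, (fun=> 0); split=> [[]//||//]; exact: lin_indep0.
have [y ys|n [b [Vb ib hb]]] := IH; first by apply: hs; rewrite in_cons ys orbT.
have [[c xc]|no] := pselect (exists c : 'rV[C]_n, x = fmul c b 0).
  exists n, b; split=> // y; rewrite in_cons => /orP[/eqP ->|]; last exact: hb.
  by exists c.
exists n.+1, (fcons x b); split.
- by apply: fcons_in => //; apply: hs; rewrite in_cons eqxx.
- apply: lin_indep_fcons => // c xc; apply: no; exists (\row_i c i).
  by rewrite -fmul_row.
- move=> y; rewrite in_cons => /orP[/eqP ->|ys].
    exists (\row_i (i == ord0)%:R); rewrite /fmul.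
    under eq_bigr do rewrite mxE.
    rewrite sum_fcons eqxx scale1r big1 ?addr0 // => i _.
    by rewrite -val_eqE /= scale0r.
  have [c ->] := hb y ys.
  exists (\row_i oapp (c 0) 0 (unlift ord0 i)); rewrite /fmul.
  under [RHS]eq_bigr do rewrite mxE.
  rewrite sum_fcons unlift_none /= scale0r add0r.
  by apply: eq_bigr => i _; rewrite liftK.
Qed.
End Gram.

(** Such a family is independent, as a nontrivial combination has a nonzero value
    of the form. *)
Definition negative_family (R : realType) (X : completeNormedModType R[i])
    (ip : X -> X -> R[i]) (V : set X) (T : X -> X) n (v : 'I_n -> X) : Prop :=
  (forall i, V (v i)) /\ forall c : 'rV[R[i]]_n, c != 0 ->
    Re (ip (T (fmul c v 0)) (fmul c v 0)) < 0.

(** The number of negative squares of the form [(T u, u)] on [V]. *)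
Definition negative_index (R : realType) (X : completeNormedModType R[i])
    (ip : X -> X -> R[i]) (V : set X) (T : X -> X) k : Prop :=
  (exists v : 'I_k -> X, negative_family ip V T v) /\
  (forall n (v : 'I_n -> X), negative_family ip V T v -> (n <= k)%N).

Lemma form_bound_arith (R : realType) (c r s t : R) : 0 <= c -> 0 <= t ->
  s <= c * t -> r ^+ 2 <= s * t -> r <= (c + 1) * t.
Proof.
move=> c0 t0 h1 h2; rewrite leNgt; apply/negP => h3.
have : ((c + 1) * t) ^+ 2 < r ^+ 2.
  rewrite ltr_sqr ?nnegrE //; first by rewrite mulr_ge0 //; lra.
  by apply: le_trans (ltW h3); rewrite mulr_ge0 //; lra.
have := ler_wpM2r t0 h1; nra.
Qed.

Section IndefiniteForm.
Variables (R : realType) (X : completeNormedModType R[i]).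
Variable (ip : X -> X -> R[i]).
Hypothesis hip : inner_product ip.
Local Notation C := R[i].
Local Notation hI := (ip_herm hip).
Local Notation n2 := (qf ip).
Implicit Types (u v : X).
Variables (H : set X) (K : {linear X -> X}).
Hypothesis sH : subspace H.
Hypothesis symK : symmetric_op ip K.
Hypothesis bdK : bounded_op ip K.
Hypothesis HK : forall u, H (K u).
Hypothesis injK : forall u, H u -> K u = 0 -> u = 0.

Definition krein_form u v := ip (K u) v.
Local Notation kf := krein_form.
Local Notation q := (qf kf).

Lemma krein_herm : hermitian_form kf.
Proof.
split=> [a u v w|u v]; first by rewrite /kf linearP (hermDl hI) (hermZl hI).
by rewrite /kf symK (herm_conj hI).
Qed.
Local Notation hk := krein_herm.
Local Notation sk := (hermitian_sesquilinear krein_herm).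

Variables (kappa : nat) (e : 'I_kappa -> X).
Hypothesis ne : negative_family ip H K e.
Hypothesis maxe : forall n (v : 'I_n -> X), negative_family ip H K v -> (n <= kappa)%N.

Let He i : H (e i). Proof. by case: ne. Qed.

(** The orthogonal complement of the span of [e]; the form is positive
    there, since [e] is maximal. *)
Definition eperp u : Prop := H u /\ forall i, kf u (e i) = 0.

Lemma eperp_subspace a u v : eperp u -> eperp v -> eperp (a *: u + v).
Proof.
move=> [Hu hu] [Hv hv]; split=> [|i]; first exact: sH.2.
by rewrite (hermDl hk) (hermZl hk) hu hv mulr0 addr0.
Qed.

Lemma eperp_ge0 u : eperp u -> 0 <= q u.
Proof.
move=> [Hu hu]; rewrite leNgt; apply/negP => qneg.
suff : negative_family ip H K (fcons u e) by move=> /maxe; rewrite ltnn.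
split=> [|c c0]; first exact: fcons_in.
rewrite /fmul sum_fcons; set w := \sum_i _.
have wE : w = fmul (\row_i c 0 (lift ord0 i)) e 0.
  by rewrite /w (fmul_row (fun i => c 0 (lift ord0 i))).
rewrite -[Re _]/(q _) (qfD hk) (qfZ hk) (hermZl hk).
have -> : kf u w = 0.
  by rewrite wE (sesq_fmulr sk) big1 // => i _; rewrite hu mul0r.
rewrite mulr0 /= mulr0 addr0.
have [d0|d0] := eqVneq (\row_i c 0 (lift ord0 i)) 0.
  rewrite wE d0 fmul0 (qf0 hk) addr0 pmulr_rlt0 //; apply: sqm_gt0.
  apply: contra_neq c0 => c00; apply/rowP => i; rewrite mxE.
  case: (unliftP ord0 i) => [j|] -> //.
  by have /rowP/(_ j) := d0; rewrite !mxE.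
have := ne.2 _ d0; rewrite -wE -[Re _]/(q w).
by have := sqm_ge0 (c 0 ord0); nra.
Qed.

Lemma gram_unit n (v : 'I_n -> X) : negative_family ip H K v ->
  gram kf v v \in unitmx.
Proof.
move=> nv; rewrite -row_free_unit -kermx_eq0; apply/rowV0P => c /sub_kermxP cG.
apply/eqP; apply: contraPT cG => c0 cG.
have := nv.2 _ c0; rewrite -[ip _ _]/(kf _ _) -(mxform_gram sk).
by rewrite /mxform cG mul0mx mxE ltxx.
Qed.

Local Notation Gm := (gram kf e e).

(** The coordinates of the projection onto the span of [e]. *)
Definition ecoef u : 'rV[C]_kappa := (\row_j kf u (e j)) *m invmx Gm.

Lemma ecoefP u : H u -> eperp (u - fmul (ecoef u) e 0).
Proof.
move=> Hu; split=> [|i].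
  by apply: subspaceB => //; exact: fmul_in.
rewrite (hermBl hk); apply/eqP; rewrite subr_eq0; apply/eqP.
have := gramMl sk (ecoef u) e e.
rewrite /ecoef mulmxKV ?gram_unit // => /rowP/(_ i).
by rewrite !mxE.
Qed.

(** By the Cauchy-Schwarz inequality in [eperp] an isotropic vector is orthogonal
    to [eperp], hence to everything. *)
Lemma eperp_eq0 u : eperp u -> q u = 0 -> u = 0.
Proof.
move=> pu qu; have [Hu hu] := pu; apply: injK => //.
apply: (ip_self_eq0 hip (V := H)) => // v Hv.
have pv := ecoefP Hv; set v' := v - _ in pv.
rewrite -[ip _ _]/(kf u v).
have -> : v = v' + fmul (ecoef v) e 0 by rewrite /v' subrK.
rewrite (hermDr hk) (sesq_fmulr sk) [X in _ + X]big1 => [|i _]; last first.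
  by rewrite hu mul0r.
rewrite addr0; apply: sqm_eq0; apply/eqP; rewrite eq_le sqm_ge0 andbT.
have := @herm_CS _ _ _ hk eperp eperp_subspace eperp_ge0 u v' pu pv.
by rewrite qu mul0r.
Qed.

(** In a larger space some nonzero vector is orthogonal to [e]; being nonpositive, it
    is isotropic and [eperp_eq0] applies. *)
Lemma nonpositive_family_le n (v : 'I_n -> X) : (forall i, H (v i)) ->
  lin_indep v -> (forall c : 'rV_n, q (fmul c v 0) <= 0) -> (n <= kappa)%N.
Proof.
move=> Hv iv nonpos; rewrite leqNgt; apply/negP => kn.
have [c [i ci] hc] := nontrivial_solution (fun i j => kf (v i) (e j)) kn.
pose d : 'rV_n := \row_i c i.
have pd : eperp (fmul d v 0).
  split=> [|j]; first exact: fmul_in.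
  rewrite (sesq_fmull sk) -[RHS](hc j); apply: eq_bigr => k _; by rewrite mxE.
have q0 : q (fmul d v 0) = 0.
  by apply/eqP; rewrite eq_le nonpos eperp_ge0.
have := fmul_eq0 iv (eperp_eq0 pd q0) => /rowP/(_ i); rewrite !mxE => ci0.
by rewrite ci0 eqxx in ci.
Qed.

Lemma bounded_sum J (r : seq J) (f : J -> X -> X) :
  (forall j, bounded_op ip (f j)) ->
  bounded_op ip (fun u => \sum_(j <- r) f j u).
Proof.
move=> h; elim: r => [|j r [c c0 hc]].
  by exists 0 => // u; rewrite big_nil (qf0 hI) mul0r.
have [d d0 hd] := h j; exists (2 * d + 2 * c) => [|u]; first by lra.
rewrite big_cons; apply: le_trans (n2D_le hip _ _) _.
by have := hd u; have := hc u; move: (n2 _) (n2 _) (n2 _) => x y z; lra.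
Qed.

Lemma rank_one_bounded v w (a : C) :
  bounded_op ip (fun u => (kf u v * a) *: w).
Proof.
have [c c0 hc] := bdK; exists (c * (n2 v * sqm a * n2 w)) => [|u].
  by rewrite !mulr_ge0 ?sqm_ge0 ?n2_ge0.
rewrite (qfZ hI) sqmM -[leLHS]mulrA.
have -> : c * (n2 v * sqm a * n2 w) * n2 u = c * n2 u * n2 v * (sqm a * n2 w).
  by ring.
rewrite ler_wpM2r ?mulr_ge0 ?sqm_ge0 ?n2_ge0 //.
by apply: le_trans (CS hip _ _) _; rewrite ler_wpM2r ?n2_ge0.
Qed.

Lemma projection_bounded : bounded_op ip (fun u => u - fmul (ecoef u) e 0).
Proof.
have h1 : bounded_op ip (fun u => fmul (ecoef u) e 0).
  apply: bounded_sum => i.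
  have [c c0 hc] := bounded_sum (index_enum 'I_kappa)
    (fun j => rank_one_bounded (e j) (e i) (invmx Gm j i)).
  exists c => // u; rewrite /ecoef mxE scaler_suml.
  by under eq_bigr do rewrite mxE; exact: hc.
have [c c0 hc] := h1; exists (2 + 2 * c) => [|u]; first by lra.
apply: le_trans (n2D_le hip _ _) _; rewrite (qfN hI).
by have := hc u; move: (n2 _) (n2 _) => x y; lra.
Qed.

(** The form of such a [w] on its component in [eperp] is at most [|q e'|], where
    [e'] is the component in the span of [e], so that the Cauchy-Schwarz inequality in
    [eperp] bounds the functional. The vectors themselves need not be bounded in norm;
    this bound is the compactness behind the limit in [pontryagin]. *)
Lemma nonpositive_bounded (a : 'rV[C]_kappa) : exists2 M : R, 0 <= M &
  forall w v, eperp (w - fmul a e 0) -> q w <= 0 -> H v ->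
    sqm (kf w v) <= M * n2 v.
Proof.
set e' := fmul a e 0.
have [cK cK0 hK] := bdK; have [cP cP0 hP] := projection_bounded.
have Ke0 := n2_ge0 hip (K e').
exists (2 * n2 (K e') + 2 * (`|q e'| * ((cK + 1) * cP))).
  by rewrite addr_ge0 // !mulr_ge0 // addr_ge0.
move=> w v pw qw Hv; set x := w - e' in pw.
have wE : w = x + e' by rewrite /x subrK.
have qx : q x <= `|q e'|.
  have : q w = q x + q e'.
    rewrite wE (qfD hk); have -> : kf x e' = 0.
      by rewrite (sesq_fmulr sk) big1 // => i _; rewrite pw.2 mul0r.
    by rewrite /= mulr0 addr0.
  by have := ler_norm (- q e'); rewrite normrN; lra.
pose v' := v - fmul (ecoef v) e 0.
have pv : eperp v' by exact: ecoefP.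
have xv : kf x v = kf x v'.
  rewrite /v' (hermBr hk) (sesq_fmulr sk) [X in _ - X]big1 ?subr0 // => i _.
  by rewrite pw.2 mul0r.
have qv : q v' <= (cK + 1) * n2 v'.
  have := CS_Re hip (K v') v'; rewrite -[Re _]/(q v').
  exact: (form_bound_arith cK0 (n2_ge0 hip v') (hK v')).
have h1 : sqm (kf x v) <= `|q e'| * ((cK + 1) * cP) * n2 v.
  rewrite xv; apply: le_trans
    (@herm_CS _ _ _ hk eperp eperp_subspace eperp_ge0 x v' pw pv) _.
  rewrite -mulrA; apply: ler_pM => //; [exact: eperp_ge0|exact: eperp_ge0|].
  apply: le_trans qv _; rewrite -mulrA ler_wpM2l //; [lra|exact: hP].
have h2 : sqm (kf e' v) <= n2 (K e') * n2 v by exact: (CS hip).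
rewrite wE (hermDl hk); apply: le_trans (sqmD_le _ _) _.
move: (`|q e'| * _) h1 => D h1.
have -> : (2 * n2 (K e') + 2 * D) * n2 v = 2 * (D * n2 v) + 2 * (n2 (K e') * n2 v).
  by ring.
by apply: lerD; rewrite ler_pM2l.
Qed.

Variable G : {linear X -> X}.
Hypothesis cH : nclosed ip H.
Hypothesis symG : symmetric_op ip G.
Hypothesis HG : forall u, H (G u).
Hypothesis injG : forall u, H u -> G u = 0 -> u = 0.

(** The form [[G K u, v]] made strictly dissipative: on the diagonal the first
    term is real, the second one is [t * n2 (K u)] times the imaginary unit. *)
Definition perturbed_form (t : R) u v : C :=
  ip (G (K u)) (K v) + Complex 0 t * kf u (K v).

Lemma perturbed_sesq t : sesquilinear_form (perturbed_form t).
Proof.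
split=> a u v w; rewrite /perturbed_form !linearP.
  by rewrite !(hermDl hI) !(hermZl hI) (hermDl hk) (hermZl hk); ring.
by rewrite !(hermDr hI) !(hermZr hI) (hermDr hk) (hermZr hk); ring.
Qed.

Lemma perturbed_Im t u : Im (perturbed_form t u u) = t * n2 (K u).
Proof.
have hG : ip (G (K u)) (K u) = (ip (G (K u)) (K u))^*%C.
  by rewrite {1}symG (herm_conj hI).
have := congr1 Im hG; rewrite cIm_conj => h.
rewrite /perturbed_form cImD cImM /= mul0r add0r /kf -[Re _]/(n2 (K u)).
by lra.
Qed.

Lemma perturbedE t u v :
  perturbed_form t u v = kf u (G (K v)) + Complex 0 t * kf u (K v).
Proof. by rewrite /perturbed_form symG. Qed.

(** The characteristic polynomials of the finite stages stay away from zero in the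
    upper half plane, by an amount that survives in the limit. *)
Lemma sqm_prod_ge (x : R) (z : C) (s : seq C) : 0 < x -> x <= Im z ->
  all (fun y => Im y < 0) s ->
  (x ^+ 2) ^+ size s <= sqm (\prod_(y <- s) (z - y)).
Proof.
move=> x0 xz; elim: s => [|y s IH] /= => [_|/andP[y0 hs]].
  by rewrite big_nil /sqm /= expr1n expr0n addr0 expr0.
rewrite big_cons sqmM exprS; apply: ler_pM; last exact: IH.
- exact: sqr_ge0.
- by rewrite exprn_ge0 // sqr_ge0.
apply: (@le_trans _ _ (Im (z - y) ^+ 2)); last by rewrite lerDr sqr_ge0.
by rewrite ler_sqr ?nnegrE ?cImD ?cImN; lra.
Qed.

(** [dissipative_negative_subspace] is applied to the compression to the finite
    dimensional space spanned by [e] and [s]. The subspace found has dimension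
    [kappa]: not more by definition of the index, and not less, since otherwise its
    complement, where the form is nonnegative, would meet the span of [e]. It is a graph over the span of [e], and the basis [w] is chosen
    with the same products with [e] as [e] itself. *)
Lemma finite_stage (s : seq X) (t : R) : (forall x, x \in s -> H x) -> 0 < t ->
  exists (w : 'I_kappa -> X) (M : 'M[C]_kappa),
  [/\ forall j, H (w j), gram kf w e = Gm, forall c : 'rV_kappa, q (fmul c w 0) <= 0,
      forall v, (v \in s) \/ (exists i, v = e i) ->
        forall j, perturbed_form t (w j) v = \sum_k M j k * kf (w k) v
    & forall z : C, 0 < Im z -> (Im z ^+ 2) ^+ kappa <= sqm (\det (z%:M - M))].
Proof.
move=> Hs t0.
have [|n [b [Hb ib hb]]] := @basis_of_list _ _ H ([seq e i | i <- enum 'I_kappa] ++ s).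
  by move=> x; rewrite mem_cat => /orP[/mapP[i _ ->]|] //; exact: Hs.
have espan i : exists c : 'rV[C]_n, e i = fmul c b 0.
  by apply: hb; rewrite mem_cat map_f // mem_enum.
have [cf hcf] := choice espan.
pose E := \matrix_(i, j) cf i 0 j.
have eE i : e i = fmul E b i.
  by rewrite hcf /fmul; apply: eq_bigr => j _; rewrite mxE.
have sp := perturbed_sesq t.
have HH : adjmx (gram kf b b) = gram kf b b.
  by apply/matrixP => i j; rewrite !mxE -(herm_conj hk).
have uG : gram kf b b \in unitmx.
  rewrite -row_free_unit -kermx_eq0; apply/rowV0P => c /sub_kermxP cG.
  pose u := fmul c b 0.
  have uspan (d : 'rV_n) : kf u (fmul d b 0) = 0.
    have := gramMr sk d (fmul c b) b; rewrite (gramMl sk c b b) cG mul0mx.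
    by move=> /matrixP/(_ 0 0); rewrite !mxE.
  have pu : eperp u.
    by split=> [|i]; [exact: fmul_in | rewrite hcf uspan].
  by apply: (fmul_eq0 ib); apply: (eperp_eq0 pu); rewrite /qf uspan.
have posA c : c != 0 -> 0 < Im (mxform (gram (perturbed_form t) b b) c).
  move=> c0; rewrite (mxform_gram sp) perturbed_Im mulr_gt0 //.
  apply: (n2_gt0 hip); apply: contra_neq c0 => Ku0.
  apply: (fmul_eq0 ib); apply: injK => //; exact: fmul_in.
have [k [W [M [WA Wneg Wpos [r [rk rneg rdet]]]]]] :=
  dissipative_negative_subspace HH uG posA.
pose w0 := fmul W b.
have Hw0 i : H (w0 i) by exact: fmul_in.
have nw0 : negative_family ip H K w0.
  split=> // c c0; rewrite /w0 fmulM -[ip _ _]/(kf _ _) -(mxform_gram sk).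
  exact: Wneg.
have kk : k = kappa.
  apply/eqP; rewrite eqn_leq (maxe nw0) /= leqNgt; apply/negP => lk.
  have [c [i ci] hc] := nontrivial_solution (fun i j => kf (e i) (w0 j)) lk.
  pose d : 'rV_kappa := \row_i c i.
  have d0 : d != 0.
    by apply: contra_neq ci => /rowP/(_ i); rewrite !mxE.
  have uE : fmul d e 0 = fmul (d *m E) b 0.
    by rewrite -fmulM /fmul; apply: eq_bigr => j _; rewrite eE.
  have := Wpos (d *m E); rewrite (mxform_gram sk) -uE leNgt ne.2 // => /(_ _)/negP.
  case; last by [].
  rewrite -(gramMl sk) -(gramMr sk) -/w0; apply/matrixP => x j; rewrite !mxE ord1 -uE.
  rewrite (sesq_fmull sk) -[RHS](hc j); apply: eq_bigr => y _; by rewrite mxE.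
move: rk; subst k => rk.
pose T := gram kf w0 e.
have uT : T \in unitmx.
  rewrite -row_free_unit -kermx_eq0; apply/rowV0P => c /sub_kermxP cT.
  apply/eqP; apply: contraPT cT => c0 cT.
  have := nw0.2 _ c0; apply/negP; rewrite -leNgt.
  apply: (@eperp_ge0 (fmul c w0 0)); split=> [|i]; first exact: fmul_in.
  by have := gramMl sk c w0 e; rewrite cT => /matrixP/(_ 0 i); rewrite !mxE.
pose Q := Gm *m invmx T.
have uGm : Gm \in unitmx by exact: gram_unit.
have uQ : Q \in unitmx by rewrite unitmx_mul uGm unitmx_inv.
have QT : Q *m gram kf w0 e = Gm by rewrite /Q mulmxKV.
clearbody Q.
exists (fmul Q w0), (Q *m M *m invmx Q); split.
- by move=> j; exact: fmul_in.
- by rewrite (gramMl sk).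
- move=> c; rewrite fmulM; have [->|c0] := eqVneq (c *m Q) 0.
    by rewrite fmul0 (qf0 hk).
  by apply: ltW; exact: nw0.2.
- move=> v hv j; have [d vE] : exists d : 'rV_n, v = fmul d b 0.
    case: hv => [vs|[i ->]]; last by exists (cf i).
    by apply: hb; rewrite mem_cat vs orbT.
  have : gram (perturbed_form t) (fmul Q w0) (fmul d b) =
      Q *m M *m invmx Q *m gram kf (fmul Q w0) (fmul d b).
    rewrite !(gramMl sp) !(gramMl sk) !(gramMr sp) !(gramMr sk) !mulmxA mulmxKV //.
    have := congr1 (fun B => Q *m B *m adjmx d) WA.
    by rewrite !mulmxA.
  move=> /matrixP/(_ j 0); rewrite [LHS]mxE -vE => ->; rewrite mxE.
  by apply: eq_bigr => i _; rewrite [gram _ _ _ _ _]mxE -vE.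
- move=> z z0.
  have -> : z%:M - Q *m M *m invmx Q = Q *m (z%:M - M) *m invmx Q.
    rewrite mulmxBr mulmxBl; congr (_ - _).
    by rewrite mul_mx_scalar -scalemxAl mulmxV // scalemx1.
  rewrite !det_mulmx mulrAC -det_mulmx mulmxV // det1 mul1r rdet -rk.
  exact: sqm_prod_ge.
Qed.

(** Pontryagin's theorem for [G K], which is symmetric for the indefinite form. The
    invariant subspace is a limit, along an ultrafilter, of those of
    [finite_stage]. As the approximating vectors are bounded only in the weaker
    topology of the form, the limit is taken of their images under [K], which
    gives vectors [y] with [K G y = M y]; then [x = M^-1 G y] satisfies [K x = y]
    and [G K x = M x]. The span stays nonpositive because the form is the sum of a
    nonnegative form, lower semicontinuous in this topology, and of a fixed value on
    the span of [e]. The condition on the determinant says that the eigenvalues are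
    in the closed lower half plane. *)
Theorem pontryagin : exists (x : 'I_kappa -> X) (M : 'M[C]_kappa),
  [/\ (forall j, H (x j)) /\ lin_indep x, forall c : 'rV_kappa, q (fmul c x 0) <= 0,
      forall j, G (K (x j)) = fmul M x j, M \in unitmx
    & forall z : C, 0 < Im z -> \det (z%:M - M) != 0].
Proof.
have [U [UU Umem Ularge]] := list_ultrafilter X.
have PU : ProperFilter U by exact: ultra_proper.
have stage (i : seq X * nat) := @finite_stage [seq x <- i.1 | `[< H x >]]
  (1 / i.2.+1%:R).
have {}stage i : exists wM : ('I_kappa -> X) * 'M[C]_kappa,
  [/\ forall j, H (wM.1 j), gram kf wM.1 e = Gm,
      forall c : 'rV_kappa, q (fmul c wM.1 0) <= 0,
      forall v, (v \in [seq x <- i.1 | `[< H x >]]) \/ (exists i, v = e i) ->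
        forall j, perturbed_form (1 / i.2.+1%:R) (wM.1 j) v =
          \sum_k wM.2 j k * kf (wM.1 k) v
    & forall z : C, 0 < Im z ->
        (Im z ^+ 2) ^+ kappa <= sqm (\det (z%:M - wM.2))].
  have [||w [M h]] := stage i; last by exists (w, M).
  - by move=> x; rewrite mem_filter => /andP[/asboolP].
  - by rewrite divr_gt0.
have [wM hwM] := choice stage; clear stage.
pose w i := (wM i).1; pose Mi i := (wM i).2; pose ti (i : seq X * nat) : R := 1 / i.2.+1%:R.
have Hw i j : H (w i j) by have [h _ _ _ _] := hwM i; exact: h.
have we i j k : kf (w i j) (e k) = Gm j k.
  by have [_ h _ _ _] := hwM i; have /matrixP/(_ j k) := h; rewrite mxE.
have qw i (c : 'rV_kappa) : q (fmul c (w i) 0) <= 0.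
  by have [_ _ h _ _] := hwM i; exact: h.
have eqw i v : (v \in [seq x <- i.1 | `[< H x >]]) \/ (exists k, v = e k) ->
    forall j, perturbed_form (ti i) (w i j) v = \sum_k Mi i j k * kf (w i k) v.
  by have [_ _ _ h _] := hwM i; exact: h.
have detw i (z : C) : 0 < Im z -> (Im z ^+ 2) ^+ kappa <= sqm (\det (z%:M - Mi i)).
  by have [_ _ _ _ h] := hwM i; exact: h.
clearbody w Mi; clear hwM wM.
have wperp i (c : 'rV_kappa) : eperp (fmul c (w i) 0 - fmul c e 0).
  split=> [|k]; first by apply: subspaceB => //; exact: fmul_in.
  rewrite (hermBl hk) !(sesq_fmull sk).
  by under eq_bigr do rewrite we; under [X in _ - X]eq_bigr do [];
     rewrite -sumrB big1 // => j _; rewrite mxE subrr.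
have bnd j : exists2 B : R, 0 <= B & forall i v, H v -> sqm (kf (w i j) v) <= B * n2 v.
  have [B B0 hB] := nonpositive_bounded (delta_mx 0 j).
  exists B => // i v Hv; apply: hB => //.
    by have := wperp i (delta_mx 0 j); rewrite [fmul _ (w i) 0]fmul_delta.
  by have := qw i (delta_mx 0 j); rewrite fmul_delta.
have lim j : exists2 y, H y & forall v, H v -> ucvg U (fun i => kf (w i j) v) (ip y v).
  have [B B0 hB] := bnd j.
  have ex v : H v -> exists a, ucvg U (fun i => kf (w i j) v) a.
    by move=> Hv; apply: (ucvg_bounded UU (M := B * n2 v)) => i; exact: hB.
  pose phi v := (xget 0 [set a | ucvg U (fun i => kf (w i j) v) a])^*%C.
  have phiP v : H v -> ucvg U (fun i => kf (w i j) v) (phi v)^*%C.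
    move=> Hv; have [a ha] := ex v Hv; rewrite /phi conjcK.
    by apply: (xgetI 0 (x := a)).
  have [|||||||y Hy hy] := @riesz _ _ _ hip H ip 1 1 phi B sH cH hI.
  - by [].
  - by [].
  - by [].
  - by move=> u _; rewrite mul1r.
  - by move=> u _; rewrite mul1r.
  - move=> a u v Hu Hv; rewrite -[LHS]conjcK -[RHS]conjcK; congr (_^*%C).
    apply: (ucvg_unique UU (phiP _ (sH.2 a _ _ Hu Hv))).
    rewrite rmorphD rmorphM; apply: ucvg_eq.
      by move=> i; rewrite (hermDr hk) (hermZr hk).
    by apply: ucvgD; [apply: ucvgM; [exact: ucvg_cst | exact: phiP] | exact: phiP].
  - move=> u Hu; rewrite -sqm_conj -subr_ge0.
    have h := ucvg_sqm UU (phiP u Hu).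
    have h2 : ucvg U (fun i => (B * n2 u)%:C - (sqm (kf (w i j) u))%:C)
        ((B * n2 u)%:C - (sqm (phi u)^*%C)%:C).
      have := ucvgD UU (ucvg_cst UU (B * n2 u)%:C) (ucvgM UU (ucvg_cst UU (-1)) h).
      rewrite mulN1r; apply: ucvg_eq => i; by rewrite mulN1r.
    have := ucvg_Re_ge UU (x := 0) _ h2; rewrite cReB !cReR; apply => i.
    by rewrite cReB !cReR subr_ge0; exact: hB.
  - exists y => // v Hv; have := phiP v Hv; rewrite -hy //.
    by rewrite -(herm_conj hI).
have [y hy] := choice (fun j => let: ex_intro2 a b c := lim j in ex_intro _ a (conj b c)).
have Hy j : H (y j) by case: (hy j).
have ylim j v : H v -> ucvg U (fun i => kf (w i j) v) (ip (y j) v) by case: (hy j) => _; apply.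
have tlim : ucvg U (fun i => Complex 0 (ti i)) 0.
  split; first exact: cvg_cst.
  apply/cvgrPdist_lt => d d0; have := truncnS_gt d^-1; set N := (_.+1) => hN.
  apply: filterS (Ularge N) => i /= Ni; rewrite /ti sub0r normrN ger0_norm ?divr_ge0 //.
  rewrite div1r invf_plt ?posrE ?ltr0Sn //; apply: lt_le_trans hN _.
  by rewrite ler_nat ltnW.
have plim j v : H v -> ucvg U (fun i => perturbed_form (ti i) (w i j) v) (ip (y j) (G (K v))).
  move=> Hv; rewrite -[ip _ _]addr0.
  have -> : 0 = 0 * ip (y j) (K v) by rewrite mul0r.
  apply: ucvg_eq; first by move=> i; rewrite perturbedE.
  by apply: ucvgD; [exact: ylim | apply: ucvgM => //; exact: ylim].
have uGm : Gm \in unitmx by exact: gram_unit.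
pose M : 'M[C]_kappa := gram (fun u v => ip u (G (K v))) y e *m invmx Gm.
have Mlim j k : ucvg U (fun i => Mi i j k) (M j k).
  have ME i : Mi i = gram (perturbed_form (ti i)) (w i) e *m invmx Gm.
    have -> : gram (perturbed_form (ti i)) (w i) e = Mi i *m Gm.
      apply/matrixP => a b; rewrite !mxE eqw; last by right; exists b.
      by apply: eq_bigr => c _; rewrite we.
    by rewrite mulmxK.
  rewrite mxE; apply: ucvg_eq; first by move=> i; rewrite ME mxE.
  apply: ucvg_sum => l _; apply: ucvgM; last exact: ucvg_cst.
  rewrite mxE; apply: ucvg_eq; first by move=> i; rewrite mxE.
  exact: plim.
have KGy j : K (G (y j)) = fmul M y j.
  apply/eqP; rewrite -subr_eq0; apply/eqP; apply: (ip_self_eq0 hip (V := H)).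
    by apply: subspaceB => //; exact: fmul_in.
  move=> v Hv; rewrite (hermBl hI) symK symG; apply/eqP; rewrite subr_eq0; apply/eqP.
  apply: (ucvg_unique UU (plim j v Hv)).
  rewrite (sesq_fmull (hermitian_sesquilinear hI)).
  have h : ucvg U (fun i => \sum_k Mi i j k * kf (w i k) v) (\sum_k M j k * ip (y k) v).
    by apply: ucvg_sum => k _; apply: ucvgM => //; exact: ylim.
  apply: ucvg_near h; apply: filterS (Umem v) => i vi /=; rewrite eqw //.
  by left; rewrite mem_filter vi andbT; apply/asboolP.
have ye j k : ip (y j) (e k) = Gm j k.
  apply: (ucvg_unique UU (ylim j _ (He k))).
  by apply: ucvg_eq (ucvg_cst UU (Gm j k)) => i; rewrite we.
have iy : lin_indep y.
  move=> c; rewrite fmul_row => h j.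
  have : \row_i c i *m Gm = 0.
    apply/rowP => k; rewrite !mxE.
    have h0 := congr1 (fun u => ip u (e k)) h; rewrite (herm0l hI) in h0.
    rewrite -[RHS]h0 (sesq_fmull (hermitian_sesquilinear hI)).
    by apply: eq_bigr => l _; rewrite ye.
  move=> /(congr1 (mulmx^~ (invmx Gm))); rewrite mulmxK // mul0mx.
  by move=> /rowP/(_ j); rewrite !mxE.
have uM : M \in unitmx.
  rewrite -row_free_unit -kermx_eq0; apply/rowV0P => c /sub_kermxP cM.
  apply: (fmul_eq0 iy); apply: injG; first exact: fmul_in.
  apply: injK => //; rewrite !linear_fmul.
  have -> : fmul c (fun i => K (G (y i))) 0 = fmul (c *m M) y 0.
    by rewrite -fmulM /fmul; apply: eq_bigr => i _; rewrite KGy.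
  by rewrite cM fmul0.
pose x := fmul (invmx M) (fun j => G (y j)).
have Hx j : H (x j) by exact: fmul_in.
have Kx j : K (x j) = y j.
  rewrite /x linear_fmul.
  have -> : fmul (invmx M) (fun i => K (G (y i))) j = fmul (invmx M *m M) y j.
    by rewrite -fmulM /fmul; apply: eq_bigr => i _; rewrite KGy.
  by rewrite mulVmx // fmul1.
exists x, M; split.
- split; first exact: Hx.
  move=> c hc i; apply: (iy c); rewrite -[RHS](linear0 K) -[in RHS]hc linear_sum.
  by apply: eq_bigr => k _; rewrite linearZ /= Kx.
- move=> c; set u := fmul c x 0; set E := fmul c e 0.
  have Ku : K u = fmul c y 0.
    by rewrite /u linear_fmul /fmul; apply: eq_bigr => i _; rewrite Kx.
  have ulim v : H v -> ucvg U (fun i => kf (fmul c (w i) 0) v) (kf u v).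
    move=> Hv; rewrite /kf Ku (sesq_fmull (hermitian_sesquilinear hI)).
    apply: ucvg_eq; first by move=> i; rewrite -/(kf _ v) (sesq_fmull sk).
    by apply: ucvg_sum => k _; apply: ucvgM; [exact: ucvg_cst|exact: ylim].
  have Eperp v : eperp v -> kf E v = 0.
    move=> [_ hv]; rewrite (herm_conj hk) (sesq_fmulr sk) big1 ?conjc0 // => i _.
    by rewrite hv mul0r.
  have qE v : eperp (v - E) -> q v = q (v - E) + q E.
    move=> pv; rewrite -{1}[v](subrK E) (qfD hk) (herm_conj hk E) Eperp //.
    by rewrite conjc0 /= mulr0 addr0.
  have pu : eperp (u - E).
    split=> [|k]; first by apply: subspaceB => //; exact: fmul_in.
    rewrite (hermBl hk) /kf Ku (sesq_fmull (hermitian_sesquilinear hI)).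
    rewrite -/(kf E _) (sesq_fmull sk) -sumrB big1 // => j _.
    by rewrite ye mxE subrr.
  set x' := u - E in pu.
  have ineq i : 0 <= Re (- 2%:R * kf (fmul c (w i) 0) x' + (q x' - q E)%:C).
    have pw := wperp i c; rewrite -/E in pw.
    have : 0 <= q ((fmul c (w i) 0 - E) - x').
      apply: eperp_ge0; rewrite addrC -scaleN1r; exact: eperp_subspace.
    rewrite (qfB hk) (hermBl hk) Eperp // subr0.
    have := qw i c; rewrite (qE _ pw) cReD cReR mulNr cReN.
    rewrite -(rmorph_nat (real_complex R)) Re_scaler.
    by move: (q _) (q x') (q E) (Re _) => a1 a2 a3 a4; lra.
  have Hx' : H x' by case: pu.
  have := ucvg_Re_ge UU ineq (ucvgD UU (ucvgM UU (ucvg_cst UU _) (ulim _ Hx')) (ucvg_cst UU _)).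
  rewrite cReD cReR mulNr cReN -(rmorph_nat (real_complex R)) Re_scaler.
  have -> : kf u x' = kf x' x'.
    by rewrite {2}/x' (hermBl hk) Eperp // subr0.
  rewrite -[Re (kf x' x')]/(q x') (qE _ pu) -/x'; lra.
- by move=> j; rewrite Kx /x fmulM mulmxV // fmul1.
- exact: uM.
- move=> z z0; apply/eqP => dz.
  have h : ucvg U (fun i => \det (z%:M - Mi i)) (\det (z%:M - M)).
    apply: ucvg_det => // a b.
    have gen (N : 'M[C]_kappa) : z%:M a b + -1 * N a b = (z%:M - N) a b.
      by rewrite !mxE mulN1r.
    rewrite -gen; apply: ucvg_eq; first by move=> i; exact: gen.
    apply: ucvgD; first exact: ucvg_cst.
    by apply: ucvgM; [exact: ucvg_cst | exact: Mlim].
  have := ucvg_Re_ge UU (x := (Im z ^+ 2) ^+ kappa) _ (ucvg_sqm UU h).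
  rewrite dz /sqm /= !expr0n addr0 => h2.
  have : 0 < (Im z ^+ 2) ^+ kappa by rewrite !exprn_gt0.
  by rewrite ltNge h2 // => i; rewrite ?cReR; exact: detw.
Qed.
End IndefiniteForm.

(** * Root spaces *)

Section Inverses.
Variable R : realType.
Implicit Type z : R[i].

Lemma invc_sqm z : z^-1 = (sqm z)^-1%:C * z^*%C.
Proof.
have [->|z0] := eqVneq z 0; first by rewrite invr0 conjc0 mulr0.
apply: (mulfI z0); rewrite mulfV // mulrCA conjc_sqm -rmorphM mulVf //.
by rewrite gt_eqF // sqm_gt0.
Qed.
Lemma cIm_inv z : Im z^-1 = - Im z / sqm z.
Proof. by rewrite invc_sqm cImM /= mul0r addr0 cIm_conj mulrC. Qed.
Lemma cRe_inv z : Re z^-1 = Re z / sqm z.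
Proof. by rewrite invc_sqm cReM /= mul0r subr0 cRe_conj mulrC. Qed.
End Inverses.

Section PolynomialCalculus.
Variables (R : realType) (X : completeNormedModType R[i]).
Local Notation C := R[i].
Variable S : {linear X -> X}.
Implicit Types (p q : {poly C}) (u v : X).

(** The vector [p(S) u], defined without a ring of linear maps: only the values at
    vectors matter below. *)
Definition pap p u : X := \sum_(i < size p) p`_i *: iter i S u.

Lemma papE n p u : (size p <= n)%N -> pap p u = \sum_(i < n) p`_i *: iter i S u.
Proof.
move=> pn; rewrite /pap (big_ord_widen n (fun i => p`_i *: iter i S u)) //.
rewrite big_mkcond; apply: eq_bigr => i _; case: ltnP => // h.
by rewrite nth_default // scale0r.
Qed.

Lemma pap_is_linear p a u v : pap p (a *: u + v) = a *: pap p u + pap p v.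
Proof.
have it i : iter i S (a *: u + v) = a *: iter i S u + iter i S v.
  by elim: i => //= i ->; rewrite linearP.
rewrite /pap scaler_sumr -big_split; apply: eq_bigr => i _.
by rewrite it scalerDr !scalerA mulrC.
Qed.

Lemma papDl p q u : pap (p + q) u = pap p u + pap q u.
Proof.
pose n := maxn (size p) (size q).
rewrite (papE (n := n) u (size_polyD _ _)) (papE (n := n) u (leq_maxl _ _)).
rewrite (papE (n := n) u (leq_maxr _ _)) -big_split; apply: eq_bigr => i _.
by rewrite coefD scalerDl.
Qed.

Lemma papZl c p u : pap (c *: p) u = c *: pap p u.
Proof.
rewrite (papE (n := size p) u (size_scale_leq _ _)) /pap scaler_sumr.
by apply: eq_bigr => i _; rewrite coefZ scalerA.
Qed.

Lemma papC c u : pap c%:P u = c *: u.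
Proof.
by rewrite (papE (n := 1) u (size_polyC_leq1 _)) big_ord1 coefC.
Qed.

Lemma papMX p u : pap (p * 'X) u = S (pap p u).
Proof.
have sz : (size (p * 'X)%R <= (size p).+1)%N.
  have [->|p0] := eqVneq p 0; first by rewrite mul0r size_poly0.
  by rewrite size_mulX.
rewrite (papE u sz) big_ord_recl coefMX /= scale0r add0r /pap linear_sum.
by apply: eq_bigr => i _; rewrite coefMX linearZ.
Qed.

Lemma pap1 u : pap 1 u = u. Proof. by rewrite papC scale1r. Qed.
Lemma pap0r p : pap p 0 = 0.
Proof.
have := pap_is_linear p 1 0 0; rewrite !scale1r addr0 => /eqP.
by rewrite -subr_eq subrr eq_sym => /eqP.
Qed.
Lemma papDr p u v : pap p (u + v) = pap p u + pap p v.
Proof. by have := pap_is_linear p 1 u v; rewrite !scale1r. Qed.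
Lemma papZr p a u : pap p (a *: u) = a *: pap p u.
Proof. by have := pap_is_linear p a u 0; rewrite !addr0 pap0r addr0. Qed.

Lemma papS p u : pap p (S u) = S (pap p u).
Proof.
rewrite /pap linear_sum; apply: eq_bigr => i _.
by rewrite linearZ -iterSr.
Qed.

Lemma papM p q u : pap (p * q) u = pap p (pap q u).
Proof.
elim/poly_ind: p => [|p c IH]; first by rewrite mul0r /pap size_poly0 !big_ord0.
rewrite mulrDl papDl mulrAC papMX IH [RHS]papDl papMX papC.
by rewrite mul_polyC papZl.
Qed.

Lemma papMC p q u : pap p (pap q u) = pap q (pap p u).
Proof. by rewrite -!papM mulrC. Qed.

Lemma pap_coprime p q u : coprimep p q -> pap p u = 0 -> pap q u = 0 -> u = 0.
Proof.
move=> /Bezout_eq1_coprimepP[[a b] /= h] pu qu.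
by rewrite -[u]pap1 -h papDl !papM pu qu !pap0r addr0.
Qed.

Lemma pap_in V p u : subspace V -> (forall v, V v -> V (S v)) -> V u -> V (pap p u).
Proof.
move=> sV VS Vu; apply: subspace_sum => // i _; apply: subspaceZ => //.
by elim: (i : nat) => //= k; exact: VS.
Qed.

Lemma pap_fmul m n (A : 'M[C]_(m, n.+1)) (M : 'M[C]_n.+1) (x : 'I_n.+1 -> X) p r :
  (forall j, S (x j) = fmul M x j) ->
  pap p (fmul A x r) = fmul (A *m horner_mx M p) x r.
Proof.
move=> Sx; elim/poly_ind: p A r => [|p c IH] A r.
  rewrite /pap size_poly0 big_ord0 rmorph0 mulmx0 /fmul big1 // => i _.
  by rewrite mxE scale0r.
rewrite papDl papMX papC IH.
have lin (B : 'M[C]_(m, n.+1)) : S (fmul B x r) = fmul (B *m M) x r.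
  rewrite -(fmulM B M) /fmul linear_sum; apply: eq_bigr => i _.
  by rewrite linearZ /= Sx.
rewrite lin.
rewrite rmorphD rmorphM /= horner_mx_X horner_mx_C mulmxDr mulmxA /fmul.
rewrite scaler_sumr -big_split; apply: eq_bigr => i _.
by rewrite mul_mx_scalar !mxE scalerDl scalerA.
Qed.

(** [1 - mu S], a power of which vanishes on the generalized eigenspace for the
    eigenvalue [mu] of the inverse of [S]. *)
Definition lin_factor (mu : C) : {poly C} := 1 - mu *: 'X.

Lemma pap_lin_factor mu u : pap (lin_factor mu) u = u - mu *: S u.
Proof.
rewrite /lin_factor papDl pap1 -scaleNr papZl scaleNr; congr (_ - _ *: _).
by rewrite -['X]mul1r papMX pap1.
Qed.

(** Coprimality is what separates the root spaces for different numbers. *)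
Lemma lin_factor_coprime mu nu : mu != nu -> coprimep (lin_factor mu) (lin_factor nu).
Proof.
move=> mn; apply/Bezout_eq1_coprimepP.
have d : nu - mu != 0 by rewrite subr_eq0 eq_sym.
exists (((nu - mu)^-1 * nu)%:P, - ((nu - mu)^-1 * mu)%:P).
rewrite /lin_factor /= mulNr !mul_polyC !scalerBr !scalerA opprB addrACA.
rewrite [_ * nu * mu]mulrAC addrA addrK -scalerBl.
by rewrite -mulrBr mulVf // scale1r.
Qed.

(** The parameter is that of the equation [u = mu S u]; for an injective [S] this is the
    generalized eigenspace of the inverse of [S]. *)
Definition root_space (mu : C) : set X :=
  [set u | exists n, pap (lin_factor mu ^+ n) u = 0].

Lemma root_space_subspace mu : subspace (root_space mu).
Proof.
split=> [|a u v [m hu] [n hv]]; first by exists 0%N; rewrite pap0r.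
exists (m + n)%N; rewrite exprD papDr papZr !papM [X in a *: X]papMC hu hv.
by rewrite !pap0r scaler0 addr0.
Qed.
End PolynomialCalculus.

Section Counting.
Variables (R : realType) (X : completeNormedModType R[i]).
Variable (ip : X -> X -> R[i]).
Hypothesis hip : inner_product ip.
Local Notation C := R[i].
Local Notation hI := (ip_herm hip).
Implicit Types (u v : X) (p : {poly C}).
Variables (H : set X) (K G : {linear X -> X}).
Hypothesis sH : subspace H.
Hypothesis cH : nclosed ip H.
Hypothesis symK : symmetric_op ip K.
Hypothesis symG : symmetric_op ip G.
Hypothesis bdK : bounded_op ip K.
Hypothesis HK : forall u, H (K u).
Hypothesis HG : forall u, H (G u).
Hypothesis injK : forall u, H u -> K u = 0 -> u = 0.
Hypothesis injG : forall u, H u -> G u = 0 -> u = 0.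

Let S : {linear X -> X} := (G \o K)%FUN.
Local Notation kf := (krein_form ip K).
Local Notation q := (qf kf).
Local Notation hk := (krein_herm hip symK).
Local Notation E := (root_space S).

Lemma conj_lin_factor mu : map_poly (@conjc R) (lin_factor mu) = lin_factor mu^*%C.
Proof. by rewrite /lin_factor rmorphB rmorph1 /= map_polyZ map_polyX. Qed.

Lemma kf_pap p u v : kf (pap S p u) v = kf u (pap S (map_poly (@conjc R) p) v).
Proof.
have it i : kf (iter i S u) v = kf u (iter i S v).
  elim: i u v => // i IH u' v'; rewrite iterSr IH /krein_form /S /=.
  by rewrite symK symG.
rewrite (papE (n := size p) S v (size_poly _ _)) /pap.
rewrite (big_morph (kf^~ v) (fun x y => hermDl hk x y v) (herm0l hk v)).
rewrite (big_morph (kf u) (fun x y => hermDr hk x y u) (herm0r hk u)).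
apply: eq_bigr => i _; rewrite (hermZl hk) (hermZr hk) it coef_map /= conjcK.
by [].
Qed.

(** Bezout's identity, moved across the form by [kf_pap]. *)
Lemma annihilators_orthogonal p r u v :
  coprimep (map_poly (@conjc R) p) r ->
  pap S p u = 0 -> pap S r v = 0 -> kf u v = 0.
Proof.
move=> /Bezout_eq1_coprimepP[[a b] /= h] pu rv.
rewrite -[v](pap1 S) -h papDl mulrC papM papM rv pap0r addr0 -kf_pap pu.
exact: (herm0l hk).
Qed.

Lemma root_space_in mu u : E mu u -> H u.
Proof.
move=> [n]; elim: n u => [|n IH] u.
  by rewrite expr0 pap1 => ->; exact: sH.1.
rewrite exprSr papM => /IH; rewrite pap_lin_factor => h.
rewrite -[u](subrK (mu *: S u)); apply: subspaceD => //.
by apply: subspaceZ => //; exact: HG.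
Qed.

(** The sign condition concerns real [mu] only: for the other numbers the root
    spaces are neutral, see [root_families_union]. *)
Definition root_family (mu : C) n : Prop := exists v : 'I_n -> X,
  [/\ forall i, E mu (v i), lin_indep v
    & Im mu = 0 -> forall c : 'rV_n, q (fmul c v 0) <= 0].

Variables (kappa : nat).
Hypothesis indexK : negative_index ip H K kappa.

(** The sum of the root spaces for the numbers in [s], in a form that is visibly a
    subspace and lends itself to Bezout's identity. *)
Let sum_space (s : seq C) u : Prop :=
  exists p, pap S p u = 0 /\ forall nu, nu \notin s -> coprimep p (lin_factor nu).

Let sum_spaceP s : subspace (sum_space s).
Proof.
split=> [|a u v [p [pu hp]] [r [rv hr]]].
  by exists 1; split=> [|nu _]; [rewrite pap0r | rewrite coprime1p].
exists (p * r); split=> [|nu hnu]; last by rewrite coprimepMl hp // hr.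
by rewrite papDr papZr !papM [X in a *: X]papMC pu rv !pap0r scaler0 addr0.
Qed.

Let root_sum_space mu s u : mu \in s -> E mu u -> sum_space s u.
Proof.
move=> ms [n hn]; exists (lin_factor mu ^+ n); split=> // nu ns.
apply: coprimep_expl; apply: lin_factor_coprime; apply: contraNneq ns => <-.
by [].
Qed.

(** The root spaces for distinct eigenvalues in the closed upper half plane are
    independent and mutually orthogonal, and those for nonreal eigenvalues are
    neutral; so the given families together span a nonpositive subspace. *)
Lemma root_families_union (s : seq C) (nn : C -> nat) : uniq s ->
  (forall mu, mu \in s -> 0 <= Im mu) ->
  (forall mu, mu \in s -> root_family mu (nn mu)) ->
  exists v : 'I_(\sum_(mu <- s) nn mu) -> X,
    [/\ forall i, exists2 mu, mu \in s & E mu (v i), lin_indep v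
      & forall c : 'rV_(\sum_(mu <- s) nn mu), q (fmul c v 0) <= 0].
Proof.
elim: s => [|mu s IH] /=.
  move=> _ _ _; rewrite big_nil; exists (fun=> 0); split=> [[]//||c].
    exact: lin_indep0.
  by rewrite /fmul big_ord0 (qf0 hk).
move=> /andP[mus us] ims hs.
have [||f [Ef indf nf]] := IH us.
- by move=> nu nus; apply: ims; rewrite in_cons nus orbT.
- by move=> nu nus; apply: hs; rewrite in_cons nus orbT.
have sf i : sum_space s (f i) by have [nu nus] := Ef i; exact: root_sum_space.
have [g [Eg indg ng]] := hs mu (mem_head _ _).
have imu := ims mu (mem_head _ _).
have conj_notin : mu^*%C \notin s.
  apply/negP => h; have := ims _ (mem_behead (s := mu :: s) h).
  rewrite cIm_conj => imu'; have Imu : Im mu = 0 by lra.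
  by rewrite (conjc_Im0 Imu) (negPf mus) in h.
have orth u v : sum_space s u -> E mu v -> kf u v = 0.
  move=> [p [pu hp]] [n hn]; apply: (annihilators_orthogonal (p := p)) pu hn.
  apply: coprimep_expr; rewrite -[mu]conjcK -conj_lin_factor coprimep_map.
  exact: hp.
have qg (c : 'rV_(nn mu)) : q (fmul c g 0) <= 0.
  have [Imu|Imu] := eqVneq (Im mu) 0; first exact: ng.
  have [n hn] : E mu (fmul c g 0).
    by apply: fmul_in => //; exact: root_space_subspace.
  rewrite /qf (annihilators_orthogonal (p := lin_factor mu ^+ n) _ hn hn) //.
  rewrite rmorphXn /= conj_lin_factor; apply/coprimep_expl/coprimep_expr.
  apply: lin_factor_coprime; apply: contraNneq Imu => h.
  have := congr1 Im h; rewrite cIm_conj => h'; apply/eqP; lra.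
rewrite big_cons addnC.
have split_c (c : 'rV_(\sum_(nu <- s) nn nu + nn mu)) :
    fmul c (fcat f g) 0 = fmul (lsubmx c) f 0 + fmul (rsubmx c) g 0.
  rewrite /fmul sum_fcat; congr (_ + _); apply: eq_bigr => i _; by rewrite mxE.
exists (fcat f g); split.
- pose V u := exists2 nu, nu \in mu :: s & E nu u.
  apply: (fcat_in (V := V)) => i; last by exists mu; [exact: mem_head | exact: Eg].
  by have [nu nus Enu] := Ef i; exists nu; rewrite // in_cons nus orbT.
- move=> c; rewrite fmul_row split_c => h.
  set x := fmul _ f 0 in h; set y := fmul _ g 0 in h.
  have sx : sum_space s x by apply: fmul_in.
  have Ey : E mu y by apply: fmul_in => //; exact: root_space_subspace.
  have y0 : y = 0.
    have [p [px hp]] := sx; have [n hn] := Ey.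
    apply: (pap_coprime (S := S) (p := p) (q := lin_factor mu ^+ n)) => //.
      by apply: coprimep_expr; exact: hp.
    have -> : y = - x by apply/eqP; rewrite -addr_eq0 addrC h.
    by rewrite -scaleN1r papZr px scaler0.
  have x0 : x = 0 by rewrite y0 addr0 in h.
  have h1 := fmul_eq0 indf x0; have h2 := fmul_eq0 indg y0.
  have : \row_i c i = 0 by rewrite -[LHS]hsubmxK h1 h2 row_mx0.
  by move=> /rowP h3 i; have := h3 i; rewrite !mxE.
- move=> c; rewrite split_c (qfD hk) orth /=.
  + rewrite mulr0 addr0; have := nf (lsubmx c); have := qg (rsubmx c); lra.
  + exact: fmul_in.
  + by apply: fmul_in => //; exact: root_space_subspace.
Qed.

Theorem root_families_le (s : seq C) (nn : C -> nat) : uniq s ->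
  (forall mu, mu \in s -> 0 <= Im mu) ->
  (forall mu, mu \in s -> root_family mu (nn mu)) ->
  (\sum_(mu <- s) nn mu <= kappa)%N.
Proof.
move=> us ims hs; have [[e ne] maxe] := indexK.
have [v [Ev iv nv]] := root_families_union us ims hs.
apply: (nonpositive_family_le hip sH symK HK injK ne maxe _ iv nv) => i.
by have [mu _] := Ev i; exact: root_space_in.
Qed.

(** The invariant subspace of [pontryagin] is the direct sum of the kernels of the
    primary factors of the characteristic polynomial of [M]. The eigenvalues [l]
    of [M] are those of [S], so they give [mu = l^-1]; the inversion exchanges the
    half planes. *)
Theorem root_families_exist : exists (s : seq C) (nn : C -> nat),
  [/\ uniq s, forall mu, mu \in s -> mu != 0 /\ 0 <= Im mu,
      forall mu, mu \in s -> root_family mu (nn mu)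
    & (\sum_(mu <- s) nn mu)%N = kappa].
Proof.
have [[e ne] maxe] := indexK.
have [x [M [[Hx ix] nx Sx uM detM]]] :=
  pontryagin hip sH symK bdK HK injK ne maxe cH symG HG injG.
case: kappa x M Hx ix nx Sx uM detM => [|k] x M Hx ix nx Sx uM detM.
  by exists [::], (fun=> 0%N); split=> //; rewrite big_nil.
have [r hr] := closed_field_poly_normal (char_poly M).
rewrite (monicP (char_poly_monic M)) scale1r in hr.
pose rs := undup r.
have detr l : l \in rs -> \det (l%:M - M) = 0.
  rewrite mem_undup => lr; apply: eigenvalue_det0.
  by rewrite eigenvalue_root_char hr root_prod_XsubC.
have rs0 l : l \in rs -> l != 0.
  move=> lr; apply: contraTneq uM => l0; have := detr l lr.
  rewrite l0 raddf0 sub0r -scaleN1r detZ => /eqP.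
  rewrite mulf_eq0 signr_eq0 /= => d0.
  by rewrite unitmxE unitfE negbK.
have rsIm l : l \in rs -> Im l <= 0.
  by move=> lr; rewrite leNgt; apply/negP => /detM; rewrite detr // eqxx.
pose pl l := ('X - l%:P) ^+ count_mem l r.
pose rk l := \rank (kermxpoly M (pl l)).
have sum_rk : (\sum_(l <- rs) rk l)%N = k.+1.
  rewrite (big_nth 0) big_mkord.
  have cop : {in predT &, forall i j : 'I_(size rs), j != i ->
      coprimep (pl rs`_i) (pl rs`_j)}.
    move=> i j _ _ ij; rewrite /pl coprimep_expr ?coprimep_expl //.
    by rewrite coprimep_XsubC root_XsubC nth_uniq ?undup_uniq.
  have /mxdirectP /= hd := mxdirect_sum_kermx M cop.
  have hp := kermxpoly_prod M cop.
  rewrite -hd -hp.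
  have -> : \prod_(i < size rs) pl rs`_i = char_poly M.
    rewrite hr -(prodr_undup_exp_count r predT) -/rs.
    by rewrite (big_nth 0) big_mkord.
  rewrite (kermxpoly_min (mxminpoly_dvd_char M)).
  exact: mxrank1.
exists [seq l^-1 | l <- rs], (fun mu => rk mu^-1); split.
- by rewrite map_inj_uniq ?undup_uniq //; exact: invr_inj.
- move=> _ /mapP[l lr ->]; rewrite invr_eq0 rs0 //; split=> //.
  rewrite cIm_inv divr_ge0 ?sqm_ge0 // oppr_ge0; exact: rsIm.
- move=> _ /mapP[l lr ->]; rewrite invrK.
  set B := row_base (kermxpoly M (pl l)).
  exists (fmul B x); split.
  + move=> i; exists (count_mem l r).
    have Sx' j : S (x j) = fmul M x j by exact: Sx.
    rewrite (pap_fmul _ _ _ Sx').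
    have -> : lin_factor l^-1 ^+ count_mem l r = (- l^-1) ^+ count_mem l r *: pl l.
      rewrite /pl -exprZn; congr (_ ^+ _); rewrite /lin_factor scalerBr scaleNr.
      have -> : - l^-1 *: l%:P = -1 :> {poly C}.
        by rewrite scaleNr -mul_polyC -polyCM mulVf ?rs0.
      by rewrite opprK addrC.
    rewrite linearZ /= -scalemxAr.
    have -> : B *m horner_mx M (pl l) = 0.
      by apply/sub_kermxP; rewrite eq_row_base.
    by rewrite scaler0 fmul0.
  + by apply: lin_indep_fmul => //; exact: row_base_free.
  + by move=> _ c; rewrite fmulM.
- rewrite big_map -[RHS]sum_rk; apply: eq_bigr => l _; by rewrite invrK.
Qed.
End Counting.

(** * Interchange of the two operators *)

Section Swap.
Variables (R : realType) (X : completeNormedModType R[i]).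
Variable (ip : X -> X -> R[i]).
Hypothesis hip : inner_product ip.
Local Notation C := R[i].
Local Notation hI := (ip_herm hip).
Implicit Types (u v h : X).

(** Newton's iteration for formal power series, one coefficient at a time. *)
Lemma poly_sqrt (p : {poly R}) n : p`_0 = 1 ->
  exists r : {poly R}, r`_0 = 1 /\ exists d, r ^+ 2 - p = 'X^(n.+1) * d.
Proof.
move=> p0; have divX (d : {poly R}) : d`_0 = 0 -> exists d', d = 'X * d'.
  move=> d0; have : 'X %| d by rewrite -['X]subr0 dvdp_XsubCl /root horner_coef0 d0.
  by move=> /dvdpP[d' ->]; exists d'; rewrite mulrC.
elim: n => [|n [r [r0 [d rd]]]].
  exists 1; split; first by rewrite coef1.
  by apply: divX; rewrite expr1n coefB coef1 p0 subrr.
exists (r - (d`_0 / 2) *: 'X^(n.+1)); split.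
  by rewrite coefB coefZ coefXn /= mulr0 subr0.
have [d' hd'] : exists d', d - d`_0 *: r + (d`_0 ^+ 2 / 4) *: 'X^(n.+1) = 'X * d'.
  apply: divX; rewrite coefD coefB !coefZ coefXn r0 /=; ring.
exists d'; rewrite ['X^(n.+2)]exprSr -mulrA -hd'.
have -> : (r - (d`_0 / 2) *: 'X^(n.+1)) ^+ 2 - p =
    (r ^+ 2 - p) - d`_0 *: ('X^(n.+1) * r) + (d`_0 ^+ 2 / 4) *: ('X^(n.+1) * 'X^(n.+1)).
  have -> : d`_0 = 2 * (d`_0 / 2) by field.
  rewrite -!mul_polyC; set a := d`_0 / 2.
  have -> : ((2 * a) ^+ 2 / 4)%:P = a%:P ^+ 2 :> {poly R}.
    by rewrite -rmorphXn /=; congr (_%:P); field.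
  have -> : (2 * a / 2)%:P = a%:P :> {poly R} by congr (_%:P); field.
  have -> : (2 * a)%:P = 2 * a%:P :> {poly R} by rewrite polyCM polyC_natr.
  ring.
by rewrite rd -!mul_polyC; ring.
Qed.

(** With [s = 1] and [s = - 1] the span is nonpositive and nonnegative, with [s = 0]
    only the dimension counts. *)
Definition signed_root_family (K G : {linear X -> X}) (s : R) (mu : C) n : Prop :=
  exists v : 'I_n -> X,
  [/\ forall i, root_space (G \o K)%FUN mu (v i), lin_indep v
    & forall c : 'rV[C]_n, s * qf (krein_form ip K) (fmul c v 0) <= 0].

Section Pair.
Variables (H : set X) (K G : {linear X -> X}).
Hypothesis sH : subspace H.
Hypothesis symK : symmetric_op ip K.
Hypothesis symG : symmetric_op ip G.
Hypothesis HK : forall u, H (K u).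
Hypothesis injG : forall u, H u -> G u = 0 -> u = 0.
Let S : {linear X -> X} := (G \o K)%FUN.
Let S' : {linear X -> X} := (K \o G)%FUN.

Let pap_G p h : G (pap S' p h) = pap S p (G h).
Proof.
rewrite /pap linear_sum; apply: eq_bigr => i _; rewrite linearZ; congr (_ *: _).
by elim: (i : nat) => //= k <-.
Qed.
Let pap_K p u : K (pap S p u) = pap S' p (K u).
Proof.
rewrite /pap linear_sum; apply: eq_bigr => i _; rewrite linearZ; congr (_ *: _).
by elim: (i : nat) => //= k <-.
Qed.

Lemma family_annihilated mu n (v : 'I_n -> X) :
  (forall i, root_space S' mu (v i)) ->
  exists N, forall c : 'rV[C]_n, pap S' (lin_factor mu ^+ N) (fmul c v 0) = 0.
Proof.
move=> /choice[f hf]; exists (\sum_i f i)%N => c.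
have [T hT] := @linear_pack _ X (pap S' (lin_factor mu ^+ \sum_i f i))
  (pap_is_linear S' _).
rewrite -hT linear_fmul /fmul big1 //.
move=> i _; rewrite hT (bigD1 i) //= exprD mulrC papM hf pap0r.
by rewrite scaler0.
Qed.

(** [G] intertwines [K G] with [G K]. *)
Lemma swap_dimension mu n :
  signed_root_family G K 0 mu n -> signed_root_family K G 0 mu n.
Proof.
move=> [v [Ev iv _]]; exists (fun i => G (v i)); split.
- by move=> i; have [N hN] := Ev i; exists N; rewrite -pap_G hN linear0.
- move=> c hc; apply: iv; apply: injG.
    have hv i : H (v i).
      by apply: (root_space_in (G := K) sH HK); exact: Ev.
    by apply: subspace_sum => // i _; exact: subspaceZ.
  by rewrite linear_sum -[RHS]hc; apply: eq_bigr => i _; rewrite linearZ.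
- by move=> c; rewrite mul0r.
Qed.

(** On the root space for [mu] the operator [1 - mu S] is nilpotent, so that [mu S]
    has an inverse square root [Q], a polynomial in [S] with [mu Q^2 S = 1]; for
    real [mu] it is symmetric for the form. The map [Q G] then sends root vectors
    [h] of [K G] to root vectors of [G K], and
    [mu (K Q G h, Q G h) = mu (K Q^2 G h, G h) = (h, G h)]. *)
Lemma swap_family (s : R) (mu : C) n : Im mu = 0 ->
  signed_root_family G K s mu n -> signed_root_family K G (s * Re mu) mu n.
Proof.
move=> Imu [v [Ev iv nv]]; have [N0 hN0] := family_annihilated Ev.
pose N := N0.+1.
have hN (c : 'rV_n) : pap S' (lin_factor mu ^+ N) (fmul c v 0) = 0.
  by rewrite exprS papM hN0 pap0r.
have [|r [_ [d rd]]] := @poly_sqrt (\sum_(i < N) 'X^i) N0.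
  rewrite coef_sum (bigD1 ord0) //= coefXn /= big1 ?addr0 // => i i0.
  by rewrite coefXn eq_sym; case: i i0 => [[|i] hi].
(* [r] is the square root of the truncated geometric series, the inverse of
   [1 - X]; [p] is its value at the nilpotent [1 - mu X] *)
pose Y : {poly C} := lin_factor mu.
pose p := map_poly (real_complex R) r \Po Y.
have pconj : map_poly (@conjc R) p = p.
  rewrite /p map_comp_poly /= conj_lin_factor.
  rewrite (conjc_Im0 Imu).
  by congr (_ \Po _); rewrite -map_poly_comp; apply: eq_map_poly => x /=; rewrite oppr0.
have [e he] : exists e, p ^+ 2 * (mu *: 'X) = 1 + Y ^+ N * e.
  have muX : mu *: 'X = 1 - Y by rewrite /Y /lin_factor opprB addrC subrK.
  have sumY : (1 - Y) * (\sum_(i < N) Y ^+ i) = 1 - Y ^+ N.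
    rewrite -opprB mulNr -subrX1 opprB; congr (_ - _).
  have p2 : p ^+ 2 = \sum_(i < N) Y ^+ i + Y ^+ N * (map_poly (real_complex R) d \Po Y).
    have /(congr1 (fun t => map_poly (real_complex R) t \Po Y)) : r ^+ 2 = \sum_(i < N) 'X^i + 'X^N * d.
      by rewrite -rd addrC subrK.
    rewrite rmorphXn /= rmorphXn /= -/p => ->.
    rewrite rmorphD /= rmorphD /= rmorphM /= rmorphM /= map_polyXn comp_Xn_poly.
    congr (_ + _); rewrite rmorph_sum /= rmorph_sum /=.
    by apply: eq_bigr => i _; rewrite map_polyXn comp_Xn_poly.
  exists (- 1 + (map_poly (real_complex R) d \Po Y) * (1 - Y)).
  by rewrite muX p2 mulrDl mulrC sumY; ring.
pose Rm h := pap S p (G h).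
have key (c : 'rV_n) : mu *: K (pap S p (Rm (fmul c v 0))) = fmul c v 0.
  set h := fmul c v 0; rewrite /Rm -papM pap_K.
  have -> : K (G h) = pap S' 'X h by rewrite -['X]mul1r papMX pap1.
  rewrite -papM -papZl.
  have -> : mu *: (p * p * 'X) = p ^+ 2 * (mu *: 'X) by rewrite scalerAr expr2.
  by rewrite he papDl pap1 mulrC papM hN pap0r addr0.
have Rfmul (c : 'rV_n) : fmul c (fun i => Rm (v i)) 0 = Rm (fmul c v 0).
  have [T hT] := @linear_pack _ X (pap S p) (pap_is_linear S _).
  rewrite /Rm linear_fmul -hT linear_fmul.
  by apply: eq_bigr => i _; rewrite hT.
exists (fun i => Rm (v i)); split.
- move=> i; exists N; rewrite /Rm papMC -pap_G.
  by have := hN (delta_mx 0 i); rewrite fmul_delta => ->; rewrite linear0 pap0r.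
- move=> c hc i; apply: (iv c); rewrite fmul_row -key -Rfmul -fmul_row hc.
  by rewrite pap0r linear0 scaler0.
- move=> c; rewrite Rfmul -mulrA; set h := fmul c v 0.
  suff -> : Re mu * qf (krein_form ip K) (Rm h) = qf (krein_form ip G) h by exact: nv.
  rewrite /qf -Re_scaler.
  have -> : (Re mu)%:C = mu by apply: complexP => //=.
  congr (Re _); rewrite -{1}/(krein_form ip K (Rm h) (Rm h)).
  rewrite {2}/Rm -{1}pconj -(kf_pap hip symK symG) /krein_form -(hermZl hI) key.
  by rewrite symG.
Qed.
End Pair.
End Swap.

(** * Negative eigenvalues and negative squares *)

Lemma negative_ball (R : realType) (m a x y : R) :
  0 <= m -> m <= - y -> 0 <= a -> (x - y) ^+ 2 + a < m ^+ 2 -> x < 0.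
Proof. by move=> m0 my a0 h; rewrite ltNge; apply/negP => x0; nra. Qed.

Section NegativeEigenvalues.
Variables (R : realType) (X : completeNormedModType R[i]).
Variable (ip : X -> X -> R[i]).
Hypothesis hip : inner_product ip.
Local Notation C := R[i].
Local Notation hI := (ip_herm hip).
Local Notation n2 := (qf ip).
Implicit Types (u v w : X) (p : {poly C}) (mu nu z : C).

Lemma bounded_pap (S : {linear X -> X}) p :
  bounded_op ip S -> bounded_op ip (pap S p).
Proof.
move=> [c c0 hc].
have it i : exists2 d : R, 0 <= d & forall u, n2 (iter i S u) <= d * n2 u.
  elim: i => [|i [d d0 hd]]; first by exists 1 => // u; rewrite mul1r.
  exists (c * d) => [|u /=]; first exact: mulr_ge0.
  by apply: (le_trans (hc _)); rewrite -mulrA ler_wpM2l.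
apply: (bounded_sum hip) => i; have [d d0 hd] := it i.
exists (sqm p`_i * d) => [|u]; first by rewrite mulr_ge0 ?sqm_ge0.
by rewrite (qfZ hI) -mulrA ler_wpM2l ?sqm_ge0.
Qed.

Variables (H : set X) (B P : {linear X -> X}).
Hypothesis sH : subspace H.
Hypothesis cH : nclosed ip H.
Hypothesis symB : symmetric_op ip B.
Hypothesis bdB : bounded_op ip B.
Hypothesis HB : forall u, H (B u).
Hypothesis injB : forall u, H u -> B u = 0 -> u = 0.
Hypothesis HP : forall u, H (P u).
Hypothesis PH : forall u, H u -> P u = u.
Hypothesis symP : symmetric_op ip P.
Variable kappa : nat.
Hypothesis indexB : negative_index ip H B kappa.

Let S : {linear X -> X} := (P \o B)%FUN.
Local Notation kf := (krein_form ip B).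
Local Notation q := (qf kf).
Local Notation hk := (krein_herm hip symB).
Local Notation E := (root_space S).

Let SB u : S u = B u. Proof. exact: PH. Qed.
Let injP u : H u -> P u = 0 -> u = 0. Proof. by move=> /PH ->. Qed.
Let bdS : bounded_op ip S.
Proof. by have [c c0 hc] := bdB; exists c => // u; rewrite SB. Qed.

Let Y nu u : X := u - nu *: S u.
Let YE nu u : pap S (lin_factor nu) u = Y nu u. Proof. exact: pap_lin_factor. Qed.
Let HY nu u : H u -> H (Y nu u).
Proof. by move=> Hu; apply: subspaceB => //; apply: subspaceZ => //; rewrite SB. Qed.
Let Y_adj nu u v : ip (Y nu u) v = ip u (Y nu^*%C v).
Proof. by rewrite (hermBl hI) (hermZl hI) (hermBr hI) (hermZr hI) conjcK !SB symB. Qed.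
Let Y_comm nu p u : Y nu (pap S p u) = pap S p (Y nu u).
Proof. by rewrite -!YE papMC. Qed.
Let n2Y nu u : n2 (Y nu^*%C u) = n2 (Y nu u).
Proof.
rewrite /qf [in RHS]Y_adj -[in RHS]YE -Y_comm YE.
by rewrite (Y_adj nu^*%C) conjcK.
Qed.

(** [S] is symmetric for the definite inner product; so [1 - nu S] is normal, and the
    kernels of its powers coincide. *)
Let normal_kernel nu w : Y nu (Y nu w) = 0 -> Y nu w = 0.
Proof.
move=> h; apply: (n2_eq0 hip); rewrite /qf Y_adj.
have -> : Y nu^*%C (Y nu w) = 0.
  by apply: (n2_eq0 hip); rewrite n2Y h (qf0 hI).
by rewrite (herm0r hI).
Qed.

Let root_space_eigen mu u : E mu u -> Y mu u = 0.
Proof.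
move=> [n]; elim: n u => [|n IH] u; first by rewrite expr0 pap1 => ->; rewrite /Y linear0 scaler0 subr0.
by rewrite exprSr papM YE => /IH; exact: normal_kernel.
Qed.

Let S_form mu u : Y mu u = 0 -> n2 u = Re mu * q u /\ Im mu * q u = 0.
Proof.
move=> /eqP; rewrite subr_eq0 => /eqP h.
have : ip u u = mu * kf u u by rewrite {1}h (hermZl hI) SB.
rewrite (hermE hI) (hermE hk) => e.
have := congr1 Re e; have := congr1 Im e.
by rewrite cReM cImM /= !(mulr0, mul0r, subr0, addr0, add0r) => <- ->.
Qed.

Let real_neg mu : bool := (Im mu == 0) && (Re mu < 0).

(** [root_families_exist] with the identity (the projection [P]) in the place of the
    second operator. Root vectors are eigenvectors here, and for them
    [n2 u = mu * q u] with [q u <= 0], so that the numbers [mu] are negative. *)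
Let negative_root_vectors : exists (s : seq C) (v : 'I_kappa -> X),
  [/\ uniq s, all real_neg s, lin_indep v, forall c : 'rV_kappa, q (fmul c v 0) <= 0
    & forall i, H (v i) /\ exists2 mu, mu \in s & Y mu (v i) = 0].
Proof.
have [s0 [nn [us hs fs sn]]] :=
  root_families_exist hip sH cH symB symP bdB HB HP injB injP indexB.
have im mu : mu \in s0 -> 0 <= Im mu by move=> /hs[].
have [v [Ev iv nv]] := root_families_union hip symB symP us im fs.
move: v Ev iv nv; rewrite sn => v Ev iv nv.
exists [seq mu <- s0 | real_neg mu], v; split=> //.
- exact: filter_uniq.
- exact: filter_all.
- move=> i; have [mu ms Emu] := Ev i; split; first exact: (root_space_in sH HP Emu).
  have Yv := root_space_eigen Emu; exists mu => //.
  have [e1 e2] := S_form Yv.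
  have v0 : 0 < n2 (v i).
    by apply: (n2_gt0 hip); exact: lin_indep_neq0.
  have qv : q (v i) <= 0.
    by have := nv (delta_mx 0 i); rewrite fmul_delta.
  have q0 : q (v i) < 0.
    rewrite lt_neqAle qv andbT; apply: contraTneq v0 => q0.
    by rewrite e1 q0 mulr0 ltxx.
  rewrite mem_filter ms andbT /real_neg; apply/andP; split.
    by have /eqP := e2; rewrite mulf_eq0 (lt_eqF q0) orbF.
  move: v0 q0; rewrite e1; move: (Re mu) (q _) => a b + b0.
  by rewrite nmulr_lgt0.
Qed.

(** The form is also diagonal for the inner product, and a negative vector
    orthogonal to the [v i] would enlarge the nonpositive subspace. *)
Let nonneg_off (v : 'I_kappa -> X) u :
  lin_indep v -> (forall c : 'rV_kappa, q (fmul c v 0) <= 0) ->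
  (forall i, H (v i) /\ exists mu, mu != 0 /\ Y mu (v i) = 0) ->
  H u -> (forall i, ip u (v i) = 0) -> 0 <= q u.
Proof.
move=> iv nv Hv Hu uv; rewrite leNgt; apply/negP => qu.
have [[e ne] maxe] := indexB.
have uk c : ip u (\sum_i c i *: v i) = 0.
  rewrite (herm_sumr hI) big1 // => i _; by rewrite (hermZr hI) uv mulr0.
have kfu c : kf u (\sum_i c i *: v i) = 0.
  rewrite (herm_sumr hk) big1 // => i _; rewrite (hermZr hk).
  have [_ [mu [m0 /eqP]]] := Hv i; rewrite subr_eq0 => /eqP h.
  have : ip u (v i) = 0 by exact: uv.
  rewrite {1}h (hermZr hI) SB -symB => /eqP.
  by rewrite mulf_eq0 conjc_eq0 (negPf m0) /krein_form => /eqP ->; rewrite mulr0.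
suff : (kappa.+1 <= kappa)%N by rewrite ltnn.
apply: (nonpositive_family_le hip sH symB HB injB ne maxe (v := fcons u v)).
- by apply: fcons_in => // i; case: (Hv i).
- apply: lin_indep_fcons => // c uc.
  have : u = 0 by apply: (n2_eq0 hip); rewrite /qf {2}uc uk.
  by move=> u0; rewrite u0 (qf0 hk) ltxx in qu.
- move=> c; rewrite /fmul sum_fcons (qfD hk) (qfZ hk) (hermZl hk) kfu mulr0 /= mulr0 addr0.
  have := nv (\row_i c 0 (lift ord0 i)).
  have -> : fmul (\row_i c 0 (lift ord0 i)) v 0 = \sum_i c 0 (lift ord0 i) *: v i.
    by apply: eq_bigr => i _; rewrite mxE.
  have := sqm_ge0 (c 0 ord0); move: (sqm _) (q u) qu (q _) => a b b0 d a0 d0; nra.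
Qed.

Let prod_adj (s : seq C) u w : all real_neg s ->
  ip (pap S (\prod_(mu <- s) lin_factor mu) u) w =
  ip u (pap S (\prod_(mu <- s) lin_factor mu) w).
Proof.
elim: s w => [|mu s IH] w; first by rewrite !big_nil !pap1.
move=> /= /andP[/andP[/eqP im _] hs]; rewrite !big_cons !papM !YE Y_adj IH //.
by rewrite Y_comm (conjc_Im0 im).
Qed.

Let prod_kill (s : seq C) mu w : mu \in s -> Y mu w = 0 ->
  pap S (\prod_(nu <- s) lin_factor nu) w = 0.
Proof.
by move=> ms Yw; rewrite (big_rem mu) //= mulrC papM YE Yw pap0r.
Qed.

Let coprime_prod (s : seq C) nu : nu \notin s ->
  coprimep (lin_factor nu) (\prod_(mu <- s) lin_factor mu).
Proof.
elim: s => [|mu s IH]; first by rewrite big_nil coprimep1.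
rewrite in_cons negb_or big_cons => /andP[nm ns].
by rewrite coprimepMr lin_factor_coprime // IH.
Qed.

Let prod_nonpos (s : seq C) u : uniq s -> all real_neg s -> H u ->
  pap S (\prod_(mu <- s) lin_factor mu) u = 0 -> q u <= 0.
Proof.
elim: s u => [|mu s IH] u /=.
  by rewrite big_nil pap1 => _ _ _ ->; rewrite (qf0 hk).
move=> /andP[ms us] /andP[/andP[/eqP im mu0] hs] Hu; rewrite big_cons.
set r := \prod_(nu <- s) _ => h.
have /Bezout_eq1_coprimepP[[a b] /= ab] := coprime_prod ms.
have HS w : H w -> H (S w) by move=> _; exact: HP.
set u1 := pap S (b * r) u; set u2 := pap S (a * lin_factor mu) u.
have -> : u = u1 + u2 by rewrite -[LHS](pap1 S) -ab papDl addrC.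
have Yu1 : pap S (lin_factor mu) u1 = 0.
  by rewrite /u1 -papM mulrCA papM h pap0r.
have ru2 : pap S r u2 = 0.
  by rewrite /u2 -papM mulrCA papM [r * _]mulrC h pap0r.
have cop : coprimep (map_poly (@conjc R) (lin_factor mu)) r.
  have -> : map_poly (@conjc R) (lin_factor mu) = lin_factor mu.
    by rewrite conj_lin_factor (conjc_Im0 im).
  exact: coprime_prod.
rewrite (qfD hk) (annihilators_orthogonal hip symB symP cop Yu1 ru2) /= mulr0 addr0.
have q2 : q u2 <= 0 by apply: IH => //; apply: pap_in.
have [e1 _] := S_form (etrans (esym (YE _ _)) Yu1).
have := n2_ge0 hip u1; rewrite e1 => h1.
have q1 : q u1 <= 0 by rewrite leNgt; apply/negP => q1; nra.
lra.
Qed.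

Let annihilated (s : seq C) : set X :=
  [set u | H u /\ pap S (\prod_(mu <- s) lin_factor mu) u = 0].

Let annihilated_subspace s : subspace (annihilated s).
Proof.
split=> [|a u v [Hu pu] [Hv pv]]; first by split; [exact: sH.1 | exact: pap0r].
by split; [exact: sH.2 | rewrite papDr papZr pu pv scaler0 addr0].
Qed.

Let ldim_annihilated s : uniq s -> all real_neg s ->
  (ldim (annihilated s) <= kappa%:R%:E)%E.
Proof.
move=> us hs; have [[e ne] maxe] := indexB.
apply: ldim_le => n v Hv iv; rewrite lee_fin ler_nat.
apply: (nonpositive_family_le hip sH symB HB injB ne maxe _ iv) => [i|c].
  by case: (Hv i).
have [Hw pw] : annihilated s (fmul c v 0) by apply: fmul_in.
exact: prod_nonpos pw.
Qed.

(** The polynomial [r] with the factors [1 - mu X], [mu \in s], maps [H] into the space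
    where [B >= 0], and there [1 - nu S] is bounded below by one. As [r] is coprime
    to [1 - nu X], Bezout's identity bounds [1 - nu S] from below on [H]. *)
Let lower_bound (s : seq C) (v : 'I_kappa -> X) nu :
  all real_neg s -> lin_indep v -> (forall c : 'rV_kappa, q (fmul c v 0) <= 0) ->
  (forall i, H (v i) /\ exists2 mu, mu \in s & Y mu (v i) = 0) ->
  Re nu <= 0 -> nu \notin s ->
  exists2 c : R, 0 <= c & forall u, H u -> n2 u <= c * n2 (Y nu u).
Proof.
move=> hs iv nv Hv nu0 ns; set r := \prod_(mu <- s) lin_factor mu.
have HS w : H w -> H (S w) by move=> _; exact: HP.
have pos u : H u -> 0 <= q (pap S r u).
  move=> Hu; apply: (nonneg_off iv nv) => [i||i].
  - have [Hvi [mu ms Yv]] := Hv i; split=> //; exists mu; split=> //.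
    by apply/eqP => m0; have /allP/(_ _ ms) := hs; rewrite m0 /real_neg /= ltxx andbF.
  - exact: pap_in.
  - have [Hvi [mu ms Yv]] := Hv i.
    by rewrite prod_adj // (prod_kill ms Yv) (herm0r hI).
have lb h : H h -> 0 <= q h -> n2 h <= n2 (Y nu h).
  move=> Hh qh; have := CS_Re hip (Y nu h) h.
  have -> : Re (ip (Y nu h) h) = n2 h - Re nu * q h.
    rewrite (hermBl hI) cReB (hermZl hI) SB cReM.
    by rewrite (Im_herm hk) mulr0 subr0.
  have := n2_ge0 hip (Y nu h); have := n2_ge0 hip h.
  have : Re nu * q h <= 0 by nra.
  move: (Re nu * q h) (n2 h) (n2 _) => x y z x0 y0 z0 h1.
  rewrite leNgt; apply/negP => zy; nra.
have /Bezout_eq1_coprimepP[[a b] /= ab] := coprime_prod ns.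
have [ca ca0 ha] := bounded_pap a bdS; have [cb cb0 hb] := bounded_pap (b * r) bdS.
have [cr cr0 hr] := bounded_pap r bdS; have [cb' cb0' hb'] := bounded_pap b bdS.
exists (2 * ca + 2 * (cb' * cr)) => [|u Hu].
  by have := mulr_ge0 cb0' cr0; lra.
rewrite -[X in n2 X](pap1 S) -ab papDl; apply: (le_trans (n2D_le hip _ _)).
rewrite !papM YE -/r [leRHS]mulrDl -!mulrA; apply: lerD; rewrite ler_wpM2l //.
apply: (le_trans (hb' _)); rewrite ler_wpM2l //.
apply: (le_trans (lb _ _ (pos _ Hu))); first exact: pap_in.
by rewrite Y_comm; exact: hr.
Qed.

(** The adjoint of the normal operator [1 - nu S] has the same lower bound, so that the
    form [(Z u, Z v)] with this adjoint [Z] is coercive. *)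
Let surjective nu (c : R) : 0 <= c ->
  (forall u, H u -> n2 u <= c * n2 (Y nu u)) ->
  forall f, H f -> exists2 u, H u & Y nu u = f.
Proof.
move=> c0 hc f Hf; pose Z u := Y nu^*%C u.
have [M M0 hM] := bounded_pap (lin_factor nu^*%C) bdS.
have Zl a u v : Z (a *: u + v) = a *: Z u + Z v.
  by rewrite /Z -!YE papDr papZr.
pose b u v := ip (Z u) (Z v).
have hb : hermitian_form b.
  split=> [a u v w|u v]; last exact: (herm_conj hI).
  by rewrite /b Zl (hermDl hI) (hermZl hI).
have [|||||||y Hy hy] := riesz hip (b := b) (c := (c + 1)^-1) (M := M)
    (phi := fun v => ip v f) (Mp := n2 f) sH cH hb.
- by rewrite invr_gt0; lra.
- exact: M0.
- exact: (n2_ge0 hip).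
- move=> u Hu; rewrite mulrC ler_pdivrMr; last by lra.
  rewrite /qf /b -/(n2 (Z u)) n2Y mulrC mulrDl mul1r.
  by apply: (le_trans (hc u Hu)); rewrite lerDl (n2_ge0 hip).
- by move=> u Hu; rewrite /qf /b /Z -!YE; exact: hM.
- by move=> a u v _ _; rewrite (hermDl hI) (hermZl hI).
- by move=> u _; rewrite mulrC; exact: (CS hip).
exists (Z y); first exact: HY.
apply/eqP; rewrite -subr_eq0; apply/eqP.
apply: (ip_self_eq0 hip (V := H)) => [|v Hv].
  by apply: subspaceB => //; do 2 apply: HY.
have e := hy v Hv; rewrite /b /Z Y_adj conjcK in e.
by rewrite (herm_conj hI) (hermBr hI) e subrr conjc0.
Qed.

Let separated (t : seq C) z : exists2 e : R, 0 < e &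
  forall w : C, w \in t -> sqm (w - z) < e ^+ 2 -> w = z.
Proof.
elim: t => [|x t [e e0 he]]; first by exists 1.
have [xz|xz] := eqVneq x z.
  by exists e => // w; rewrite in_cons => /orP[/eqP ->|/he].
have d0 : 0 < sqm (x - z) by rewrite sqm_gt0 // subr_eq0.
exists (Num.min e (Num.min 1 (sqm (x - z)))) => [|w].
  by rewrite !lt_min e0 d0 ltr01.
set m := Num.min _ _ => wt hw.
have m0 : 0 <= m by rewrite !le_min (ltW e0) (ltW d0) ler01.
have me : m <= e by rewrite ge_min lexx.
have m1 : m <= 1 by rewrite !ge_min lexx orbT.
have md : m <= sqm (x - z) by rewrite !ge_min lexx !orbT.
move: wt; rewrite in_cons => /orP[/eqP wx|/he]; last first.
  by apply; apply: (lt_le_trans hw); rewrite ler_pXn2r ?nnegrE // ltW.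
have : m ^+ 2 <= m by rewrite expr2 ler_piMl.
by move=> /(lt_le_trans hw)/lt_le_trans/(_ md); rewrite wx ltxx.
Qed.

Variables (T : operator X) (iv : C -> C).
Hypothesis symT : forall u v, dom T u -> dom T v -> ip (T u) v = ip u (T v).
Hypothesis ivK : forall z, Re z < 0 -> iv (iv z) = z.
Hypothesis iv_neg : forall z, Re z < 0 -> Re (iv z) < 0.
Hypothesis iv_real : forall z, Im z = 0 -> Im (iv z) = 0.
Hypothesis eigT : forall z u, Re z < 0 ->
  (dom T u /\ T u = z *: u) <-> (H u /\ u = iv z *: B u).
Hypothesis resT : forall w : C, Re w < 0 ->
  (forall f, H f -> exists2 u, H u & u - iv w *: B u = f) ->
  (exists2 c : R, 0 <= c & forall u, H u -> n2 u <= c * n2 (u - iv w *: B u)) ->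
  resolvent_set H T w.

(** The eigenvectors and the resolvent of [T] are those of [B] up to the
    transformation [iv] of the spectral parameter: the identity for [T = B^(-1)], the
    inversion for [T = B]. The eigenvectors for negative eigenvalues are annihilated
    by the polynomial with the roots [s], and its kernel is a nonpositive subspace; the
    lower bounds show that these eigenvalues are isolated. *)
Lemma negative_eigenspace_dim :
  ldim (lspan [set u | exists z,
    [/\ z < 0, discrete_spectrum H T z & eigenvector T (op_id H) z u]])
  = kappa%:R%:E.
Proof.
have ltc0 z : (z < 0) = real_neg z by rewrite ltcE /= eq_sym.
have [s [v [us hs indv nv Hv]]] := negative_root_vectors.
have inA z u : Re z < 0 -> dom T u -> T u = z *: u -> annihilated s u.
  move=> z0 du Tu; have [Hu hu] := (eigT u z0).1 (conj du Tu).
  have Yu : Y (iv z) u = 0 by rewrite /Y SB -hu subrr.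
  split=> //; have [ms|ms] := boolP (iv z \in s); first exact: prod_kill Yu.
  have [c c0 /(_ u Hu)] := lower_bound hs indv nv Hv (ltW (iv_neg z0)) ms.
  rewrite Yu (qf0 hI) mulr0 => h.
  have -> : u = 0 by apply: (n2_eq0 hip); apply/le_anti; rewrite h (n2_ge0 hip).
  by rewrite pap0r.
apply/le_anti/andP; split.
  apply: le_trans (ldim_annihilated us hs); apply: ldim_le => n w Hw indw.
  apply: (ldim_ge _ indw) => i; apply: lspan_sub (Hw i).
    exact: annihilated_subspace.
  by move=> u [z [z0 _ [du _ _ Tu]]]; apply: (inA z) => //; move: z0; rewrite ltc0 => /andP[].
apply: (ldim_ge _ indv) => i; apply: sub_lspan.
have [Hvi [mu ms Yv]] := Hv i.
have /allP/(_ _ ms)/andP[/eqP imu mu0] := hs.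
have vm : v i = mu *: B (v i).
  by apply/eqP; rewrite -subr_eq0 -SB; apply/eqP.
pose z := iv mu; have rz : Re z < 0 by exact: iv_neg.
have iz : Im z = 0 by exact: iv_real.
have [dv Tv] : dom T (v i) /\ T (v i) = z *: v i.
  by apply/(eigT _ rz); split=> //; rewrite /z ivK.
have v0 : v i != 0 by exact: lin_indep_neq0.
have eigv : eigenvector T (op_id H) z (v i) by [].
exists z; split=> //; first by rewrite ltc0 /real_neg iz eqxx.
split; last 1 first.
- apply: le_lt_trans (ltry kappa%:R); apply: le_trans (ldim_annihilated us hs).
  apply: ldim_le => n w Hw indw; apply: (ldim_ge _ indw) => j.
  apply: lspan_sub (Hw j); first exact: annihilated_subspace.
  move=> u [m [f [[df f0 Tf0 Tf] [k km ->]]]].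
  have d0 := (df 0%N (leq0n m)).1.
  case: m df Tf km => [|m] df Tf km.
    by move: km; rewrite leqn0 => /eqP ->; apply: (inA z).
  have d1 := (df 1%N (ltnW (ltn0Sn m.+1))).1.
  have /= T1 := Tf 0%N (ltn0Sn m).
  exfalso; move/eqP: f0; apply; apply: (n2_eq0 hip).
  have e : f 0%N = T (f 1%N) - z *: f 1%N by rewrite T1 addrC addKr.
  rewrite /qf {1}e (hermBl hI) symT // Tf0 (hermZr hI) (hermZl hI).
  by rewrite (conjc_Im0 iz) subrr.
- move=> [_ [c /(_ _ dv)]]; rewrite Tv subrr normr0 mulr0 normr_le0.
  by rewrite (negPf v0).
- have [e e0 he] := separated [seq iv nu | nu <- s] z.
  exists (Num.min e (- Re z)) => [|w specw wz]; first by rewrite lt_min e0 oppr_gt0.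
  have sw : sqm (w - z) < (Num.min e (- Re z)) ^+ 2.
    rewrite -ltcR -normc_sqm rmorphXn /= ltr_pXn2r ?nnegrE //.
    by rewrite lecR le_min (ltW e0) oppr_ge0 ltW.
  have m0 : 0 <= Num.min e (- Re z) by rewrite le_min (ltW e0) oppr_ge0 ltW.
  have le1 : Num.min e (- Re z) <= e by rewrite ge_min lexx.
  have le2 : Num.min e (- Re z) <= - Re z by rewrite ge_min lexx orbT.
  have rw : Re w < 0.
    apply: (negative_ball m0 le2 (sqr_ge0 (Im (w - z)))).
    by rewrite -cReB.
  apply: contrapT => wnz; apply: specw.
  have ns : iv w \notin s.
    apply/negP => ws; apply: wnz; apply: he.
      by apply/mapP; exists (iv w); rewrite ?ivK.
    by apply: (lt_le_trans sw); rewrite ler_pXn2r ?nnegrE // ltW.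
  have [c c0 lb] := lower_bound hs indv nv Hv (ltW (iv_neg rw)) ns.
  apply: resT => // [f Hf|].
    have [u Hu hu] := surjective c0 lb Hf; exists u => //.
    by rewrite -SB.
  by exists c => // u Hu; rewrite -SB; exact: lb.
- by exists (v i).
Qed.
End NegativeEigenvalues.

(** * Dimensions of semidefinite root subspaces *)

Section FiniteIndex.
Variables (R : realType) (X : completeNormedModType R[i]).
Variable (ip : X -> X -> R[i]).
Hypothesis hip : inner_product ip.
Local Notation C := R[i].

(** More than [m] vectors have a nontrivial combination on which all the
    functionals vanish. *)
Lemma finite_negative_index (V : set X) (T : X -> X) m (phi : 'I_m -> X -> C) :
  subspace V ->
  (forall j a u v, phi j (a *: u + v) = a * phi j u + phi j v) ->
  (forall u, V u -> (forall j, phi j u = 0) -> 0 <= Re (ip (T u) u)) ->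
  exists k, negative_index ip V T k.
Proof.
move=> sV philin pos.
have phi0 j : phi j 0 = 0.
  have := philin j 1 0 0; rewrite scaler0 addr0 mul1r => /eqP.
  by rewrite -subr_eq subrr eq_sym => /eqP.
pose N n := exists v : 'I_n -> X, negative_family ip V T v.
have bnd n : N n -> (n <= m)%N.
  move=> [v [Vv nv]]; rewrite leqNgt; apply/negP => mn.
  have [c [i ci] hc] := nontrivial_solution (fun i j => phi j (v i)) mn.
  have : (\row_i c i : 'rV[C]_n) != 0.
    by apply/eqP => /rowP/(_ i); rewrite !mxE; exact/eqP.
  move=> /nv; rewrite ltNge pos //; first exact: fmul_in.
  move=> j; rewrite -fmul_row -[RHS](hc j).
  elim/big_ind2: _ => //= [x a y b <- <-|k _].
    by rewrite -{1}[a]scale1r philin mul1r.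
  by rewrite -[_ *: _]addr0 philin phi0 addr0.
have N0 : N 0%N.
  exists (fun=> 0); split=> [[]//|c /eqP[]].
  by apply/rowP => -[].
pose p n := `[< N n >].
have ep : exists n, p n by exists 0%N; apply/asboolP.
have bp n : p n -> (n <= m)%N by move=> /asboolP; exact: bnd.
have [k pk maxk] := ex_maxnP ep bp.
exists k; split; first exact/asboolP.
by move=> n v hv; apply: maxk; apply/asboolP; exists v.
Qed.
End FiniteIndex.

Section Dimensions.
Variables (R : realType) (X : completeNormedModType R[i]).
Variable (ip : X -> X -> R[i]).
Hypothesis hip : inner_product ip.
Local Notation C := R[i].
Implicit Types (u v : X) (mu z : C).

Definition max_family (K G : {linear X -> X}) (s : R) mu : \bar R :=
  ereal_sup [set n%:R%:E | n in [set n | signed_root_family ip K G s mu n]].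

Lemma max_family_le (K G : {linear X -> X}) s mu (x : \bar R) :
  (forall n, signed_root_family ip K G s mu n -> (n%:R%:E <= x)%E) ->
  (max_family K G s mu <= x)%E.
Proof. by move=> h; apply: ge_ereal_sup => _ [n hn <-]; exact: h. Qed.

Lemma max_family_ge (K G : {linear X -> X}) s mu n :
  signed_root_family ip K G s mu n -> (n%:R%:E <= max_family K G s mu)%E.
Proof. by move=> h; apply: ereal_sup_ubound; exists n. Qed.

Lemma signed_root_family0 (K G : {linear X -> X}) s mu :
  symmetric_op ip K -> signed_root_family ip K G s mu 0.
Proof.
move=> symK; exists (fun=> 0); split=> [[]//||c]; first exact: lin_indep0.
by rewrite /fmul big_ord0 (qf0 (krein_herm hip symK)) mulr0.
Qed.

Lemma signed_root_family_scale (K G : {linear X -> X}) (a s : R) mu n : 0 <= a ->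
  signed_root_family ip K G s mu n -> signed_root_family ip K G (a * s) mu n.
Proof.
move=> a0 [v [Ev iv nv]]; exists v; split=> // c.
by rewrite -mulrA mulr_ge0_le0.
Qed.

Lemma max_family_ge0 (K G : {linear X -> X}) s mu :
  symmetric_op ip K -> (0 <= max_family K G s mu)%E.
Proof. by move=> symK; apply: (max_family_ge (n := 0)); exact: signed_root_family0. Qed.

(** [Np] and [Nn] have the form of the left-hand side. *)
Lemma ldim_sup (K G : {linear X -> X}) s mu : symmetric_op ip K ->
  ereal_sup [set ldim W | W in [set W | [/\ subspace W,
    W `<=` root_space (G \o K)%FUN mu
    & forall u, W u -> s * qf (krein_form ip K) u <= 0]]]
  = max_family K G s mu.
Proof.
move=> symK; apply/le_anti/andP; split.
  apply: ge_ereal_sup => _ [W [sW WE nW] <-]; apply: ldim_le => n v Wv iv.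
  apply: max_family_ge; exists v; split=> // [i|c]; first exact/WE/Wv.
  by apply: nW; exact: fmul_in.
apply: max_family_le => n [v [Ev iv nv]].
pose W := [set u | exists c : 'rV[C]_n, u = fmul c v 0].
have Wv i : W (v i).
  by exists (delta_mx 0 i); rewrite fmul_delta.
apply: (le_trans (ldim_ge Wv iv)); apply: ereal_sup_ubound; exists W => //; split.
- split=> [|a _ _ [c ->] [d ->]].
    by exists 0; rewrite fmul0.
  exists (a *: c + d); rewrite /fmul scaler_sumr -big_split.
  by apply: eq_bigr => i _; rewrite !mxE scalerDl scalerA.
- by move=> _ [c ->]; apply: fmul_in => //; exact: root_space_subspace.
- by move=> _ [c ->].
Qed.

Section Pair.
Variables (H : set X) (K G : {linear X -> X}) (kappa : nat).
Hypothesis sH : subspace H.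
Hypothesis cH : nclosed ip H.
Hypothesis symK : symmetric_op ip K.
Hypothesis symG : symmetric_op ip G.
Hypothesis bdK : bounded_op ip K.
Hypothesis HK : forall u, H (K u).
Hypothesis HG : forall u, H (G u).
Hypothesis injK : forall u, H u -> K u = 0 -> u = 0.
Hypothesis injG : forall u, H u -> G u = 0 -> u = 0.
Hypothesis indexK : negative_index ip H K kappa.

Lemma root_familyP mu n : root_family ip K G mu n <->
  signed_root_family ip K G (Im mu == 0)%:R mu n.
Proof.
split=> -[v [Ev iv nv]]; exists v; split=> //.
  by case: eqVneq => [/nv h c|_ c]; rewrite ?mul1r ?mul0r.
by move=> /eqP h c; have := nv c; rewrite h mul1r.
Qed.

(** The two bounds [root_families_le] and [root_families_exist] meet. The
    translation by [delta] leads from the parameter [mu] of the root spaces back to the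
    spectral parameter of the pencil. *)
Theorem dimension_sum (delta : R) :
  esum [set z : C | 0 <= Im z]
    (fun z => max_family K G (Im z == 0)%:R (z + delta%:C)) = kappa%:R%:E.
Proof.
have /choice[nn hnn] : forall mu : C, exists k : nat, 0 <= Im mu ->
    root_family ip K G mu k /\ forall n, root_family ip K G mu n -> (n <= k)%N.
  move=> mu; have [im|im] := boolP (0 <= Im mu); last by exists 0%N.
  pose p n := `[< root_family ip K G mu n >].
  have ep : exists n, p n.
    by exists 0%N; apply/asboolP/root_familyP; exact: signed_root_family0.
  have bp n : p n -> (n <= kappa)%N.
    move=> /asboolP hn.
    have := root_families_le hip sH symK symG HK HG injK indexK (s := [:: mu])
      (nn := fun=> n) isT.
    by rewrite big_seq1; apply=> nu; rewrite inE => /eqP ->.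
  have [k /asboolP pk maxk] := ex_maxnP ep bp.
  by exists k => _; split=> // n hn; apply: maxk; apply/asboolP.
have Imd z : Im (z + delta%:C) = Im z by rewrite cImD /= addr0.
have fE z : 0 <= Im z ->
    max_family K G (Im z == 0)%:R (z + delta%:C) = (nn (z + delta%:C))%:R%:E.
  move=> iz; have [|fam mx] := hnn (z + delta%:C); first by rewrite Imd.
  apply/le_anti/andP; split.
    apply: max_family_le => n; rewrite -{1}Imd => /root_familyP/mx.
    by rewrite lee_fin ler_nat.
  by apply: max_family_ge; rewrite -{1}Imd; apply/root_familyP.
have sumE (s : seq C) : all (fun z => 0 <= Im z) s ->
    (\sum_(z <- s) max_family K G ((Im z == 0)%:R)%R (z + delta%:C)%R =
     (\sum_(mu <- [seq (z + delta%:C)%R | z <- s]) nn mu)%N%:R%:E)%E.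
  move=> /allP hs; rewrite big_map natr_sum -sumEFin big_seq [RHS]big_seq.
  by apply: eq_bigr => z /hs; exact: fE.
apply/le_anti/andP; split.
  apply: ge_ereal_sup => _ [F [finF FD] <-].
  rewrite fsbig_finite //= sumE; last first.
    by apply/allP => z; rewrite in_fset_set // inE => /FD.
  rewrite lee_fin ler_nat.
  have im mu : mu \in [seq z + delta%:C | z <- finmap.enum_fset (fset_set F)] -> 0 <= Im mu.
    by move=> /mapP[z]; rewrite in_fset_set // inE => /FD /= iz ->; rewrite Imd.
  apply: (root_families_le hip sH symK symG HK HG injK indexK _ im).
    by rewrite map_inj_uniq; [exact: finmap.fset_uniq | exact: addIr].
  by move=> mu /im /hnn[].
have [s [mm [us hs fs sumk]]] :=
  root_families_exist hip sH cH symK symG bdK HK HG injK injG indexK.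
pose t := [seq mu - delta%:C | mu <- s].
have ut : uniq t by rewrite map_inj_uniq //; exact: addIr.
have tD z : z \in t -> 0 <= Im z.
  by move=> /mapP[mu /hs[_ im] ->]; rewrite cImD /= subr0.
apply: esum_ge; exists [set` t].
  by split=> [|z /tD]; first exact: finite_seq.
rewrite -fsbig_seq // sumE; last exact/allP.
rewrite -map_comp (eq_map (g := id)) ?map_id => [|mu /=]; last by rewrite subrK.
rewrite lee_fin ler_nat -sumk big_seq [X in (_ <= X)%N]big_seq.
apply: leq_sum => mu ms; have [_ im] := hs _ ms.
by apply: (hnn mu im).2; exact: fs.
Qed.
End Pair.

(** The signs [s] and [t] of the two forms are related by the sign of [mu] as in
    [swap_family]; for nonreal [mu] they are both zero. *)
Lemma max_family_swap (H : set X) (K G : {linear X -> X}) mu (s t : R) :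
  subspace H -> symmetric_op ip K -> symmetric_op ip G ->
  (forall u, H (K u)) -> (forall u, H (G u)) ->
  (forall u, H u -> K u = 0 -> u = 0) -> (forall u, H u -> G u = 0 -> u = 0) ->
  (s = 0 /\ t = 0) \/
  [/\ Im mu = 0, (exists2 a, 0 <= a & s = a * (t * Re mu))
    & exists2 a, 0 <= a & t = a * (s * Re mu)] ->
  max_family K G s mu = max_family G K t mu.
Proof.
move=> sH symK symG HK HG injK injG h.
have E n : signed_root_family ip K G s mu n <-> signed_root_family ip G K t mu n.
  case: h => [[-> ->]|[im [a a0 sE] [b b0 tE]]].
    by split; [exact: (swap_dimension sH HG) | exact: (swap_dimension sH HK)].
  split=> hn.
    rewrite tE; apply: signed_root_family_scale => //.
    exact: (swap_family hip symG symK).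
  rewrite sE; apply: signed_root_family_scale => //.
  exact: (swap_family hip symK symG).
rewrite /max_family; congr ereal_sup; apply/seteqP.
by split=> _ [n /E hn <-]; exists n.
Qed.
End Dimensions.

(** * Jordan chains of the pencil *)

Section JordanChains.
Variables (R : realType) (X : completeNormedModType R[i]).
Local Notation C := R[i].
Implicit Types (u v : X) (z : C).
Variables (H : set X) (K G : {linear X -> X}) (A B : operator X) (delta : R).
Hypothesis sH : subspace H.
Hypothesis HK : forall u, H (K u).
Hypothesis HG : forall u, H (G u).
Hypothesis injG : forall u, H u -> G u = 0 -> u = 0.
Hypothesis domA : dom A `<=` H.
Hypothesis domB : dom B = H.
Hypothesis BK : forall u, H u -> B u = K u.
Hypothesis AG : forall u, dom A u -> u = G (A u + delta%:C *: K u).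
Hypothesis GA : forall w, H w ->
  dom A (G w) /\ A (G w) + delta%:C *: K (G w) = w.

Let S : {linear X -> X} := (G \o K)%FUN.
Local Notation E z := (root_space S (z + delta%:C)).

(** Adding [delta K u] to both sides and applying [G] turns the equation of the
    pencil into one for [S], the inverse of [K^(-1) A + delta]. *)
Let stepP z u v : H v ->
  (dom A u /\ A u = z *: K u + K v) <->
  (H u /\ u = (z + delta%:C) *: S u + S v).
Proof.
move=> Hv; split=> [[du Au]|[Hu hu]].
  split; first exact: domA.
  rewrite {1}(AG du) Au addrAC -scalerDl linearD linearZ /=.
  by [].
have Hw : H ((z + delta%:C) *: K u + K v) by exact: sH.2.
have uG : u = G ((z + delta%:C) *: K u + K v).
  by rewrite linearD linearZ.
have [d e] := GA Hw; rewrite -uG in d e; split=> //.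
by apply: (addIr (delta%:C *: K u)); rewrite e addrAC -scalerDl.
Qed.

Lemma jordan_chain_root_space z n f j :
  jordan_chain A B z n f -> (j <= n)%N -> E z (f j).
Proof.
move=> [df f0 A0 Af]; suff h : (j <= n)%N ->
    pap S (lin_factor (z + delta%:C) ^+ j.+1) (f j) = 0 by move=> /h; exists j.+1.
have Hf i : (i <= n)%N -> H (f i) by move=> /df[+ _]; exact: domA.
elim: j => [|j IH] jn.
  rewrite expr1 pap_lin_factor; apply/eqP; rewrite subr_eq0; apply/eqP.
  have [|_ +] := (stepP z (f 0%N) sH.1).1.
    by split; [case: (df 0%N jn) | rewrite A0 BK ?linear0 ?addr0 //; exact: Hf].
  by rewrite linear0 addr0.
rewrite exprSr papM pap_lin_factor.
have [|_ h] := (stepP z (f j.+1) (Hf j (ltnW jn))).1.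
  by split; [case: (df _ jn) | rewrite Af // !BK //; apply: Hf => //; exact: ltnW].
by rewrite {1}h addrAC subrr add0r papS IH ?linear0 // ltnW.
Qed.

(** The chain descends from [u] by repeated application of [S^(-1) (1 - mu S)], where
    on the kernel of [(1 - mu S)^n] the inverse of [S] is [r = mu (Y^0 + Y^1 + ...)], a
    polynomial in [Y = 1 - mu S]. *)
Lemma root_space_jordan_chain z u : E z u -> u != 0 ->
  exists n f, jordan_chain A B z n f /\ f n = u.
Proof.
set mu := z + delta%:C => -[n0 hn0] u0.
pose Y := lin_factor mu.
have en : exists n, `[< pap S (Y ^+ n) u = 0 >] by exists n0; apply/asboolP.
have [n /asboolP hn minn] := ex_minnP en.
case: n hn minn => [|m] hn minn; first by rewrite expr0 pap1 in hn; rewrite hn eqxx in u0.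
have Hu : H u by apply: (root_space_in (K := K) sH HG); exists m.+1; exact: hn.
pose r := mu *: \sum_(i < m.+1) Y ^+ i.
have rS w : pap S (Y ^+ m.+1) w = 0 -> S (pap S r w) = w.
  move=> hw; rewrite -papMX.
  have -> : r * 'X = 1 - Y ^+ m.+1.
    rewrite /r -scalerAl scalerAr mulrC -[RHS]opprB subrX1 -mulNr opprB.
    by congr (_ * _); rewrite /Y /lin_factor opprB addrC subrK.
  by rewrite papDl pap1 -scaleN1r papZl hw scaler0 addr0.
pose f j := pap S ((r * Y) ^+ (m - j)) u.
have fker j : pap S (Y ^+ m.+1) (f j) = 0 by rewrite /f papMC hn pap0r.
have HS w : H w -> H (S w) by move=> _; exact: HG.
have Hf j : H (f j) by apply: pap_in.
have fS j : (j < m)%N -> f j.+1 = mu *: S (f j.+1) + S (f j).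
  move=> jm; have -> : S (f j) = pap S Y (f j.+1).
    rewrite /f -(subnSK jm) exprS papM papM rS // -papM.
    by rewrite mulrC papM -[pap S (Y ^+ m.+1) _]papM mulrC papM; rewrite papMC hn !pap0r.
  by rewrite pap_lin_factor addrC subrK.
have f0 : f 0%N = mu *: S (f 0%N).
  apply/eqP; rewrite -subr_eq0 -pap_lin_factor /f subn0 -papM exprMn mulrCA.
  by rewrite -exprS papM hn pap0r.
exists m, f; split; last by rewrite /f subnn expr0 pap1.
split.
- move=> j jm; rewrite domB; split; last exact: Hf.
  case: j jm => [|j] jm.
    by have [|] := (stepP z (f 0%N) sH.1).2; rewrite ?linear0 ?addr0.
  by have [|] := (stepP z (f j.+1) (Hf j)).2; first by split; [exact: Hf | exact: fS].
- apply/eqP => f00; have : pap S (Y ^+ m) u = 0.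
    have h k w : pap S (Y ^+ m.+1) w = 0 -> iter k S (pap S (r ^+ k) w) = w.
      elim: k w => [|k IH] w hw; first by rewrite expr0 pap1.
      by rewrite iterSr exprS papM rS ?IH // papMC hw pap0r.
    have : pap S (Y ^+ m.+1) (pap S (Y ^+ m) u) = 0 by rewrite papMC hn pap0r.
    move=> /(h m); rewrite -papM -exprMn.
    have -> : pap S ((r * Y) ^+ m) u = 0 by rewrite -f00 /f subn0.
    have S0 k : iter k S 0 = 0 by elim: k => //= k ->; rewrite !linear0.
    by rewrite S0.
  by move=> hm; have := minn m (asboolT hm); rewrite ltnn.
- have [|_ +] := (stepP z (f 0%N) sH.1).2; first by rewrite linear0 addr0.
  by rewrite linear0 addr0 BK.
- move=> j jm; have [|_ +] := (stepP z (f j.+1) (Hf j)).2.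
    by split; [exact: Hf | exact: fS].
  by rewrite !BK.
Qed.

Lemma gen_eigenspaceE z : gen_eigenspace A B z = E z.
Proof.
apply/seteqP; split.
  apply: lspan_sub; first exact: root_space_subspace.
  by move=> _ [n [f [hf [j jn ->]]]]; exact: jordan_chain_root_space hf jn.
move=> u Eu; have [->|u0] := eqVneq u 0; first exact: (lspan_subspace _).1.
apply: sub_lspan; have [n [f [hf fn]]] := root_space_jordan_chain Eu u0.
by exists n, f; split=> //; exists n.
Qed.

Lemma is_eigenvalueP z : is_eigenvalue A B z <-> exists2 u, u != 0 & E z u.
Proof.
split=> [[u [dA dB u0 Au]]|[u u0 Eu]].
  exists u => //; apply: (@jordan_chain_root_space z 0 (fun=> u) 0) => //.
have [n [f [[df f0 A0 _] _]]] := root_space_jordan_chain Eu u0.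
by exists (f 0%N); have [dA dB] := df 0%N (leq0n _).
Qed.
End JordanChains.

(** * The operators of the pencil *)

Section UpperHalfPlane.
Variable R : realType.
Local Notation C := R[i].

Lemma esum_subset (I : choiceType) (E D : set I) (f : I -> \bar R) :
  (forall z, D z -> ~ E z -> f z = 0%E) ->
  esum [set z | E z /\ D z] f = esum D f.
Proof.
move=> h; rewrite (esum_mkcondl E D); apply: eq_esum => z Dz.
by case: ifPn => // /negP Ez; rewrite h // => /mem_set.
Qed.

(** The closed upper half plane consists of the negative axis, the origin, the
    positive axis and the open upper half plane. *)
Lemma esum_closed_upper_half (f : C -> \bar R) : (forall z, 0 <= f z)%E ->
  esum [set z : C | 0 <= Im z] f =
  (esum [set z : C | (z < 0)%R] f + f 0%R + esum [set z : C | (0 < z)%R] f +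
   esum [set z : C | (0 < Im z)%R] f)%E.
Proof.
move=> f0; rewrite (esumID [set z : C | 0 < Im z]) // addeC; congr (_ + _)%E; last first.
  by congr esum; apply/seteqP; split=> z /=; [case | move=> h; split=> //; exact: ltW].
rewrite (esumID [set z : C | z < 0]) // -addeA; congr (_ + _)%E.
  congr esum; apply/seteqP; split=> z /=; first by case.
  move=> z0; have := z0; rewrite {1}ltcE /= => /andP[/eqP <- rz].
  by rewrite lexx ltxx.
rewrite (esumID [set 0 : C]) //; congr (_ + _)%E.
  rewrite -[RHS](esum_set1 (t := 0)) //; congr esum; apply/seteqP.
  split=> z /=; first by case.
  by move=> ->; rewrite !ltxx lexx.
congr esum; apply/seteqP; split=> z /=.
  move=> [[[iz /negP niz] /negP nz] z0]; rewrite !ltcE /= -!leNgt in niz nz *.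
  have im : Im z = 0 by apply/le_anti; rewrite niz iz.
  rewrite im eqxx /= -leNgt in nz *; rewrite lt_neqAle nz andbT.
  by apply/eqP => rz; apply: z0; apply: complexP; rewrite ?im.
rewrite !ltcE /= => /andP[/eqP im rz]; rewrite im lexx ltxx; split=> [|z0].
  by split=> // /andP[_ /(lt_trans rz)]; rewrite ltxx.
by rewrite z0 /= ltxx in rz.
Qed.
End UpperHalfPlane.

Section Pencil.
Variables (R : realType) (X : completeNormedModType R[i]).
Variable (ip : X -> X -> R[i]).
Hypothesis hip : inner_product ip.
Local Notation C := R[i].
Local Notation hI := (ip_herm hip).
Local Notation n2 := (qf ip).
Implicit Types (u v w f : X).

Lemma projE V u w : subspace V -> V w -> orthocomplement ip V (u - w) ->
  Defs.proj ip V u = w.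
Proof.
move=> sV Vw ow; rewrite /Defs.proj; case: xgetP => [v _ [Vv ov]|/(_ w)[]//].
apply/eqP; rewrite -subr_eq0; apply/eqP.
apply: (ip_self_eq0 hip (V := V)) => [|x Vx]; first exact: subspaceB.
have -> : v - w = (u - w) - (u - v) by rewrite opprB [RHS]addrC addrA subrK.
by rewrite (hermBl hI) ow // ov // subrr.
Qed.

(** The tests are bases of the eigenspaces, listed one after the other. *)
Lemma eigenvector_tests (L : operator X) (s : seq R) :
  (forall l, l \in s -> (alg_mult L (op_id setT) l%:C < +oo)%E) ->
  exists m (k : 'I_m -> X), forall u, (forall j, ip u (k j) = 0) ->
    forall l x, l \in s -> dom L x -> L x = l%:C *: x -> ip u x = 0.
Proof.
elim: s => [|l s IH] hs; first by exists 0%N, (fun=> 0).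
have [|m [k hk]] := IH; first by move=> x xs; apply: hs; rewrite in_cons xs orbT.
have [n [g [_ _ hg]]] := ldim_fin_basis (hs l (mem_head _ _)).
exists (m + n)%N, (fcat k g) => u hu l' x.
have hl i : ip u (k i) = 0.
  by have := hu (lshift n i); rewrite /fcat (unsplitK (inl i)).
have hr i : ip u (g i) = 0.
  by have := hu (rshift m i); rewrite /fcat (unsplitK (inr i)).
rewrite in_cons => /orP[/eqP -> dx Lx|]; last exact: hk.
have [->|x0] := eqVneq x 0; first exact: (herm0r hI).
have [|c ->] := hg x.
  by apply: sub_lspan; exists 0%N, (fun=> x); split=> //; exists 0%N.
by rewrite (herm_sumr hI) big1 // => i _; rewrite (hermZr hI) hr mulr0.
Qed.

Section Minus.
Variables (Lm : operator X) (omega_m : R).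
Hypothesis Lm_sa : self_adjoint ip setT Lm.
Hypothesis omega_m_gt0 : 0 < omega_m.
Hypothesis P1m : essential_spectrum_assumption ip Lm omega_m.
Hypothesis P2m : discrete_spectrum_assumption Lm.
Local Notation H := (spaceH ip Lm).

Lemma spaceH_subspace : subspace H. Proof. exact: orthocomplement_subspace. Qed.
Lemma spaceH_closed : nclosed ip H. Proof. exact: orthocomplement_closed. Qed.

Lemma projH_linear : exists P : {linear X -> X},
  [/\ forall u, H (P u), forall u, H u -> P u = u, symmetric_op ip P
    & forall u, projH ip Lm u = P u].
Proof.
have [P [HP PH Pip]] := orthogonal_projection hip spaceH_subspace spaceH_closed.
exists P; split=> // [u v|u].
  by rewrite (herm_conj hI v) -Pip // -(herm_conj hI) Pip.
apply: projE; [exact: spaceH_subspace | exact: HP | move=> v Hv].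
by rewrite (hermBl hI) Pip // subrr.
Qed.

(** As [omega_m] is positive, [0] is isolated in the spectrum of [Lm] or regular;
    hence the part of [Lm] in the complement of its kernel has a bounded
    inverse. *)
Lemma opK_linear : exists K : {linear X -> X},
  [/\ forall u, H (K u), symmetric_op ip K, bounded_op ip K,
      forall f, H f -> dom Lm (K f) /\ Lm (K f) = f
    & forall f, H f -> dom (opK ip Lm) f /\ opK ip Lm f = K f].
Proof.
have sH := spaceH_subspace; have cH := spaceH_closed.
have [s [regs _]] := spectrum_below hip P1m P2m.
have symL := sa_symmetric Lm_sa; have linL := sa_linear Lm_sa.
have neg : - omega_m < 0 by rewrite oppr_lt0.
have [e e0 he] := isolated_in_list [seq x - omega_m | x <- s] neg.
have reg0 : regular ip (dom Lm) Lm (remove_eigenvectors ip (dom Lm) Lm setT 0) 0.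
  apply: (isolated_point_removed hip linL symL (e := e)) => // w we w0.
  have [||w1 w2] := he (w - omega_m).
  - by case/andP: we => w1 w2; apply/andP; split; lra.
  - by apply: contra_neq w0 => h; lra.
  - apply: regs; first by lra.
    by apply: contra w2 => ws; apply/mapP; exists w.
have remE u : remove_eigenvectors ip (dom Lm) Lm setT 0 u <-> H u.
  split=> [[_ h] k [dk k0]|h]; first by apply: h => //; rewrite scale0r.
  by split=> // k _ dk; rewrite scale0r => k0; apply: h.
have [sur [c c0 lb]] := reg0.
pose D := [set u | H u /\ dom Lm u].
have [||||||K [DK LK KL [symK bdK] _]] := inverse_operator hip (V := H) (D := D) (T := Lm) sH cH.
- by move=> u [].
- move=> a u v [Hu du] [Hv dv]; have [d l] := linL a u v du dv.
  by split=> //; split=> //; exact: sH.2.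
- by move=> u [Hu du] k [dk k0]; rewrite symL // k0 (herm0r hI).
- by move=> u v [_ du] [_ dv]; exact: symL.
- move=> f /remE /sur[u [/remE Hu du]]; rewrite scale0r subr0 => <-.
  by exists u.
- exists c => // u [Hu du]; have /remE ru := Hu.
  by have := lb u ru du; rewrite scale0r subr0.
have HK u : H (K u) by case: (DK u).
have LKf f : H f -> dom Lm (K f) /\ Lm (K f) = f.
  by move=> Hf; split; [case: (DK f) | exact: LK].
exists K; split=> // f Hf.
have [P [HP PH _ pP]] := projH_linear.
have pf : projH ip Lm f = f by rewrite pP PH.
have [dKf LKf'] := LKf f Hf.
split; first by split=> //; exists (K f); rewrite ?pf.
rewrite /= pf; case: xgetP => [v _ [dv Lv]|/(_ (K f))[]//].
apply: projE => // k Hk; rewrite (herm_conj hI); suff -> : ip k (v - K f) = 0 by rewrite conjc0.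
apply: Hk; have [d l] := linL (-1) (K f) v dKf dv.
rewrite scaleN1r addrC in d l; split=> //.
by rewrite l Lv LKf' scaleN1r addNr.
Qed.

Variable K : {linear X -> X}.
Hypothesis HK : forall u, H (K u).
Hypothesis LK : forall f, H f -> dom Lm (K f) /\ Lm (K f) = f.

Lemma opK_injective f : H f -> K f = 0 -> f = 0.
Proof.
move=> Hf K0; have [d <-] := LK Hf; rewrite K0 in d *.
have [_ l] := sa_linear Lm_sa (-1) d d.
by rewrite scaler0 addr0 scaleN1r addNr in l.
Qed.

(** With [u = K f] the form [(K f, f)] is [(u, Lm u)], and it is nonnegative if [u] is
    orthogonal to the eigenvectors of [Lm] for negative eigenvalues. *)
Lemma opK_index : exists k, negative_index ip H K k.
Proof.
have [s [regs fins]] := spectrum_below hip P1m P2m.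
have [m [k hk]] := eigenvector_tests fins.
have symL := sa_symmetric Lm_sa; have linL := sa_linear Lm_sa.
apply: (@finite_negative_index _ _ ip H K m (fun j u => ip (K u) (k j))).
- exact: spaceH_subspace.
- by move=> j a u v; rewrite linearP (hermDl hI) (hermZl hI).
- move=> u Hu hu; have [d l] := LK Hu.
  have -> : Re (ip (K u) u) = Re (ip (Lm (K u)) (K u)).
    by rewrite l [RHS]/= (herm_conj hI) cRe_conj.
  apply: (nonneg_off_eigenvectors hip linL symL (s := s) (V := setT)) => //.
    by move=> w w0; apply: regs; exact: lt_trans w0 _.
  by move=> l' x ls dx Lx; exact: (hk _ hu l').
Qed.

Lemma neg_dim_opK k : symmetric_op ip K -> bounded_op ip K ->
  (forall f, H f -> dom (opK ip Lm) f /\ opK ip Lm f = K f) ->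
  negative_index ip H K k -> neg_dim ip Lm (opK ip Lm) = k%:R%:E.
Proof.
move=> symK bdK opKE iK; have [P [HP PH symP _]] := projH_linear.
have Re_neq0 (z : C) : Re z < 0 -> z != 0 by apply: contraTneq => ->; rewrite ltxx.
have domH u : dom (opK ip Lm) u -> H u by case.
apply: (negative_eigenspace_dim hip spaceH_subspace spaceH_closed symK bdK HK
  opK_injective HP PH symP iK (iv := fun z => z^-1)).
- by move=> u v /domH/opKE[_ ->] /domH/opKE[_ ->].
- by move=> z _; rewrite invrK.
- by move=> z z0; rewrite cRe_inv pmulr_llt0 // invr_gt0 sqm_gt0 ?Re_neq0.
- by move=> z z0; rewrite cIm_inv z0 oppr0 mul0r.
- move=> z u /Re_neq0 z0; split=> [[/domH Hu]|[Hu h]]; have [du e] := opKE _ Hu.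
    by rewrite e => ->; rewrite scalerA mulVf // scale1r.
  by split=> //; rewrite e [in RHS]h scalerA mulfV // scale1r.
- move=> w /Re_neq0 w0 sur [c c0 lb]; split.
    move=> f Hf; have [|u Hu hu] := sur (- w^-1 *: f).
      exact: (subspaceZ spaceH_subspace).
    have [du e] := opKE _ Hu; exists u; rewrite // e.
    apply: (scalerI (a := - w^-1)); first by rewrite oppr_eq0 invr_eq0.
    by rewrite -hu scalerBr scaleNr scalerA mulNr mulVf // scaleN1r opprK addrC.
  exists (Num.sqrt (c * sqm w^-1)) => u /domH Hu; have [_ e] := opKE _ Hu.
  have m0 : 0 <= c * sqm w^-1 by rewrite mulr_ge0 ?sqm_ge0.
  apply: (norm_le_n2 hip); rewrite ?sqrtr_ge0 // sqr_sqrtr // -mulrA -(qfZ hI).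
  rewrite scalerBr scalerA mulVf // scale1r e (qfBC hI); exact: lb.
Qed.

Section Plus.
Variables (Lp : operator X) (omega_p delta : R).
Hypothesis Lp_sa : self_adjoint ip setT Lp.
Hypothesis omega_p_ge0 : 0 <= omega_p.
Hypothesis P1p : essential_spectrum_assumption ip Lp omega_p.
Hypothesis P2p : discrete_spectrum_assumption Lp.
Hypothesis delta_gt0 : 0 < delta.
Hypothesis AK_invertible : resolvent_set H (opAK ip Lp Lm delta) 0.
Hypothesis symK : symmetric_op ip K.
Hypothesis opKE : forall f, H f -> dom (opK ip Lm) f /\ opK ip Lm f = K f.
Local Notation T := (opAK ip Lp Lm delta).

Let opA_dom u : dom (opA ip Lp Lm) u -> H u. Proof. by case. Qed.

Let opAKE u : dom T u <-> dom (opA ip Lp Lm) u.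
Proof. by split=> [[]|du] //; split=> //; exact: (opKE (opA_dom du)).1. Qed.

Let opAK_app u : dom T u -> T u = opA ip Lp Lm u + delta%:C *: K u.
Proof. by move=> /opAKE/opA_dom Hu; rewrite -(opKE Hu).2. Qed.

Let opAK_props : [/\ forall a u v, dom T u -> dom T v ->
     dom T (a *: u + v) /\ T (a *: u + v) = a *: T u + T v,
   forall u, dom T u -> H (T u)
 & forall u v, dom T u -> dom T v -> ip (T u) v = ip u (T v)].
Proof.
have sH := spaceH_subspace; have [P [HP PH symP pP]] := projH_linear.
have symL := sa_symmetric Lp_sa; have linL := sa_linear Lp_sa.
have dH u : dom T u -> H u by move=> /opAKE/opA_dom.
have dL u : dom T u -> dom Lp u by move=> /opAKE [Hu]; rewrite pP PH.
have TE u : dom T u -> T u = P (Lp u) + delta%:C *: K u.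
  by move=> du; rewrite opAK_app // /= !pP [P u]PH //; exact: dH.
split=> [a u v du dv|u du|u v du dv].
- have [d l] := linL a u v (dL u du) (dL v dv).
  have dT : dom T (a *: u + v).
    apply/opAKE; split; first by apply: sH.2; exact: dH.
    by rewrite pP PH //; apply: sH.2; exact: dH.
  split=> //; rewrite !TE // l (linearP P) (linearP K).
  by rewrite !scalerDr !scalerA mulrC addrACA.
- by rewrite TE //; apply: (subspaceD sH) => //; exact: (subspaceZ sH).
- rewrite !TE // (hermDl hI) (hermDr hI) (hermZl hI) (hermZr hI) symP symK.
  rewrite -[ip u (P _)]symP (PH _ (dH _ du)) (PH _ (dH _ dv)) (symL _ _ (dL _ du) (dL _ dv)).
  by congr (_ + _ * _); apply: complexP; rewrite /= ?oppr0.
Qed.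

Lemma opAK_inverse : exists G : {linear X -> X},
  [/\ forall u, dom T (G u), symmetric_op ip G, bounded_op ip G,
      forall f, H f -> T (G f) = f & forall u, dom T u -> G (T u) = u].
Proof.
have [linT HT symT] := opAK_props; have [sur [c lb]] := AK_invertible.
have [||||||G [DG TG GT [symG bdG] _]] :=
  inverse_operator hip (V := H) (D := dom T) (T := T) spaceH_subspace spaceH_closed.
- by move=> u /opAKE/opA_dom.
- exact: linT.
- exact: HT.
- exact: symT.
- by move=> f /sur[u du]; rewrite scale0r subr0 => <-; exists u.
- exists (c ^+ 2) => [|u du]; first exact: sqr_ge0.
  by have := lb u du; rewrite scale0r subr0 => /(n2_le_norm hip).
by exists G.
Qed.

Variable G : {linear X -> X}.
Hypothesis domG : forall u, dom T (G u).
Hypothesis symG : symmetric_op ip G.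
Hypothesis bdG : bounded_op ip G.
Hypothesis TG : forall f, H f -> T (G f) = f.
Hypothesis GT : forall u, dom T u -> G (T u) = u.

Lemma opAK_inverse_in u : H (G u). Proof. by have /opAKE/opA_dom := domG u. Qed.

Lemma opAK_inverse_injective f : H f -> G f = 0 -> f = 0.
Proof.
move=> Hf G0; have := TG Hf; have := domG f; rewrite G0 => d <-.
have [linT _ _] := opAK_props; have [_ l] := linT (-1) 0 0 d d.
by rewrite scaler0 addr0 scaleN1r addNr in l.
Qed.

Lemma opA_inverse u : dom (opA ip Lp Lm) u -> u = G (opA ip Lp Lm u + delta%:C *: K u).
Proof. by move=> /opAKE du; rewrite -opAK_app // GT. Qed.

Lemma opA_inverseK w : H w -> dom (opA ip Lp Lm) (G w) /\
  opA ip Lp Lm (G w) + delta%:C *: K (G w) = w.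
Proof. by move=> Hw; split; [exact/opAKE | rewrite -opAK_app // TG]. Qed.

(** With [u = G f] the form [(G f, f)] is [(u, Lp u) + delta (K u, u)]; the first term
    is nonnegative if [u] is orthogonal to the negative eigenvectors of [Lp], the
    second one if [u] is orthogonal, for the form of [K], to a maximal negative
    family. *)
Lemma opAK_index k : negative_index ip H K k ->
  exists k', negative_index ip H G k'.
Proof.
move=> [[e ne] maxe]; have [P [HP PH symP pP]] := projH_linear.
have [s [regs fins]] := spectrum_below hip P1p P2p.
have [m [x hx]] := eigenvector_tests fins.
have symL := sa_symmetric Lp_sa; have linL := sa_linear Lp_sa.
apply: (@finite_negative_index _ _ ip H G (m + k)
  (fun j u => ip (G u) (fcat x (fun i => K (e i)) j))).
- exact: spaceH_subspace.
- by move=> j a u v; rewrite linearP (hermDl hI) (hermZl hI).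
- move=> f Hf hu; set u := G f.
  have hl i : ip u (x i) = 0.
    by have := hu (lshift k i); rewrite /fcat (unsplitK (inl i)).
  have hr i : ip (K u) (e i) = 0.
    by have := hu (rshift m i); rewrite /fcat (unsplitK (inr i)) -symK.
  have /opAKE [Hu] := domG f; rewrite pP PH // => dLu.
  have fE : f = P (Lp u) + delta%:C *: K u.
    have h := TG Hf; rewrite opAK_app // in h.
    by rewrite -[LHS]h /= !pP [P (G f)]PH.
  have -> : Re (ip u f) = Re (ip (Lp u) u) + delta * qf (krein_form ip K) u.
    rewrite {1}fE (hermDr hI) (hermZr hI) cReD -symP PH // cReM /= oppr0 mul0r subr0.
    by congr (_ + _ * _); rewrite /qf /krein_form (herm_conj hI) cRe_conj.
  apply: addr_ge0; last first.
    apply: mulr_ge0; first exact: ltW.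
    exact: (eperp_ge0 hip symK ne maxe).
  apply: (nonneg_off_eigenvectors hip linL symL (s := s) (V := setT)) => //.
    by move=> w w0; apply: regs; exact: lt_le_trans w0 _.
  by move=> l y ls dy Ly; exact: (hx _ hl l).
Qed.

Lemma neg_dim_opAK k : negative_index ip H G k -> neg_dim ip Lm T = k%:R%:E.
Proof.
move=> iG; have [P [HP PH symP _]] := projH_linear.
have [linT HT symT] := opAK_props.
apply: (negative_eigenspace_dim hip spaceH_subspace spaceH_closed symG bdG
  opAK_inverse_in opAK_inverse_injective HP PH symP iG (iv := id)) => //.
- move=> z u _; split=> [[du Tu]|[Hu h]].
    split; first by move/opAKE/opA_dom: du.
    by rewrite -linearZ -Tu GT.
  have uG : u = G (z *: u) by rewrite linearZ.
  have Hzu : H (z *: u) by exact: (subspaceZ spaceH_subspace).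
  by split; rewrite {1}uG // TG.
- move=> w _ sur [c c0 lb]; split.
    move=> f Hf; have [g Hg hg] := sur f Hf.
    by exists (G g) => //; rewrite TG.
  have [d d0 hd] := bdG; have m0 : 0 <= d * c by exact: mulr_ge0.
  exists (Num.sqrt (d * c)) => u du.
  apply: (norm_le_n2 hip); rewrite ?sqrtr_ge0 // sqr_sqrtr // -mulrA.
  rewrite -{1}[u]GT //; apply: (le_trans (hd _)); rewrite ler_wpM2l //.
  by have := lb (T u) (HT u du); rewrite GT.
Qed.

End Plus.
End Minus.
End Pencil.

(** * The count of eigenvalues *)

Theorem theorem3 (R : realType) (X : completeNormedModType R[i])
  (ip : X -> X -> R[i]) (Lp Lm : operator X) (omega_p omega_m delta : R)
  (ip_inner : inner_product ip)
  (Lp_sa : self_adjoint ip setT Lp)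
  (Lm_sa : self_adjoint ip setT Lm)
  (omega_p_ge0 : 0 <= omega_p)
  (omega_m_gt0 : 0 < omega_m)
  (P1p : essential_spectrum_assumption ip Lp omega_p)
  (P1m : essential_spectrum_assumption ip Lm omega_m)
  (P2p : discrete_spectrum_assumption Lp)
  (P2m : discrete_spectrum_assumption Lm)
  (delta_gt0 : 0 < delta)
  (delta_lt : forall z : R[i],
    is_eigenvalue (opA ip Lp Lm) (opK ip Lm) z -> z < 0 -> delta%:C < `|z|)
  (omega_AK_gt0 : exists2 omega : R, 0 < omega &
    forall z, ac_spectrum ip (spaceH ip Lm) (opAK ip Lp Lm delta) z ->
      omega%:C <= z)
  (AK_invertible :
    resolvent_set (spaceH ip Lm) (opAK ip Lp Lm delta) 0)
  (embedded_simple : forall z, pencil_embedded_eigenvalues ip Lp Lm z ->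
    alg_mult (opA ip Lp Lm) (opK ip Lm) z = 1%E) :
  (Np_neg ip Lp Lm + Nn_zero ip Lp Lm + Nn_pos ip Lp Lm + Nc_plus ip Lp Lm
     = neg_dim ip Lm (opAK ip Lp Lm delta))%E /\
  (Nn_neg ip Lp Lm + Nn_zero ip Lp Lm + Nn_pos ip Lp Lm + Nc_plus ip Lp Lm
     = neg_dim ip Lm (opK ip Lm))%E.
Proof.
have sH := spaceH_subspace ip_inner Lm; have cH : nclosed ip (spaceH ip Lm) := spaceH_closed ip_inner (Lm := Lm).
have [K [HK symK bdK LK opKE]] := opK_linear ip_inner Lm_sa omega_m_gt0 P1m P2m.
have injK u := @opK_injective _ _ _ _ Lm_sa _ LK u.
have [kK iK] := opK_index ip_inner Lm_sa omega_m_gt0 P1m P2m LK.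
have [G [domG symG bdG TG GT]] :=
  opAK_inverse ip_inner HK Lp_sa AK_invertible symK opKE.
have HG u : spaceH ip Lm (G u) by exact: (opAK_inverse_in opKE domG).
have injG u := @opAK_inverse_injective _ _ _ ip_inner _ _ HK _ _ Lp_sa symK opKE _ domG TG u.
have [kG iG] := opAK_index ip_inner Lp_sa omega_p_ge0 P1p P2p delta_gt0 symK
  opKE domG TG iK.
rewrite (neg_dim_opK ip_inner Lm_sa HK LK symK bdK opKE iK).
rewrite (neg_dim_opAK ip_inner HK Lp_sa symK opKE domG symG bdG TG GT iG).
have domA : dom (opA ip Lp Lm) `<=` spaceH ip Lm by move=> u [].
have domB : dom (opK ip Lm) = spaceH ip Lm.
  by apply/seteqP; split=> u; [case | move=> /opKE[]].
have BK u : spaceH ip Lm u -> opK ip Lm u = K u by move=> /opKE[].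
have AG u : dom (opA ip Lp Lm) u -> u = G (opA ip Lp Lm u + delta%:C *: K u).
  exact: (opA_inverse opKE GT).
have GA w : spaceH ip Lm w -> dom (opA ip Lp Lm) (G w) /\
    opA ip Lp Lm (G w) + delta%:C *: K (G w) = w.
  exact: (opA_inverseK opKE domG TG).
have genE z := gen_eigenspaceE sH HK HG domA domB BK AG GA z.
have eigE z := is_eigenvalueP sH HK HG domA domB BK AG GA z.
(* the pencil, and the pencil with the two operators interchanged *)
pose F s z := max_family ip K G s (z + delta%:C).
pose F' s z := max_family ip G K s (z + delta%:C).
have F_ge0 s z : (0 <= F s z)%E by exact: max_family_ge0.
have F'_ge0 s z : (0 <= F' s z)%E by exact: max_family_ge0.
pose eig z := is_eigenvalue (opA ip Lp Lm) (opK ip Lm) z.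
have no_family s z n : ~ eig z -> signed_root_family ip K G s (z + delta%:C) n -> n = 0%N.
  case: n => // n nz [v [Ev iv _]]; exfalso; apply/nz/eigE.
  by exists (v ord0); [exact: lin_indep_neq0 | exact: Ev].
have F0 s z : ~ eig z -> F s z = 0%E.
  move=> nz; apply/le_anti; rewrite F_ge0 andbT; apply: max_family_le => n /no_family.
  by move=> /(_ nz) ->.
have F'0 s z : ~ eig z -> F' s z = 0%E.
  move=> nz; apply/le_anti; rewrite F'_ge0 andbT; apply: max_family_le => n hn.
  have h0 : signed_root_family ip G K 0 (z + delta%:C) n.
    by rewrite -[X in signed_root_family _ _ _ X](mul0r s); exact: signed_root_family_scale.
  by rewrite (no_family _ _ _ nz (swap_dimension sH HK injG h0)).
have restrict (D : set R[i]) (f g : R[i] -> \bar R) :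
    (forall z, eig z -> D z -> f z = g z) -> (forall z, ~ eig z -> g z = 0%E) ->
    esum [set z | eig z /\ D z] f = esum D g.
  move=> fg g0; rewrite -[RHS](esum_subset (E := eig)) => [|z _ /g0 //].
  by apply: eq_esum => z [ez Dz]; exact: fg.
have kreinE z W u : W `<=` gen_eigenspace (opA ip Lp Lm) (opK ip Lm) z -> W u ->
    krein ip Lm u u = (qf (krein_form ip K) u)%:C.
  move=> WE /WE; rewrite genE => /(root_space_in sH HG) Hu.
  by rewrite -(hermE (krein_herm ip_inner symK)) /krein BK.
have NnE z : Nn ip Lp Lm z = F 1 z.
  rewrite /F -(ldim_sup G _ _ symK) /Nn -genE; congr (ereal_sup (_ @` _)).
  apply/seteqP; split=> W [sW WE hW]; split=> // u Wu; have := hW u Wu.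
    by rewrite (kreinE z W) // mul1r -lecR.
  by rewrite (kreinE z W) // mul1r -lecR.
have NpE z : Np ip Lp Lm z = F (-1) z.
  rewrite /F -(ldim_sup G _ _ symK) /Np -genE; congr (ereal_sup (_ @` _)).
  apply/seteqP; split=> W [sW WE hW]; split=> // u Wu; have := hW u Wu.
    by rewrite (kreinE z W) // mulN1r oppr_le0 -lecR.
  by rewrite (kreinE z W) // mulN1r oppr_le0 -lecR.
have algE z : alg_mult (opA ip Lp Lm) (opK ip Lm) z = F 0 z.
  rewrite /alg_mult genE; apply/le_anti/andP; split.
    apply: ldim_le => n v Ev iv; apply: max_family_ge; exists v; split=> // c.
    by rewrite mul0r.
  by apply: max_family_le => n [v [Ev iv _]]; exact: ldim_ge Ev iv.
have neg (z : R[i]) : z < 0 -> Im z = 0 /\ Re z < 0 by rewrite ltcE /= => /andP[/eqP <-].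
have pos (z : R[i]) : 0 < z -> Im z = 0 /\ 0 < Re z by rewrite ltcE /= => /andP[/eqP <-].
have ImD z : Im (z + delta%:C) = Im z by rewrite cImD addr0.
have ReD z : Re (z + delta%:C) = Re z + delta by rewrite cReD.
(* on the nonnegative axis the translated parameter is positive *)
have swap_ge0 z : Im z = 0 -> 0 <= Re z -> F 1 z = F' 1 z.
  move=> im re; apply: (max_family_swap ip_inner sH) => //; right.
  have mu0 : 0 < Re z + delta by exact: ltr_wpDl.
  split; first by rewrite ImD.
    exists (Re z + delta)^-1; first by rewrite invr_ge0 ltW.
    by rewrite ReD mul1r mulVf // gt_eqF.
  exists (Re z + delta)^-1; first by rewrite invr_ge0 ltW.
  by rewrite ReD mul1r mulVf // gt_eqF.
(* and on the negative eigenvalues it is negative, as [delta < |z|] *)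
have swap_neg z : eig z -> z < 0 -> F (-1) z = F' 1 z.
  move=> ez z0; have [im re] := neg z z0.
  have mu0 : Re z + delta < 0.
    have := delta_lt z ez z0; rewrite ltr0_norm // ltcE /= => /andP[_].
    by rewrite cReN => h; lra.
  apply: (max_family_swap ip_inner sH) => //; right; split; first by rewrite ImD.
    exists (- (Re z + delta)^-1); first by rewrite oppr_ge0 invr_le0 ltW.
    by rewrite ReD mul1r mulNr mulVf // lt_eqF.
  exists (- (Re z + delta)^-1); first by rewrite oppr_ge0 invr_le0 ltW.
  by rewrite ReD mulN1r mulrNN mulVf // lt_eqF.
have swap_complex z : F 0 z = F' 0 z.
  by apply: (max_family_swap ip_inner sH) => //; left.
split.
  rewrite -(dimension_sum ip_inner sH cH symG symK bdG HG HK injG injK iG delta).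
  rewrite esum_closed_upper_half => [|z]; last exact: F'_ge0.
  congr (_ + _ + _ + _)%E.
  - apply: restrict => z ez; last exact: F'0.
    by move=> z0; have [im _] := neg z z0; rewrite NpE swap_neg // im eqxx.
  - by rewrite /Nn_zero NnE swap_ge0 //= eqxx.
  - apply: restrict => z ez; last exact: F'0.
    by move=> /pos[im re]; rewrite NnE swap_ge0 ?ltW // im eqxx.
  - apply: restrict => z ez; last exact: F'0.
    by move=> im; rewrite algE swap_complex gt_eqF.
rewrite -(dimension_sum ip_inner sH cH symK symG bdK HK HG injK injG iK delta).
rewrite esum_closed_upper_half => [|z]; last exact: F_ge0.
congr (_ + _ + _ + _)%E.
- apply: restrict => z ez; last exact: F0.
  by move=> /neg[im _]; rewrite NnE im eqxx.
- by rewrite /Nn_zero NnE /= eqxx.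
- apply: restrict => z ez; last exact: F0.
  by move=> /pos[im _]; rewrite NnE im eqxx.
- apply: restrict => z ez; last exact: F0.
  by move=> im; rewrite algE gt_eqF.
Qed.
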